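(* Let $\mathcal{R}$ be the class of all matroids that are either binary or can be obtained from a binary matroid by relaxing a circuit-hyperplane. Then the set of excluded minors for $\mathcal{R}$ is $$\{U_{2,5},\ U_{3,5},\ K,\ K^*,\ R_6,\ U_{2,4}\oplus U_{1,1},\ U_{2,4}\oplus U_{0,1}\}\cup\mathcal{D}.$$
   Context: Relaxation: if $H$ is a circuit and a hyperplane (a circuit-hyperplane) of a matroid $M$, the matroid on $E(M)$ whose bases are the bases of $M$ together with $H$ is said to be obtained from $M$ by relaxing $H$. $\mathcal{D}$ denotes the collection of all matroids obtained from a connected binary matroid $M$ having two disjoint circuit-hyperplanes $X,Y$ with $X\cup Y=E(M)$ by relaxing both $X$ and $Y$ (i.e. the matroid on $E(M)$ whose bases are the bases of $M$ together with $X$ and $Y$). $U_{m,n}$ is the uniform matroid of rank $m$ on $n$ elements. $K$ is the seven-element rank-2 matroid obtained from $U_{2,4}$ by adding one new element in parallel to each of three of its four elements; $K^*$ is its dual. $R_6$ is the six-element rank-3 matroid whose non-spanning circuits are exactly two disjoint triangles; equivalently $R_6\cong U_{2,4}\oplus_2 U_{2,4}$. *)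

(* Defs.v *)
From HB Require Import structures.
From mathcomp Require Import all_boot all_order all_algebra.
Set Implicit Arguments. Unset Strict Implicit. Unset Printing Implicit Defensive.
Import GRing.Theory.

Record matroid (T : finType) := Matroid {
  ground : {set T};
  bases : {set {set T}} }.

Definition is_matroid (T : finType) (M : matroid T) : Prop :=
  [/\ bases M != set0,
      (forall B, B \in bases M -> B \subset ground M) &
      (forall B1 B2 x, B1 \in bases M -> B2 \in bases M -> x \in B1 :\: B2 ->
         exists2 y, y \in B2 :\: B1 & y |: (B1 :\ x) \in bases M)].

Section MatroidNotions.
Variable T : finType.
Implicit Types (M : matroid T) (X Y C H F : {set T}).

Definition indep M X : bool := [exists B in bases M, X \subset B].

Definition rank M X : nat := \max_(Y in powerset X | indep M Y) #|Y|.

Definition circuit M C : bool :=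
  [&& C \subset ground M, ~~ indep M C & [forall e in C, indep M (C :\ e)]].

Definition flat M F : bool :=
  (F \subset ground M) &&
  [forall e in ground M :\: F, rank M F < rank M (e |: F)].

Definition hyperplane M H : bool :=
  flat M H && ((rank M H).+1 == rank M (ground M)).

Definition circuit_hyperplane M H : bool := circuit M H && hyperplane M H.

Definition relax M H : matroid T := Matroid (ground M) (H |: bases M).

Definition dual M : matroid T :=
  Matroid (ground M) [set ground M :\: B | B in bases M].

Definition connected M : Prop :=
  forall e f, e \in ground M -> f \in ground M -> e != f ->
    exists C, circuit M C /\ e \in C /\ f \in C.

Definition binary M : Prop :=
  exists n (f : T -> 'rV['F_2]_n),
    forall X, X \subset ground M -> (indep M X <-> free (map f (enum X))).

(* N is a minor of M (on the same carrier type):  N = M / C \ D with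
   C, D disjoint subsets of E(M) and E(N) = E(M) - (C u D). *)
Definition minor (N M : matroid T) : Prop :=
  ground N \subset ground M /\
  exists C, C \subset ground M :\: ground N /\
    forall X, X \subset ground N ->
      indep N X = (rank M (X :|: C) == #|X| + rank M C).

Definition proper_minor (N M : matroid T) : Prop :=
  minor N M /\ ground N != ground M.

Definition in_R M : Prop :=
  binary M \/
  exists M' : matroid T, [/\ is_matroid M', binary M' &
    exists H, circuit_hyperplane M' H /\
      ground M = ground M' /\ bases M = H |: bases M'].

Definition excluded_minor_R M : Prop :=
  [/\ is_matroid M, ~ in_R M &
      forall N, is_matroid N -> proper_minor N M -> in_R N].

Definition in_D M : Prop :=
  exists M' : matroid T, [/\ is_matroid M', binary M', connected M' &
    exists X Y, [/\ circuit_hyperplane M' X, circuit_hyperplane M' Y,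
      [disjoint X & Y] & X :|: Y = ground M'] /\
      ground M = ground M' /\ bases M = X |: (Y |: bases M')].

End MatroidNotions.

Definition iso (T T' : finType) (M : matroid T) (N : matroid T') : Prop :=
  exists f : T -> T',
    [/\ {in ground M &, injective f}, f @: ground M = ground N &
        forall X : {set T}, X \subset ground M -> (X \in bases M) = (f @: X \in bases N)].

Definition dsum (T1 T2 : finType) (M1 : matroid T1) (M2 : matroid T2)
  : matroid (T1 + T2)%type :=
  Matroid (inl @: ground M1 :|: inr @: ground M2)
          [set inl @: (B1 : {set T1}) :|: inr @: (B2 : {set T2}) | B1 in bases M1, B2 in bases M2].

Definition U (m n : nat) : matroid 'I_n :=
  Matroid [set: 'I_n] [set B : {set 'I_n} | #|B| == m].

(* K: U_{2,4} on {0,1,2,3} with 4,5,6 added in parallel to 0,1,2. *)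
Definition Kcls (i : 'I_7) : nat := if 4 <= i then i - 4 else i.
Definition K : matroid 'I_7 :=
  Matroid [set: 'I_7]
    [set B : {set 'I_7} | [exists a, exists b,
        (B == [set a; b]) && (Kcls a != Kcls b)]].
Definition Kstar : matroid 'I_7 := dual K.

(* R_6: rank 3 on 'I_6, non-spanning circuits exactly {0,1,2} and {3,4,5}. *)
Definition R6 : matroid 'I_6 :=
  Matroid [set: 'I_6]
    [set B : {set 'I_6} | (#|B| == 3) &&
       (B != [set i : 'I_6 | i < 3]) && (B != [set i : 'I_6 | 3 <= i])].

(* Main.v *)
Require Import Defs.
From mathcomp Require Import all_boot all_order all_algebra.
From Stdlib Require Import Classical_Prop.
From mathcomp Require Import zify.
Set Implicit Arguments. Unset Strict Implicit. Unset Printing Implicit Defensive.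
Import GRing.Theory.

(* Call a pair (C, Q) an octahedron of M if |Q| = 4 and C together with any two elements of Q is a basis; by Tutte's theorem
   M is binary iff it has no octahedron. A basis H is free if all its single exchanges are bases, i.e. if it arises by
   relaxing a circuit-hyperplane of the matroid with H removed from the bases. So M belongs to the class iff it has no
   octahedron or some free H lies in all of them, in the sense that H contains C and is contained in the union of C and Q.

   Let M be an excluded minor. A loop, a parallel pair or rank two forces M to be U_{2,4} + U_{0,1}, K or U_{2,5}, and dually.
   Otherwise, comparing octahedra with the free sets of M \ e and M / e, and excluding R_6 and U_{2,5}, U_{3,5}, one finds that
   every octahedron contains a free basis of M and that two distinct free bases are complementary. Since no single free basis
   lies in all octahedra there are exactly two, X and Y, and removing both from the bases leaves a connected binary matroid
   with circuit-hyperplanes X and Y.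

   Conversely, in a member of D both X and Y are free and every octahedron contains one of them; if M were in the class, then
   both would lie in every octahedron (C, Q), so that C would be empty, whereas connectedness forces rank at least three. For e
   in X, deleting e destroys the octahedra containing X, and contracting e destroys those containing Y. *)

(** Minors are handled inside [M]: a pair [(C0, D0)] stands for contracting [C0] and deleting [D0],
    and the bases of the minor are read off from those bases of [M] that contain [C0] and avoid
    [D0]. The obstacle is that [M] and its various minors may each need a different basis to be
    un-relaxed. What controls this is that a non-binary member of the class has no preferred basis:
    every free basis lying in one octahedron lies in all of them. Hence a free basis of [M] can be
    compared with an octahedron of [M] by passing to a one-element minor in which both survive. The
    calculations take place in the fundamental matrix of a free basis. It has no zero entry, so only
    the vanishing of 2x2 determinants has to be tracked, and on two fixed rows (or columns) this is
    an equivalence relation on columns (or rows). Excluding [U_{2,5}] and [U_{3,5}] bounds the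
    number of classes by two, while simplicity and cosimplicity supply nonvanishing determinants.
    The six-element case of rank three is tight: the comparison of two free bases needs rank or
    corank at least four, so it is treated separately. *)

Lemma mem_neq (T : finType) (A : {set T}) x y : x \in A -> y \notin A -> (x == y) = false.
Proof. by move=> xA; apply: contraNF => /eqP <-. Qed.

Lemma mem_neqC (T : finType) (A : {set T}) x y : x \in A -> y \notin A -> (y == x) = false.
Proof. by rewrite eq_sym; apply: mem_neq. Qed.

(* Rewrites membership and equality atoms with the hypotheses at hand. *)
Ltac atoms := rewrite ?eqxx ?orbT ?orbF ?andbT ?andbF /=; repeat (progress (match goal with
  | h : is_true (~~ (?a == ?b)) |- context [?a == ?b] => rewrite (negbTE h)
  | h : is_true (~~ (?a == ?b)) |- context [?b == ?a] => rewrite (eq_sym b a) (negbTE h)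
  | h : is_true (~~ (?a \in ?A)) |- context [?a \in ?A] => rewrite (negbTE h)
  | h : is_true (?a \in ?A) |- context [?a \in ?A] => rewrite h
  | h : is_true (?a \in ?A), h' : is_true (~~ (?b \in ?A)) |- context [?a == ?b] => rewrite (mem_neq h h')
  | h : is_true (?a \in ?A), h' : is_true (~~ (?b \in ?A)) |- context [?b == ?a] => rewrite (mem_neqC h h')
  end; rewrite ?eqxx ?orbT ?orbF ?andbT ?andbF /=)).

Ltac split_at z := repeat (progress (match goal with
  | |- context [z == ?a] => case: (eqVneq z a) => [?|?]; [subst z|]; atoms; try done
  | |- context [?a == z] => case: (eqVneq z a) => [?|?]; [subst z|]; atoms; try done
  end)).

Ltac set_eq := apply/setP; let z := fresh "z" in intro z; rewrite !inE; atoms; try done;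
  split_at z; try done; repeat (case: (_ \in _) => //=).

(** * Bases, duality, circuit-hyperplanes *)

Section Basics.
Variable T : finType.
Implicit Types (M N : matroid T) (B C D E H I X Y Q : {set T}).

Lemma exch M B1 B2 x : is_matroid M -> B1 \in bases M -> B2 \in bases M ->
  x \in B1 -> x \notin B2 ->
  exists y, [/\ y \in B2, y \notin B1 & y |: (B1 :\ x) \in bases M].
Proof.
case=> _ _ exM b1 b2 x1 x2.
have [|y] := exM _ _ x b1 b2; first by rewrite inE x2.
by rewrite inE => /andP[? ?] ?; exists y.
Qed.

Lemma base_sub M B : is_matroid M -> B \in bases M -> B \subset ground M.
Proof. by case=> _ sub _; apply: sub. Qed.

Lemma base_in M B x : is_matroid M -> B \in bases M -> x \in B -> x \in ground M.
Proof. by move=> mM /(base_sub mM)/subsetP; apply. Qed.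

Lemma card_swap B x y : x \in B -> y \notin B -> #|y |: (B :\ x)| = #|B|.
Proof. by move=> xB yB; rewrite cardsU1 !inE (negbTE yB) andbF (cardsD1 x B) xB. Qed.

Lemma card_bases M B1 B2 : is_matroid M ->
  B1 \in bases M -> B2 \in bases M -> #|B1| = #|B2|.
Proof.
move=> mM; have [n] := ubnP #|B1 :\: B2|; elim: n B1 => // n IHn B1 lt_n b1 b2.
have [s12|] := boolP (B1 \subset B2).
  suff -> : B1 = B2 by [].
  apply/eqP; rewrite eqEsubset s12; apply/subsetP=> y y2; apply/negPn/negP=> y1.
  have [z [z1 /negP[]]] := exch mM b2 b1 y2 y1.
  by rewrite (subsetP s12).
case/subsetPn=> x x1 x2; have [y [y2 y1 b]] := exch mM b1 b2 x1 x2.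
rewrite -(card_swap x1 y1); apply: IHn => //.
rewrite -ltnS (leq_trans _ lt_n) // ltnS; apply: proper_card.
apply/properP; split; last by exists x; rewrite !inE; atoms.
by apply/subsetP=> z; rewrite !inE => /andP[z2]; case/orP=> [/eqP zy|/andP[_ ->]]; rewrite ?z2 //; rewrite zy y2 in z2.
Qed.

(** Elements of [B0] outside [I :|: B] are exchanged one at a time for elements of [B]; each
    exchange shrinks that remainder and leaves [I] untouched. *)
Lemma extend M B0 B I : is_matroid M -> B0 \in bases M -> I \subset B0 ->
  B \in bases M ->
  exists B', [/\ B' \in bases M, I \subset B' & B' \subset I :|: B].
Proof.
move=> mM b0 sI bB.
have [n] := ubnP #|B0 :\: (I :|: B)|; elim: n B0 b0 sI => // n IHn B0 b0 sI lt_n.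
have [s|] := boolP (B0 \subset I :|: B); first by exists B0.
case/subsetPn=> x x0; rewrite inE => /norP[xI xB].
have [y [yB y0 b]] := exch mM b0 bB x0 xB.
apply: (IHn _ b).
  apply/subsetP=> z zI; rewrite !inE (subsetP sI) // andbT; apply/orP; right.
  by apply: contraTneq zI => ->.
rewrite -ltnS (leq_trans _ lt_n) // ltnS; apply: proper_card.
apply/properP; split.
  apply/subsetP=> z; rewrite !inE => /andP[/norP[zI zB] /orP[/eqP zy|/andP[_ z0]]].
    by move: zB; rewrite zy yB.
  by rewrite (negbTE zI) (negbTE zB).
by exists x; rewrite !inE; atoms.
Qed.

Lemma base_swap M B B' f : is_matroid M -> B \in bases M -> B' \in bases M ->
  f \in B' -> f \notin B -> B' \subset f |: B -> exists b, [/\ b \in B, b \notin B' & B' = f |: (B :\ b)].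
Proof.
move=> mM b b' fB' fB s; have [c cB cB'] : exists2 c, c \in B & c \notin B'.
  apply/subsetPn/negP=> sB; have : B == B' by rewrite eqEcard sB (card_bases mM b' b) /=.
  by move/eqP=> e; rewrite e fB' in fB.
exists c; split=> //; apply/eqP; rewrite eqEcard (card_bases mM b' b) cardsU1 !inE (negbTE fB) andbF.
rewrite /= [in X in _ <= X](cardsD1 c) cB leqnn andbT.
apply/subsetP=> z zB; have := subsetP s z zB; rewrite !inE; case: (eqVneq z c) => [zc|//].
by rewrite -zc zB in cB'.
Qed.

(** The exchange property of the dual, with the entering element prescribed. It comes from extending
    [x |: B1 :&: B2] by elements of [B1]; keeping the intersection forces the leaving element out of
    [B2]. *)
Lemma extend1 M B1 B2 x : is_matroid M -> B1 \in bases M -> B2 \in bases M ->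
  x \in B2 -> x \notin B1 ->
  exists y, [/\ y \in B1, y \notin B2 & x |: (B1 :\ y) \in bases M].
Proof.
move=> mM b1 b2 x2 x1.
have [|B' [b' sI sU]] := @extend M B2 B1 (x |: B1 :&: B2) mM b2 _ b1.
  by apply/subsetP=> z; rewrite !inE => /orP[/eqP->//|/andP[]].
have xB' : x \in B' by apply: (subsetP sI); rewrite !inE eqxx.
have [|y [y1 yB' e]] := base_swap mM b1 b' xB' x1.
  by apply: subset_trans sU _; rewrite -setUA setUS // subUset subsetIl subxx.
exists y; split=> //; last by rewrite -e.
by apply: contra yB' => y2; apply: (subsetP sI); rewrite !inE y1 y2 orbT.
Qed.

Lemma setDDK E B : B \subset E -> E :\: (E :\: B) = B.
Proof. by move=> s; rewrite setDDr setDv set0U; apply/setIidPr. Qed.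

Lemma base_dual M B : is_matroid M -> B \subset ground M ->
  (ground M :\: B \in bases (dual M)) = (B \in bases M).
Proof.
move=> mM sB; apply/imsetP/idP=> [[B' b' e]|b]; last by exists B.
by rewrite -(setDDK sB) e setDDK // (base_sub mM b').
Qed.

Lemma dual_base M X : is_matroid M -> X \in bases (dual M) ->
  ground M :\: X \in bases M /\ X \subset ground M.
Proof.
move=> mM /imsetP[B b ->]; rewrite setDDK ?(base_sub mM b) //; split=> //.
exact: subsetDl.
Qed.

Lemma dual_matroid M : is_matroid M -> is_matroid (dual M).
Proof.
move=> mM; have [ne _ _] := mM; split.
- have /set0Pn[B b] := ne; apply/set0Pn; exists (ground M :\: B).
  by rewrite base_dual // (base_sub mM b).
- by move=> B /(dual_base mM)[].
move=> X1 X2 x d1 d2; rewrite inE => /andP[xX2 xX1].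
have [b1 s1] := dual_base mM d1; have [b2 s2] := dual_base mM d2.
have xE := subsetP s1 _ xX1.
have [||y [y1 y2 b]] := @extend1 M _ _ x mM b1 b2; rewrite ?inE ?xX1 ?xX2 ?xE //.
move: y1 y2; rewrite !inE => /andP[yX1 yE]; rewrite yE andbT negbK => yX2.
exists y; first by rewrite inE yX1.
have -> : y |: X1 :\ x = ground M :\: (x |: (ground M :\: X1) :\ y).
  have sX z : z \in X1 -> z \in ground M := subsetP s1 z.
  apply/setP=> z; rewrite !inE; case: (eqVneq z x) => [?|zx] /=.
    by subst z; atoms.
  case: (eqVneq z y) => [->|] //=; atoms => //.
  by move: (sX z); case: (z \in X1) => /= [->|_] //; case: (z \in ground M).
by rewrite base_dual // (base_sub mM b).
Qed.

Lemma dualK M : is_matroid M -> dual (dual M) = M.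
Proof.
move=> mM; have mD := dual_matroid mM; case: M mM mD => E Bs mM mD.
rewrite {1}/dual /=; congr Matroid; apply/setP=> X; apply/idP/idP => [/imsetP[Y]|b].
  by case/(dual_base mM) => /= bY _ ->.
apply/imsetP; exists (E :\: X); last by rewrite setDDK // (base_sub mM b).
by move: (b); rewrite -(base_dual mM (base_sub mM b)).
Qed.

Lemma indepP M X : reflect (exists2 B, B \in bases M & X \subset B) (indep M X).
Proof. exact: exists_inP. Qed.

Lemma indep_base M B : B \in bases M -> indep M B.
Proof. by move=> b; apply/indepP; exists B. Qed.

Lemma indep_sub M X Y : X \subset Y -> indep M Y -> indep M X.
Proof. by move=> s /indepP[B b sB]; apply/indepP; exists B => //; apply: subset_trans sB. Qed.

Lemma indep0 M : is_matroid M -> indep M set0.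
Proof. by case=> /set0Pn[B b] _ _; apply/indepP; exists B; rewrite ?sub0set. Qed.

Lemma indep_card M B X : is_matroid M -> B \in bases M -> indep M X -> #|X| <= #|B|.
Proof. by move=> mM b /indepP[B' b' s]; rewrite (card_bases mM b b') subset_leq_card. Qed.

Lemma indep_full M B X : is_matroid M -> B \in bases M -> indep M X -> #|B| <= #|X| ->
  X \in bases M.
Proof.
move=> mM b /indepP[B' b' s] le; suff -> : X = B' by [].
by apply/eqP; rewrite eqEcard s (card_bases mM b' b).
Qed.

Lemma indep_aug M X Y : is_matroid M -> indep M X -> indep M Y -> #|X| < #|Y| ->
  exists y, [/\ y \in Y, y \notin X & indep M (y |: X)].
Proof.
move=> mM /indepP[B1 b1 s1] /indepP[B2 b2 s2] lt.
have [B [b sX sU]] := extend mM b1 s1 b2.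
have [s|/subsetPn[y yY yX]] := boolP (Y :&: B \subset X); last first.
  move: yY; rewrite inE => /andP[yY yB]; exists y; split=> //.
  by apply/indepP; exists B => //; rewrite subUset sub1set yB.
suff : #|B| < #|B| by rewrite ltnn.
have sB : B \subset X :|: (B2 :\: Y).
  apply/subsetP=> z zB; move: (subsetP sU z zB) (subsetP s z); rewrite !inE zB.
  by case: (z \in X) => //=; case: (z \in Y) => //= _; apply.
apply: leq_ltn_trans (subset_leq_card sB) _.
apply: leq_ltn_trans (leq_card_setU _ _) _.
rewrite cardsD (setIidPr s2) (card_bases mM b b2).
by have := subset_leq_card s2; lia.
Qed.

Lemma rank_ge M X Y : Y \subset X -> indep M Y -> #|Y| <= rank M X.
Proof. by move=> s i; apply: (leq_bigmax_cond (F := fun Y : {set T} => #|Y|)); rewrite powersetE s. Qed.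

Lemma rank_le M X n : (forall Y, Y \subset X -> indep M Y -> #|Y| <= n) -> rank M X <= n.
Proof. by move=> le; apply/bigmax_leqP=> Y /andP[]; rewrite powersetE => /le. Qed.

Lemma rank_ex M X : is_matroid M -> exists Y, [/\ Y \subset X, indep M Y & #|Y| = rank M X].
Proof.
move=> mM; have [|Y] := @eq_bigmax_cond _ [pred Y | (Y \in powerset X) && indep M Y] (fun Y : {set T} => #|Y|).
  by apply/card_gt0P; exists set0; rewrite !inE sub0set indep0.
by rewrite inE powersetE => /andP[s i] e; exists Y; split=> //; rewrite -e; apply: eq_bigl.
Qed.

Lemma rank_card M X : rank M X <= #|X|.
Proof. by apply: rank_le => Y s _; apply: subset_leq_card. Qed.

Lemma indep_rank M X : is_matroid M -> indep M X = (rank M X == #|X|).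
Proof.
move=> mM; apply/idP/eqP=> [i|e].
  by apply/eqP; rewrite eqn_leq rank_card rank_ge.
have [Y [s i c]] := rank_ex X mM; suff <- : Y = X by [].
by apply/eqP; rewrite eqEcard s c e leqnn.
Qed.

Lemma rank_ground M B : is_matroid M -> B \in bases M -> rank M (ground M) = #|B|.
Proof.
move=> mM b; apply/eqP; rewrite eqn_leq rank_ge ?indep_base ?(base_sub mM b) //.
by rewrite andbT; apply: rank_le => Y _; apply: indep_card.
Qed.

(** The set [H :\ u] is independent and spans the hyperplane, and a point off the flat raises its
    rank to that of [M]. *)
Lemma circuit_hyperplane_base M H u p : is_matroid M -> circuit_hyperplane M H ->
  u \in H -> p \in ground M -> p \notin H -> p |: (H :\ u) \in bases M.
Proof.
move=> mM /andP[/and3P[sH nH /forall_inP cH] /andP[/andP[_ /forall_inP fH] /eqP rH]] uH pE pH.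
have [/set0Pn[B b] _ _] := mM; rewrite (rank_ground mM b) in rH.
have rHc : rank M H = #|H :\ u|.
  apply/eqP; rewrite eqn_leq rank_ge ?subD1set ?cH // andbT.
  have := cardsD1 u H; rewrite uH add1n => e.
  by rewrite -ltnS -e ltn_neqAle rank_card -indep_rank // nH.
have [Y [sY iY cY]] := rank_ex (p |: H) mM.
have rp : #|H :\ u| < #|Y| by rewrite cY -rHc; apply: fH; rewrite inE pH.
have [y [yY yH i]] := indep_aug mM (cH _ uH) iY rp.
have := subsetP sY _ yY; rewrite !inE => /orP[/eqP e|yH'].
  by apply: indep_full mM b _ _; rewrite -?e // cardsU1 yH -rHc -rH.
have e : y = u by apply/eqP; move: yH; rewrite !inE yH' andbT negbK.
by rewrite e setD1K // (negbTE nH) in i.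
Qed.

(** The exchanges show that each [H :\ u] is independent and that each point outside [H] raises the
    rank to the full one. That [H] is neither empty nor the ground set supplies a [u] and a [p] for
    them. *)
Lemma circuit_hyperplaneI M H B : is_matroid M -> B \in bases M -> #|H| = #|B| ->
  H \subset ground M -> H \notin bases M -> H != set0 -> H != ground M ->
  (forall u p, u \in H -> p \in ground M -> p \notin H -> p |: (H :\ u) \in bases M) ->
  circuit_hyperplane M H.
Proof.
move=> mM b cH sH nH H0 HE ex.
have [u uH] := set0Pn _ H0.
have [p pE pH] : exists2 p, p \in ground M & p \notin H.
  by apply/subsetPn; apply: contra HE; rewrite eqEsubset sH.
have nI : ~~ indep M H by apply: contra nH => i; apply: indep_full mM b i _; rewrite cH.
have iD v : v \in H -> indep M (H :\ v).
  by move=> vH; apply: indep_sub (indep_base (ex v p vH pE pH)); rewrite subsetU1.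
have rH : (rank M H).+1 = #|B|.
  apply/eqP; rewrite eqn_leq -cH ltn_neqAle rank_card -indep_rank // nI /=.
  by rewrite (cardsD1 u) uH ltnS rank_ge ?subD1set ?iD.
apply/andP; split; first by rewrite /circuit sH nI /=; apply/forall_inP.
rewrite /hyperplane rH (rank_ground mM b) eqxx andbT /flat sH /=.
apply/forall_inP=> q; rewrite inE => /andP[qH qE]; rewrite rH -cH.
rewrite -(card_swap uH qH) rank_ge ?indep_base ?ex //.
by rewrite setUS // subD1set.
Qed.

(* Exchange in a rank-two contraction: if [b] is not a loop and [ac] is a basis, [b] is not parallel to both. *)
Lemma rank2_exchange M C a b c d : is_matroid M -> a |: (c |: C) \in bases M -> b |: (d |: C) \in bases M ->
  d \notin C -> d != b -> (a |: (b |: C) \in bases M) \/ (c |: (b |: C) \in bases M).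
Proof.
move=> mM b1 b2 dC db; have [|dX] := boolP (d \in a |: (c |: C)).
  rewrite !inE (negbTE dC) orbF => /orP[/eqP <-|/eqP <-]; [left|right]; by rewrite setUCA.
have [|y [y1 y2 b3]] := exch mM b2 b1 _ dX; first by rewrite !inE eqxx orbT.
have e : (b |: (d |: C)) :\ d = b |: C by set_eq.
rewrite e in b3; move: y1 y2; rewrite !inE => /or3P[/eqP <-|/eqP <-|->]; try by [left|right].
by rewrite !orbT.
Qed.

End Basics.

(** * Binary matroids and octahedra *)

Section Octahedra.
Variable T : finType.
Implicit Types (M N : matroid T) (B C D E H I X Y Q : {set T}).

(* The minor [M / C] restricted to [Q] is [U_{2,4}]. *)
Definition oct M C Q : Prop :=
  [/\ #|Q| = 4, [disjoint C & Q] &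
      forall x y, x \in Q -> y \in Q -> x != y -> x |: (y |: C) \in bases M].

Lemma card4P Q x y : #|Q| = 4 -> x \in Q -> y \in Q -> x != y ->
  exists z t, [/\ uniq [:: x; y; z; t] & Q = [set x; y; z; t]].
Proof.
move=> c xQ yQ xy.
have : #|Q :\ x :\ y| == 2.
  by have := cardsD1 x Q; have := cardsD1 y (Q :\ x); rewrite c xQ !inE yQ eq_sym xy => -> -[->].
case/cards2P=> z [t [zt e]].
have : z \in Q :\ x :\ y by rewrite e !inE eqxx.
have : t \in Q :\ x :\ y by rewrite e !inE eqxx orbT.
rewrite !inE => /and3P[ty tx tQ] /and3P[zy zx zQ].
exists z, t; split; first by rewrite /= !inE; atoms.
rewrite -(setD1K xQ); have : y \in Q :\ x by rewrite !inE yQ eq_sym xy.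
by move/setD1K <-; rewrite e -!setUA.
Qed.

Lemma card4_2 Q : #|Q| = 4 -> exists x y, [/\ x \in Q, y \in Q & x != y].
Proof. by move=> c; apply/card_gt1P; rewrite c. Qed.

Lemma card4E (x y z t : T) : uniq [:: x; y; z; t] -> #|[set x; y; z; t]| = 4.
Proof.
rewrite /= !inE => /and4P[/norP[xy /norP[xz xt]] /norP[yz yt] zt _].
by rewrite -!setUA !cardsU1 cards1 !inE; atoms.
Qed.

Lemma octI M C a b c d : uniq [:: a; b; c; d] -> a \notin C -> b \notin C -> c \notin C -> d \notin C ->
  a |: (b |: C) \in bases M -> a |: (c |: C) \in bases M -> a |: (d |: C) \in bases M ->
  b |: (c |: C) \in bases M -> b |: (d |: C) \in bases M -> c |: (d |: C) \in bases M ->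
  oct M C [set a; b; c; d].
Proof.
move=> u aC bC cC dC ab ac ad bc bd cd; split; first exact: card4E.
  rewrite disjoint_sym disjoint_subset; apply/subsetP=> z; rewrite !inE.
  by move=> /orP[/orP[/orP[]|]|] /eqP->.
by move=> x y; rewrite !inE => /orP[/orP[/orP[]|]|] /eqP-> /orP[/orP[/orP[]|]|] /eqP->;
  rewrite ?eqxx // => _; rewrite // setUCA.
Qed.

(** Boolean form of [oct], so that the existence of an octahedron can be decided. *)
Definition octb M C Q : bool := [&& #|Q| == 4, [disjoint C & Q] &
  [forall x in Q, [forall y in Q, (x != y) ==> (x |: (y |: C) \in bases M)]]].

Lemma octP M C Q : reflect (oct M C Q) (octb M C Q).
Proof.
apply: (iffP and3P) => [[/eqP c dj /forall_inP b]|[c dj b]].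
  by split=> // x y xQ yQ xy; apply: (implyP (forall_inP (b x xQ) y yQ)).
split=> //; first exact/eqP.
by apply/forall_inP=> x xQ; apply/forall_inP=> y yQ; apply/implyP=> xy; apply: b.
Qed.

(** The combinatorial shadow of the three-term Grassmann-Plücker relation: among the three
    splittings of [a, b, c, d] into two pairs, it cannot be that exactly one has both pairs
    completing [C] to a basis. *)
Lemma pairing_exchange M C a b c d : is_matroid M -> uniq [:: a; b; c; d] ->
  a \notin C -> b \notin C -> c \notin C -> d \notin C ->
  a |: (b |: C) \in bases M -> c |: (d |: C) \in bases M ->
  ((a |: (c |: C) \in bases M) && (b |: (d |: C) \in bases M)) ||
  ((a |: (d |: C) \in bases M) && (b |: (c |: C) \in bases M)).
Proof.
move=> mM; rewrite /= !inE => /and4P[/norP[ab /norP[ac ad]] /norP[bc bd] cd _] aC bC cC dC b1 b2.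
have sw x y : (y |: (x |: C) \in bases M) = (x |: (y |: C) \in bases M) by rewrite setUCA.
have := @rank2_exchange _ M C a c b d mM b1 b2 dC; rewrite eq_sym => /(_ cd).
have := @rank2_exchange _ M C a d b c mM b1; rewrite sw => /(_ b2 cC cd).
have := @rank2_exchange _ M C c a d b mM b2 b1 bC; rewrite eq_sym => /(_ ab).
have := @rank2_exchange _ M C c b d a mM b2; rewrite sw => /(_ b1 aC ab).
rewrite !(sw a) !(sw b).
by case: (a |: (c |: C) \in _); case: (b |: (d |: C) \in _); case: (a |: (d |: C) \in _); case: (b |: (c |: C) \in _) => //=;
 intuition.
Qed.

Lemma card_oct M C Q x y : oct M C Q -> x \in Q -> y \in Q -> x != y -> #|x |: (y |: C)| = #|C|.+2.
Proof.
case=> _ dj _ xQ yQ xy; have n z : z \in Q -> z \notin C.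
  by move=> zQ; apply: contraTN dj => zC; apply/pred0Pn; exists z; rewrite /= zC.
by rewrite !cardsU1 !inE (negbTE xy) (negbTE (n _ xQ)) (negbTE (n _ yQ)).
Qed.

Lemma perm_enumU1 X x : x \notin X -> perm_eq (enum (x |: X)) (x :: enum X).
Proof.
move=> xX; apply: uniq_perm; rewrite ?enum_uniq //=; first by rewrite mem_enum xX enum_uniq.
by move=> z; rewrite !(inE, mem_enum).
Qed.

Lemma sub_shift (V : zmodType) (x y s : V) : x = (y + ((x - s) - (y - s)))%R.
Proof. by rewrite opprB subrKA addrCA subrr addr0. Qed.

Lemma F2_1 (x : 'F_2) : x != 0%R -> x = 1%R.
Proof. by case: x => [[|[|]]] //= i _; apply: val_inj. Qed.

Section Free.
Variables (n : nat) (f : T -> 'rV['F_2]_n).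
Local Notation sp X := <<map f (enum (X : {set T}))>>%VS.

Lemma freeU1 X x : x \notin X ->
  free (map f (enum (x |: X))) = (f x \notin sp X) && free (map f (enum X)).
Proof. by move=> xX; rewrite (perm_free (perm_map f (perm_enumU1 xX))) /= free_cons. Qed.

Lemma spanU1 X x : x \notin X -> sp (x |: X) = (<[f x]> + sp X)%VS.
Proof.
move=> xX; rewrite -span_cons; apply: eq_span => z.
by rewrite (perm_mem (perm_map f (perm_enumU1 xX))).
Qed.

End Free.

(** Modulo the span of [C] the four points of [Q] would be pairwise independent vectors of a plane
    over [F_2], which has only three nonzero vectors. *)
Lemma binary_oct M C Q : is_matroid M -> binary M -> ~ oct M C Q.
Proof.
move=> mM [n [f fP]] o; have [cQ dj oQ] := o.
have nC z : z \in Q -> z \notin C.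
  by move=> zQ; apply: contraTN dj => zC; apply/pred0Pn; exists z; rewrite /= zC.
have fr x y : x \in Q -> y \in Q -> x != y -> free (map f (enum (x |: (y |: C)))).
  move=> xQ yQ xy; have b := oQ x y xQ yQ xy.
  by apply/fP; rewrite ?(base_sub mM b) // indep_base.
(* Over [F_2] a third point is the sum of the first two modulo the span of [C]. Applied to [c] and
   to [d] with the same [a, b], this makes [c] and [d] congruent. *)
have tri x y z : x \in Q -> y \in Q -> z \in Q -> x != y -> x != z -> y != z ->
    ((f z - (f x + f y))%R \in <<map f (enum C)>>)%VS.
  move=> xQ yQ zQ xy xz yz.
  have zX : z \notin x |: (y |: C) by rewrite !inE (eq_sym z x) (eq_sym z y); atoms; apply: nC.
  have [xC yC] : x \notin C /\ y \notin C by split; apply: nC.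
  have xyC : x \notin y |: C by rewrite !inE; atoms.
  have : ~~ free (map f (enum (z |: (x |: (y |: C))))).
    apply/negP=> /fP h; have /h i : z |: (x |: (y |: C)) \subset ground M.
      by rewrite subUset sub1set (base_sub mM (oQ _ _ xQ yQ xy)) (base_in mM (oQ _ _ zQ xQ _)) ?inE ?eqxx // eq_sym.
    have := indep_card mM (oQ _ _ xQ yQ xy) i.
    by rewrite [X in X <= _]cardsU1 zX add1n ltnn.
  rewrite freeU1 // fr // andbT negbK spanU1 // spanU1 // => /memv_addP[_ /vlineP[k ->] [w /memv_addP[_ /vlineP[l ->] [v vC ->]] e]].
  have k1 : k = 1%R.
    apply: F2_1; apply/eqP=> k0; have := fr z y zQ yQ; rewrite eq_sym yz freeU1; last by move: zX; rewrite !inE => /norP[].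
    by move/(_ isT)/andP=> [/negP[]]; rewrite spanU1 // e k0 scale0r add0r; exact: memv_add (memvZ _ (memv_line _)) vC.
  have l1 : l = 1%R.
    apply: F2_1; apply/eqP=> l0; have := fr z x zQ xQ; rewrite eq_sym xz freeU1; last first.
      by rewrite !inE eq_sym (negbTE xz) nC.
    by move/(_ isT)/andP=> [/negP[]]; rewrite spanU1 // e l0 scale0r add0r; exact: memv_add (memvZ _ (memv_line _)) vC.
  by rewrite e k1 l1 !scale1r addrA [X in (X - _)%R]addrC addrK.
have [a [b [aQ bQ ab]]] := card4_2 cQ.
have [c [d [u e]]] := card4P cQ aQ bQ ab.
have [cC dQ] : c \in Q /\ d \in Q by rewrite e !inE !eqxx !orbT.
move: u; rewrite /= !inE => /and4P[/norP[_ /norP[ac ad]] /norP[bc bd] cd _].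
have := fr c d cC dQ cd; rewrite freeU1; last by rewrite !inE (negbTE cd) nC.
case/andP=> /negP h _; apply: h; rewrite spanU1 ?nC //.
have -> : (f c = f d + ((f c - (f a + f b)) - (f d - (f a + f b))))%R.
  exact: sub_shift.
by rewrite memv_add ?memv_line // memvB // tri.
Qed.

Lemma F2_bool (a b c : bool) : (a%:R * b%:R + c%:R = (a && b (+) c)%:R :> 'F_2)%R.
Proof. by case: a; case: b; case: c; apply: val_inj. Qed.

(** * Tutte's theorem: a binary representation from the absence of octahedra *)

Section Coordinates.
Variables (M : matroid T) (mM : is_matroid M) (noct : forall C Q, ~ oct M C Q).

(* If [M] has no octahedron, [fund B y] is the vector of [y] in a binary representation in which [B] is the standard basis. *)
Definition fcirc B y b : bool :=
  if y \in B then b == y else (b \in B) && (y |: (B :\ b) \in bases M).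

Definition fund B y : 'rV['F_2]_#|T| := (\row_j (fcirc B y (enum_val j))%:R)%R.

(** Change of coordinates under a pivot: eliminating [x] adds the coordinates of [x] over [B], with
    the coefficient of [y] at [x]. Here [(+)] is addition in [F_2]. *)
Lemma fcirc_pivot B b x y j : B \in bases M -> b \in B -> x \notin B ->
  x |: (B :\ b) \in bases M -> y \in ground M ->
  fcirc B y j = (fcirc (x |: (B :\ b)) y x && fcirc B x j) (+) ((j != x) && fcirc (x |: (B :\ b)) y j).
Proof.
move=> bB bb xB bB' yE; rewrite /fcirc (negbTE xB) !inE eqxx /=.
have bx : b != x by apply: contraNneq xB => <-.
have e0 : (x |: B :\ b) :\ x = B :\ b by set_eq.
rewrite e0; have [->|yx] := eqVneq y x.
  by rewrite (negbTE xB) bB' /= andNb addbF.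
rewrite /=.
have [yb|yb] := eqVneq y b.
  rewrite yb bb /= setD1K // bB /=.
  have [->|jb] := eqVneq j b; first by atoms.
  have [->|jx] := eqVneq j x; first by atoms.
  case jB: (j \in B) => //=.
  suff -> : b |: (x |: B :\ b) :\ j = x |: (B :\ j) by rewrite addbb.
  by set_eq.
case yB: (y \in B) => /=.
  by have [->|jx] := eqVneq j x; rewrite ?(eq_sym x y) ?(negbTE yx).
have [->|jx] := eqVneq j x; first by atoms.
have [->|jb] := eqVneq j b; first by rewrite bb bB' /= ?andbT ?andbF ?addbF.
case jB: (j \in B) => /=; last by rewrite andbF.
set C := B :\ b :\ j.
have [jC bC] : j \notin C /\ b \notin C by rewrite !inE !eqxx ?andbF.
have yN : y \notin B by rewrite yB.
have [yC xC] : y \notin C /\ x \notin C by rewrite !inE (negbTE yN) (negbTE xB) !andbF.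
have E1 : y |: B :\ j = y |: (b |: C) by rewrite /C; set_eq.
have E2 : y |: B :\ b = y |: (j |: C) by rewrite /C; set_eq.
have E3 : x |: B :\ j = x |: (b |: C) by rewrite /C; set_eq.
have E4 : y |: (x |: B :\ b) :\ j = y |: (x |: C) by rewrite /C; set_eq.
have E5 : x |: B :\ b = x |: (j |: C) by rewrite /C; set_eq.
have E6 : B = b |: (j |: C) by rewrite /C; set_eq.
have jy : j != y by apply: contraNneq yN => <-.
have u : uniq [:: b; j; x; y] by rewrite /= !inE; atoms.
have sw p q : (q |: (p |: C) \in bases M) = (p |: (q |: C) \in bases M) by rewrite setUCA.
rewrite {}E1 {}E2 {}E3 {}E4; rewrite E5 in bB'; rewrite E6 in bB.
have := @octI M C b j x y u bC jC xC yC bB.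
(* Of the six pairs from [b, j, x, y] two are known to give bases over [C]. Among the values of the
   other four that violate the identity, [pairing_exchange] excludes all but the one where every
   pair gives a basis, and that one is an octahedron. *)
have G := @pairing_exchange M C; have G1 := G b j x y mM u bC jC xC yC bB.
have u2 : uniq [:: b; x; j; y] by rewrite /= !inE; atoms.
have u3 : uniq [:: b; y; j; x] by rewrite /= !inE; atoms.
have G2 := G b x j y mM u2 bC xC jC yC; have G3 := G b y j x mM u3 bC yC jC xC.
move: G1 G2 G3 (@noct C [set b; j; x; y]).
move: bB bB'; rewrite ?(sw b y) ?(sw j y) ?(sw b x) ?(sw x y) ?(sw j x) => -> ->.
case: (b |: (x |: C) \in _); case: (b |: (y |: C) \in _); case: (j |: (y |: C) \in _); case: (x |: (y |: C) \in _) => //= h1 h2 h3 no o;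
  first [by case: no; apply: o | by have := h1 isT | by have := h2 isT isT | by have := h3 isT isT].
Qed.

Lemma fund_pivot B b x : B \in bases M -> b \in B -> x \notin B -> x |: (B :\ b) \in bases M ->
  exists A, forall y, y \in ground M -> fund B y = (fund (x |: (B :\ b)) y *m A)%R.
Proof.
move=> bB bb xB bB'.
(* The identity matrix with the row of [x] replaced by the coordinates of [x] over [B]. *)
exists (\matrix_i (if i == enum_rank x then fund B x else delta_mx 0 i))%R => y yE.
apply/rowP=> j; rewrite !mxE (fcirc_pivot _ bB bb xB bB' yE) -F2_bool.
rewrite (bigD1 (enum_rank x)) //= !mxE enum_rankK eqxx !mxE; congr (_ + _)%R.
have -> : (enum_val j != x) = (j != enum_rank x) by rewrite -(inj_eq enum_rank_inj) enum_valK.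
have [->|jx] := eqVneq j (enum_rank x).
  by rewrite big1 // => i ix; rewrite !mxE (negbTE ix) !mxE eq_sym (negbTE ix) andbF mulr0.
rewrite (bigD1 j) //= !mxE (negbTE jx) !mxE !eqxx mulr1 big1 ?addr0 //.
by move=> i /andP[ix ij]; rewrite !mxE (negbTE ix) !mxE eqxx eq_sym (negbTE ij) mulr0.
Qed.

Lemma free_mulmx n (A : 'M['F_2]_n) (s : seq 'rV['F_2]_n) :
  free (map (fun v => v *m A)%R s) -> free s.
Proof.
elim: s => //= v s IHs; rewrite !free_cons => /andP[nv /IHs ->]; rewrite andbT.
apply: contra nv => vs; have := memv_img (linfun (mulmxr A)) vs.
rewrite lfunE /= limg_span; congr (_ \in _); congr (<<_>>%VS).
by apply: eq_map => w; rewrite lfunE.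
Qed.

(** A sequence of pivots leads from [B] to [B']. Each one takes the new coordinates to the old by a
    linear map, so by [free_mulmx] freeness passes from the old to the new. *)
Lemma fund_walk B B' X : X \subset ground M -> B \in bases M -> B' \in bases M ->
  free (map (fund B) (enum X)) -> free (map (fund B') (enum X)).
Proof.
move=> sX b b'; have [n] := ubnP #|B' :\: B|; elim: n B b => // n IHn B b lt_n fB.
have [s|/subsetPn[x x' xB]] := boolP (B' \subset B).
  suff -> : B' = B by []; apply/eqP.
  by rewrite eqEcard s (card_bases mM b b') leqnn.
have [y [yB y' b1]] := extend1 mM b b' x' xB.
apply: (IHn _ b1); last first.
  have [A eA] := fund_pivot b yB xB b1.
  apply: (@free_mulmx _ A); rewrite -map_comp; apply: etrans fB.
  congr (free _); apply/eq_in_map => z; rewrite mem_enum => zX /=.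
  by rewrite -eA // (subsetP sX).
rewrite -ltnS (leq_trans _ lt_n) // ltnS; apply: proper_card.
apply/properP; split; last by exists x; rewrite !inE; atoms.
by apply/subsetP=> z; rewrite !inE; case: (eqVneq z y) => [->|] //=; atoms; case: (z \in B'); rewrite ?andbF // !andbT => zy /norP[].
Qed.

Lemma fund_in B y : y \in B -> fund B y = delta_mx 0%R (enum_rank y).
Proof.
move=> yB; apply/rowP=> j; rewrite !mxE /fcirc yB eqxx /=.
by rewrite -(inj_eq enum_rank_inj) enum_valK.
Qed.

Lemma fund_free B X : X \subset B -> free (map (fund B) (enum X)).
Proof.
move=> sX; have : {subset enum X <= B} by move=> z; rewrite mem_enum; apply: (subsetP sX).
elim: (enum X) (enum_uniq X) => [|x s IHs] /=; first by rewrite nil_free.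
case/andP=> xs us sB; rewrite free_cons IHs //; last by move=> z zs; apply: sB; rewrite inE zs orbT.
rewrite andbT; apply/negP=> h; have := coord_span (X := in_tuple _) h.
move/rowP/(_ (enum_rank x)); rewrite fund_in ?sB ?mem_head // mxE !eqxx summxE big1.
  by move/eqP; rewrite oner_eq0.
move=> i _; have lt : i < size s by rewrite -(size_map (fund B)).
rewrite mxE (nth_map x) //; have ms := mem_nth x lt.
rewrite fund_in; last by apply: sB; rewrite inE ms orbT.
rewrite mxE eqxx (inj_eq enum_rank_inj) /=; case: eqP => [e|]; last by rewrite mulr0.
by move: ms; rewrite -e (negbTE xs).
Qed.

Lemma binary_noct : binary M.
Proof.
have [/set0Pn[B0 b0] _ _] := mM.
exists #|T|, (fund B0) => X sX; split=> [/indepP[B b sB]|fX].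
  exact: fund_walk sX b b0 (fund_free sB).
(* A basis meeting [X] in as many elements as possible: if [x] in [X] were outside it, no exchange
   could bring [x] in for an element outside [X]. Then [x] would be a combination of basis elements
   that lie in [X], against freeness. *)
case: (@arg_maxnP _ B0 (mem (bases M)) (fun B => #|B :&: X|) b0) => B b mx.
have {fX} := fund_walk sX b0 b fX.
have [s _|/subsetPn[x xX xB] fX] := boolP (X \subset B); first by apply/indepP; exists B.
case: (pickP [pred c | (c \in B :\: X) && (x |: (B :\ c) \in bases M)]) => [c|no].
  rewrite /= inE => /andP[/andP[cX cB] b1]; have := mx _ b1.
  suff lt : #|B :&: X| < #|(x |: B :\ c) :&: X| by rewrite /geq /= leqNgt lt.
  apply: proper_card; apply/properP; split; last by exists x; rewrite !inE; atoms.
  by apply/subsetP=> z; rewrite !inE => /andP[zB zX]; atoms.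
have : x |: (X :\ x) = X by rewrite setD1K.
move=> e; move: fX; rewrite -e freeU1 ?inE ?eqxx // => /andP[/negP h _]; case: h.
rewrite [fund B x]row_sum_delta; apply: memv_suml => j _; rewrite mxE /fcirc (negbTE xB).
case: andP => [[jB jb]|_]; last by rewrite scale0r mem0v.
rewrite memvZ //; apply: memv_span; apply/mapP; exists (enum_val j); last by rewrite fund_in // enum_valK.
rewrite mem_enum !inE; have := no (enum_val j); rewrite /= !inE jB jb !andbT => /negbFE ->.
by rewrite andbT; apply: contraTneq jB => ->.
Qed.

End Coordinates.

End Octahedra.

(** * The class in terms of octahedra *)

Section Relaxations.
Variable T : finType.
Implicit Types (M N : matroid T) (B C D E H I X Y Q : {set T}).

(* The following speak about the minor [M / C0 \ D0] in terms of the bases of [M]: [rfree] says that [H] is a basis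
   all of whose single exchanges are bases, so that [H] is the relaxation of a circuit-hyperplane, and [rvalid] adds
   that removing [H] from the bases destroys every octahedron. Hence [rR] says that the minor lies in the class. *)
Definition inoct H C Q : bool := (C \subset H) && (H \subset C :|: Q).

Definition roct M C0 D0 C Q : Prop :=
  [/\ oct M C Q, C0 \subset C & [disjoint D0 & C :|: Q]].

Definition rfree M C0 D0 H : Prop :=
  [/\ H \in bases M, C0 \subset H, [disjoint D0 & H] &
      forall u p, u \in H -> u \notin C0 -> p \in ground M -> p \notin H -> p \notin D0 ->
        p |: (H :\ u) \in bases M].

Definition rvalid M C0 D0 H : Prop :=
  rfree M C0 D0 H /\ forall C Q, roct M C0 D0 C Q -> inoct H C Q.

Definition rR M C0 D0 : Prop :=
  (exists C Q, roct M C0 D0 C Q) -> exists H, rvalid M C0 D0 H.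

(** Only one-element minors are tested, since [rR] is inherited by larger pairs ([rR_mono]). *)
Definition excl M : Prop :=
  [/\ is_matroid M, ~ rR M set0 set0 &
      forall e, e \in ground M -> rR M [set e] set0 /\ rR M set0 [set e]].

(** The class is minor-closed. The witness for the larger minor still serves, because an octahedron
    of the smaller one traps it: [C1 \subset C \subset H], and [H \subset C :|: Q] misses [D1]. *)
Lemma rR_mono M C0 D0 C1 D1 : C0 \subset C1 -> D0 \subset D1 -> rR M C0 D0 -> rR M C1 D1.
Proof.
move=> sC sD r [C [Q o]].
have sub C' Q' : roct M C1 D1 C' Q' -> roct M C0 D0 C' Q'.
  by case=> o' s d; split=> //; [apply: subset_trans s | apply: disjointWl d].
have [|H [[bH s d ex] val]] := r; first by exists C, Q; apply: sub.
have [o' s1 d1] := o; have /andP[CH HQ] := val _ _ (sub _ _ o).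
exists H; split=> [|C' Q' /sub/val //]; split=> //.
- exact: subset_trans s1 CH.
- exact: disjointWr HQ d1.
move=> u p uH uC pE pH pD; apply: ex => //.
  by apply: contra uC; apply/subsetP.
by apply: contra pD; apply/subsetP.
Qed.

Lemma excl_mono M C0 D0 : excl M -> C0 \subset ground M -> D0 \subset ground M ->
  (C0 != set0) || (D0 != set0) -> rR M C0 D0.
Proof.
move=> [_ _ ex] sC sD /orP[] /set0Pn[e eX].
  have [r _] := ex e (subsetP sC _ eX).
  by apply: rR_mono r; rewrite ?sub0set // sub1set.
have [_ r] := ex e (subsetP sD _ eX).
by apply: rR_mono r; rewrite ?sub0set // sub1set.
Qed.

Lemma oct_notin M C Q x : oct M C Q -> x \in Q -> x \notin C.
Proof. by case=> _ dj _ xQ; apply: contraTN dj => xC; apply/pred0Pn; exists x; rewrite /= xC. Qed.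

Lemma oct_sub M C Q : is_matroid M -> oct M C Q -> C :|: Q \subset ground M.
Proof.
move=> mM o; have [c _ b] := o; have [x [y [xQ yQ xy]]] := card4_2 c.
apply/subsetP=> z; rewrite inE => /orP[zC|zQ].
  by apply: (base_in mM (b x y xQ yQ xy)); rewrite !inE zC !orbT.
have [e|zx] := eqVneq z x; first by apply: (base_in mM (b x y xQ yQ xy)); rewrite !inE e eqxx.
by apply: (base_in mM (b z x zQ xQ zx)); rewrite !inE eqxx.
Qed.

Lemma oct_ex M C Q : oct M C Q -> exists B, [/\ B \in bases M, C \subset B & B \subset C :|: Q].
Proof.
move=> o; have [c _ b] := o; have [x [y [xQ yQ xy]]] := card4_2 c.
exists (x |: (y |: C)); split; first exact: b.
  by rewrite !setUA subsetUr.
by rewrite !subUset !sub1set subsetUl !inE xQ yQ !orbT.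
Qed.

Lemma swap_neq H v q : v \in H -> q \notin H -> q |: (H :\ v) != H.
Proof. by move=> vH; apply: contraNneq => <-; rewrite !inE eqxx. Qed.

(** Exchange can only break when its result is [H] itself, that is, when [B1 = x |: (H :\ y)]. As
    [B2] is not [H], it has a second element [z] outside [B1], and [z |: (H :\ y)] is a basis
    because [H] is free. *)
Lemma remove_base M H u p : is_matroid M -> H \in bases M -> u \in H -> p \in ground M -> p \notin H ->
  (forall u p, u \in H -> p \in ground M -> p \notin H -> p |: (H :\ u) \in bases M) ->
  is_matroid (Matroid (ground M) (bases M :\ H)).
Proof.
move=> mM bH uH pE pH fr.
have pD := @swap_neq H.
split=> /=.
- by apply/set0Pn; exists (p |: H :\ u); rewrite !inE pD // fr.
- by move=> B; rewrite !inE => /andP[_ /(base_sub mM)].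
move=> B1 B2 x; rewrite !inE => /andP[n1 b1] /andP[n2 b2] /andP[x2 x1].
have [y [y2 y1 b]] := exch mM b1 b2 x1 x2.
have [e|ne] := eqVneq (y |: B1 :\ x) H; last by exists y; rewrite !inE ?y1 // ne.
have yx : y != x by apply: contraNneq y1 => ->.
have yH : y \in H by rewrite -e !inE eqxx.
have xH : x \notin H by rewrite -e !inE; atoms.
have eB : B1 = x |: (H :\ y) by rewrite -e; set_eq.
have [/eqP s|] := boolP (B2 :\: B1 == [set y]).
  case/negP: n2; rewrite -e eqEcard card_swap // (card_bases mM b1 b2) leqnn andbT.
  apply/subsetP=> z z2; have : (z \in B2 :\: B1) = (z == y) by rewrite s inE.
  rewrite !inE z2 andbT => <-; case: (z \in B1) => //=; rewrite andbT.
  by apply: contraNneq x2 => <-.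
rewrite eqEsubset sub1set inE y1 y2 /= andbT; case/subsetPn=> z; rewrite !inE => /andP[z1 z2] zy.
have zH : z \notin H by move: z1; rewrite eB !inE zy => /norP[].
exists z; first by rewrite inE z1.
have -> : z |: B1 :\ x = z |: (H :\ y) by rewrite eB; set_eq.
by rewrite !inE pD // fr // (base_in mM b2).
Qed.

Lemma roct0 M C Q : oct M C Q -> roct M set0 set0 C Q.
Proof. by split=> //; rewrite ?sub0set // disjoints_subset sub0set. Qed.

Lemma inoct_compl M H C Q : is_matroid M -> oct M C Q -> H \in bases M -> inoct H C Q ->
  (exists u, u \in H) /\ (exists2 p, p \in ground M & p \notin H).
Proof.
move=> mM o bH /andP[CH HQ]; have [c dj b] := o; have [x [y [xQ yQ xy]]] := card4_2 c.
have cH : #|H| = #|C|.+2 by rewrite (card_bases mM bH (b x y xQ yQ xy)) (card_oct o).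
split; first by apply/card_gt0P; rewrite cH.
apply/subsetPn; apply/negP=> s; have := subset_leq_card (subset_trans (oct_sub mM o) s).
by rewrite cardsU (disjoint_setI0 dj) cards0 subn0 cH c; lia.
Qed.

(** A binary matroid has no octahedra, so every octahedron of its relaxation uses the added basis
    [H]. Conversely, a free [H] that lies in all octahedra is one of the six bases of each, so
    removing it destroys them all. *)
Lemma in_R_rR M : is_matroid M -> in_R M <-> rR M set0 set0.
Proof.
move=> mM; split.
  case=> [bM [C [Q [o _ _]]]|[M' [mM' bM' [H [cH [eE eB]]]]] _].
    by case: (binary_oct mM bM o).
  exists H; have bH : H \in bases M by rewrite eB setU11.
  split; first split; rewrite ?sub0set // ?disjoints_subset ?sub0set //.
    move=> u p uH _ pE pH _; rewrite eB inE; apply/orP; right.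
    by apply: circuit_hyperplane_base; rewrite -?eE.
  move=> C Q [o _ _]; apply/negPn/negP=> nH; case: (@binary_oct _ M' C Q mM' bM').
  have [c dj b] := o; split=> // x y xQ yQ xy.
  have := b x y xQ yQ xy; rewrite eB !inE => /orP[/eqP e|//].
  case/negP: nH; rewrite /inoct -e !subUset !sub1set !inE xQ yQ !orbT subsetUl !andbT /=.
  by rewrite setUA subsetUr.
move=> r; have [/existsP[C /existsP[Q /octP o]]|no] := boolP [exists C : {set T}, [exists Q : {set T}, octb M C Q]].
  have [|H [[bH _ _ fr] val]] := r; first by exists C, Q; apply: roct0.
  have inH C' Q' : oct M C' Q' -> inoct H C' Q' by move=> o'; apply: val; apply: roct0.
  have [[u uH] [p pE pH]] := inoct_compl mM o bH (inH _ _ o).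
  have {}fr v q : v \in H -> q \in ground M -> q \notin H -> q |: (H :\ v) \in bases M.
    by move=> vH qE qH; apply: fr; rewrite ?inE.
  have mM' := remove_base mM bH uH pE pH fr.
  have pD := @swap_neq H.
  right; exists (Matroid (ground M) (bases M :\ H)); split=> //.
    apply: binary_noct => // C' Q' o'.
    have [c' dj' b'] := o'; have /inH in1 : oct M C' Q'.
      by split=> // x y xQ yQ xy; have := b' x y xQ yQ xy; rewrite inE => /andP[].
    have /andP[CH HQ] := in1.
    have cH : #|H :\: C'| == 2.
      have [x [y [xQ yQ xy]]] := card4_2 c'; have := b' x y xQ yQ xy; rewrite inE => /andP[_ bb].
      have := card_oct o' xQ yQ xy; rewrite -(card_bases mM bH bb) cardsD (setIidPr CH) => ->.
      by rewrite -addn2 addKn.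
    case/cards2P: cH => x [y [xy e]].
    have [xH yH] : x \in H :\: C' /\ y \in H :\: C' by rewrite e !inE !eqxx orbT.
    move: xH yH; rewrite !inE => /andP[xC xH] /andP[yC yH].
    have xQ : x \in Q' by have := subsetP HQ x xH; rewrite inE (negbTE xC).
    have yQ : y \in Q' by have := subsetP HQ y yH; rewrite inE (negbTE yC).
    have := b' x y xQ yQ xy; rewrite !inE => /andP[/eqP[]].
    by rewrite setUA -e setUC -{1}(setIidPr CH) setID.
  exists H; split; last by split=> //=; rewrite setD1K.
  apply: (@circuit_hyperplaneI _ (Matroid (ground M) (bases M :\ H)) H (p |: H :\ u)) => //=.
  - by rewrite !inE pD // fr.
  - by rewrite card_swap.
  - exact: base_sub bH.
  - by rewrite !inE eqxx.
  - by apply/set0Pn; exists u.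
  - by apply: contraNneq pH => ->.
  by move=> v q vH qE qH; rewrite !inE pD // fr.
left; apply: binary_noct => // C Q /octP o; case/negP: no.
by apply/existsP; exists C; apply/existsP; exists Q.
Qed.

End Relaxations.

(** * Octahedra and the class under duality *)

Section Duality.
Variable T : finType.
Implicit Types (M N : matroid T) (B C D E H I X Y Q : {set T}).

Lemma swap_compl E H u p : H \subset E -> u \in E -> u \notin H -> p \in H ->
  p |: ((E :\: H) :\ u) = E :\: (u |: (H :\ p)).
Proof.
move=> sH uE uH pH; have sE z : z \in H -> z \in E := subsetP sH z.
have pE := sE p pH.
apply/setP=> z; rewrite !inE; case: (eqVneq z p) => [->|zp]; atoms; first by [].
by case: (eqVneq z u) => [->|zu]; atoms.
Qed.

Lemma disjointP X Y : (forall x, x \in X -> x \notin Y) -> [disjoint X & Y].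
Proof. by move=> h; rewrite disjoint_subset; apply/subsetP=> x /h; rewrite inE. Qed.

(** In the dual, a pair of elements of [Q] gives the complement of the basis that the other pair
    forms with [C]. *)
Lemma oct_dual M C Q : is_matroid M -> oct M C Q -> oct (dual M) (ground M :\: (C :|: Q)) Q.
Proof.
move=> mM o; have [c dj b] := o; split=> //.
  by apply: disjointP => x; rewrite !inE => /andP[/norP[]].
move=> x y xQ yQ xy; have [z [t [u e]]] := card4P c xQ yQ xy.
move: u; rewrite /= !inE => /and4P[/norP[_ /norP[xz xt]] /norP[yz yt] zt _].
have [zQ tQ] : z \in Q /\ t \in Q by rewrite e !inE !eqxx !orbT.
have sE := subsetP (oct_sub mM o).
have nC w : w \in Q -> w \notin C := oct_notin o (x := w).
have -> : x |: (y |: ground M :\: (C :|: Q)) = ground M :\: (z |: (t |: C)).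
  apply/setP=> w; rewrite !inE.
  have [wC|wC] := boolP (w \in C); rewrite /= ?orbT /=.
    by rewrite orbF; apply/negP=> /orP[] /eqP we; move: wC; apply/negP; rewrite we nC.
  have [wQ|wQ] := boolP (w \in Q); rewrite /= ?orbF ?orbT /=.
    have wE : w \in ground M by apply: sE; rewrite inE wQ orbT.
    rewrite wE andbT ?orbF; move: wQ; rewrite e !inE -!orbA => /or4P[] /eqP->; atoms; done.
  have n v : v \in Q -> (w == v) = false by move=> vQ; apply: contraNF wQ => /eqP->.
  by rewrite !n.
change (ground M :\: (z |: (t |: C)) \in bases (dual M)).
by rewrite base_dual ?b // subUset sub1set subUset sub1set ?sE ?inE ?zQ ?tQ ?orbT //=;
   apply: subset_trans (oct_sub mM o); apply: subsetUl.
Qed.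

Lemma oct_dualK M C Q : is_matroid M -> oct (dual M) C Q -> oct M (ground M :\: (C :|: Q)) Q.
Proof. by move=> mM /(oct_dual (dual_matroid mM)); rewrite dualK. Qed.

Lemma rR_dual M C0 D0 : is_matroid M -> C0 \subset ground M -> D0 \subset ground M ->
  rR M C0 D0 -> rR (dual M) D0 C0.
Proof.
move=> mM sC sD r [C [Q o]].
have od C' Q' : roct (dual M) D0 C0 C' Q' -> roct M C0 D0 (ground M :\: (C' :|: Q')) Q'.
  move=> [o' sD' dC]; have [_ dj _] := o'; split; first exact: oct_dualK.
    by rewrite subsetD sC.
  apply: disjointP => x xD; have xC := subsetP sD' x xD.
  by rewrite !inE xC /= (disjointFr dj xC).
have [|H [[bH CH DH ex] val]] := r; first by exists (ground M :\: (C :|: Q)), Q; apply: od.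
have sH := base_sub mM bH.
exists (ground M :\: H); split; first split.
- by rewrite base_dual.
- by rewrite subsetD sD.
- by apply: disjointP => x /(subsetP CH) xH; rewrite inE xH.
- move=> u p; rewrite !inE => /andP[uH uE] uD pE; rewrite pE andbT negbK => pH pC.
  by rewrite swap_compl // base_dual ?ex // subUset sub1set uE subDset setUC subsetU // sH.
move=> C1 Q1 o1; have /andP[s1 s2] := val _ _ (od _ _ o1).
have [o1' _ _] := o1; have [_ dj _] := o1'.
have /subsetP sE := oct_sub (dual_matroid mM) o1'.
apply/andP; split; apply/subsetP=> x.
  move=> xC; have := sE x; rewrite !inE xC => -> //; rewrite andbT.
  by apply/negP=> /(subsetP s2); rewrite !inE xC /= (disjointFr dj xC).
rewrite !inE => /andP[xH xE]; move: (subsetP s1 x); rewrite !inE xE andbT.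
by case: (_ || _) => //= /(_ isT) h; rewrite h in xH.
Qed.

Lemma excl_dual M : excl M -> excl (dual M).
Proof.
move=> [mM nR ex]; split; first exact: dual_matroid.
  by move/(rR_dual (dual_matroid mM)); rewrite !sub0set dualK // => /(_ isT isT).
by move=> e eE; have [c d] := ex e eE; split; apply: rR_dual; rewrite ?sub0set ?sub1set.
Qed.

End Duality.

(** * Minors as pairs of a contracted and a deleted set *)

Section Minors.
Variable T : finType.
Implicit Types (M N : matroid T) (B C D E H I X Y Q : {set T}).

Lemma setDUK X C : C \subset X -> X :\: C :|: C = X.
Proof. by move=> s; apply/setP=> z; rewrite !inE; move/subsetP/(_ z): s; case: (z \in C) => /= [->|]; rewrite ?orbF. Qed.

Lemma rank_setU M X C : rank M (X :|: C) <= #|X| + rank M C.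
Proof.
apply: rank_le => Y sY iY; have e : Y = (Y :&: X) :|: (Y :&: C) by rewrite -setIUr (setIidPl sY).
rewrite e; apply: leq_trans (leq_card_setU _ _) _; apply: leq_add.
  by rewrite subset_leq_card // subsetIr.
by rewrite rank_ge ?subsetIr //; apply: indep_sub iY; apply: subsetIl.
Qed.

(* A minor can be obtained by contracting an independent set and deleting a coindependent one. *)
Lemma minor_base M N : is_matroid M -> is_matroid N -> minor N M ->
  exists2 C : {set T}, C \subset ground M :\: ground N &
    forall X, X \subset ground N -> (X \in bases N) = (X :|: C \in bases M).
Proof.
move=> mM mN [sN [C [sC iN]]].
have dC X : X \subset ground N -> [disjoint X & C].
  by move=> sX; apply: disjointP => x /(subsetP sX) xN; apply/negP=> /(subsetP sC); rewrite inE xN.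
have [/set0Pn[X0 b0] _ _] := mN; have s0 := base_sub mN b0.
(* The contracted set may be dependent; it is replaced by a maximal independent part [C0] that
   remains independent together with the basis [X0] of [N]. *)
have [C0 [sC0 c0 i0]] : exists C0, [/\ C0 \subset C, #|C0| = rank M C & indep M (X0 :|: C0)].
  have := indep_base b0; rewrite iN // => /eqP r0.
  have [Y [sY iY cY]] := rank_ex (X0 :|: C) mM; exists (Y :&: C).
  have sD : Y :\: C \subset X0 by rewrite subDset setUC.
  have le1 : #|Y :&: C| <= rank M C.
    by rewrite rank_ge ?subsetIr //; apply: indep_sub iY; apply: subsetIl.
  have le2 := subset_leq_card sD; have := cardsID C Y; rewrite cY r0 => e.
  have e0 : Y :\: C = X0 by apply/eqP; rewrite eqEcard sD; clear -e le1 le2; lia.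
  split; rewrite ?subsetIr //; first by clear -e le1 le2; lia.
  by rewrite -e0 setUC setID.
have fact X : X \subset ground N -> indep N X = indep M (X :|: C0).
  move=> sX; rewrite iN //; apply/eqP/idP => [r|i]; last first.
    apply/eqP; rewrite eqn_leq rank_setU /= -c0.
    have dX : [disjoint X & C0] by apply: disjointWr sC0 (dC _ sX).
    move: (leq_card_setU X C0) => [_ e]; move: dX; rewrite -e => /eqP <-.
    by apply: rank_ge => //; apply: setUS.
  have /indepP[B1 b1 s1] : indep M C0 by apply: indep_sub i0; apply: subsetUr.
  have [Y [sY /indepP[B2 b2 s2] cY]] := rank_ex (X :|: C) mM.
  have [B [b sI sU]] := extend mM b1 s1 b2.
  have sub : B \subset (B :&: X) :|: (B :&: C) :|: (B2 :\: Y).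
    apply/subsetP=> z zB; move: (subsetP sU z zB) (subsetP sC0 z) (subsetP sY z); rewrite !inE zB /=.
    case: (z \in C0) => /= [_ -> //|]; first by rewrite orbT.
    by move=> -> _; case: (z \in Y) => //= [->|]; rewrite ?orbT.
  have le3 : #|B :&: C| <= rank M C.
    by rewrite rank_ge ?subsetIr //; apply: indep_sub (indep_base b); apply: subsetIl.
  have le4 : #|B :&: X| <= #|X| by rewrite subset_leq_card // subsetIr.
  have := leq_trans (subset_leq_card sub) (leq_card_setU _ _).
  have := (leq_card_setU (B :&: X) (B :&: C)).1.
  have := subset_leq_card s2.
  rewrite (card_bases mM b b2) cardsD (setIidPr s2) cY r => h1 h2 h3.
  have /eqP/setIidPr sXB : B :&: X == X.
    rewrite eqEcard subsetIr; have := rank_card M C; move: h1 h2 h3 le3 le4; clear; lia.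
  by apply/indepP; exists B; rewrite // subUset sI sXB.
have /indepP[B1 b1 s1] := i0.
have XC : X0 :&: C0 = set0 by apply/disjoint_setI0; apply: disjointWr sC0 (dC _ s0).
have s01 : X0 \subset B1 by apply: subset_trans s1; apply: subsetUl.
have sC1 : C0 \subset B1 by apply: subset_trans s1; apply: subsetUr.
(* When [X0 :|: C0] is not yet a basis of [M], more has to be contracted: the rest of a basis [B1]
   through it. No element of that rest lies in [N], as [X0] is a maximal independent set there. *)
exists (B1 :\: X0).
  apply/subsetP=> g; rewrite !inE => /andP[g0 g1]; rewrite (base_in mM b1) // andbT.
  apply/negP=> gN; have : indep N (g |: X0).
    rewrite fact ?subUset ?sub1set ?gN //; apply/indepP; exists B1 => //.
    by rewrite !subUset sub1set g1 s01.
  by move/(indep_card mN b0); rewrite cardsU1 g0 add1n ltnn.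
have C01 : C0 \subset B1 :\: X0.
  apply/subsetP=> z zC; rewrite inE (subsetP sC1) // andbT.
  by apply/negP=> zX; move/setP/(_ z): XC; rewrite !inE zX zC.
move=> X sX; apply/idP/idP => [b|b].
  have iX : indep M (X :|: C0) by rewrite -fact // indep_base.
  have /indepP[B2 b2 s2] := iX; have [B [bB sI sU]] := extend mM b2 s2 b1.
  have n0 z : z \in B -> z \in X0 -> z \in X.
    move=> zB z0; apply/negPn/negP=> zX; have : indep N (z |: X).
      rewrite fact ?subUset ?sub1set ?(subsetP s0) //; apply/indepP; exists B => //.
      by rewrite -setUA subUset sub1set zB.
    by move/(indep_card mN b); rewrite cardsU1 zX add1n ltnn.
  have sB : B \subset X :|: (B1 :\: X0).
    apply/subsetP=> z zB; move: (subsetP sU z zB) (n0 z zB) (subsetP C01 z); rewrite !inE.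
    case: (z \in X) => //=; case: (z \in C0) => //= [_ _ -> //|].
    by move=> -> h _; rewrite andbT; apply/negP=> /h.
  suff <- : B = X :|: (B1 :\: X0) by [].
  apply/eqP; rewrite eqEcard sB (card_bases mM bB b1) (leq_trans (leq_card_setU _ _)) //.
  by rewrite (card_bases mN b b0) cardsD (setIidPr s01) subnKC // subset_leq_card.
have iX : indep N X.
  by rewrite fact //; apply: indep_sub (indep_base b); apply: setUS.
apply: indep_full mN b0 iX _; have := (leq_card_setU X (B1 :\: X0)).1.
rewrite (card_bases mM b b1) cardsD (setIidPr s01); have := subset_leq_card s01.
by clear; lia.
Qed.

Lemma cat_oct N M C C' Q : oct N C Q -> [disjoint C' & C :|: Q] ->
  (forall X, X \subset C :|: Q -> (X \in bases N) = (X :|: C' \in bases M)) ->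
  oct M (C :|: C') Q.
Proof.
move=> [c dj b] d' e; split=> //.
  apply: disjointP => x; rewrite inE => /orP[xC|xC]; first by rewrite (disjointFr dj xC).
  by have := disjointFr d' xC; rewrite inE => /norP[].
move=> x y xQ yQ xy; rewrite !setUA -e -?setUA ?b //.
by rewrite !subUset !sub1set !inE xQ yQ !orbT subsetUl.
Qed.

Section MinorR.
Variables (M N : matroid T) (mM : is_matroid M) (mN : is_matroid N) (C' : {set T}).
Hypotheses (sN : ground N \subset ground M) (sC : C' \subset ground M :\: ground N).
Hypothesis e : forall X, X \subset ground N -> (X \in bases N) = (X :|: C' \in bases M).
Local Notation D' := (ground M :\: ground N :\: C').

Let nC x : x \in C' -> x \notin ground N.
Proof. by move/(subsetP sC); rewrite inE => /andP[]. Qed.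

Let dC X : X \subset ground N -> [disjoint X & C'].
Proof. by move=> sX; apply: disjointP => x /(subsetP sX) xN; apply/negP=> /nC; rewrite xN. Qed.

Let roct_up C Q : oct N C Q -> roct M C' D' (C :|: C') Q.
Proof.
move=> o; have s := oct_sub mN o; split; last 2 first.
- exact: subsetUr.
- apply: disjointP => x; rewrite !inE => /and3P[xC xN _]; rewrite (negbTE xC) orbF.
  by apply: contra xN => h; apply: (subsetP s); rewrite inE.
apply: (cat_oct o); first by rewrite disjoint_sym; apply: dC.
by move=> X sX; apply: e; apply: subset_trans s.
Qed.

Let in_ground X : X \subset ground M -> [disjoint D' & X] -> X :\: C' \subset ground N.
Proof.
move=> sX d; apply/subsetP=> x; rewrite inE => /andP[xC xX]; apply/negPn/negP=> xN.
by have := disjointFl d xX; rewrite !inE xC xN (subsetP sX).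
Qed.

Let roct_down C Q : roct M C' D' C Q -> oct N (C :\: C') Q /\ C = C :\: C' :|: C'.
Proof.
move=> [o sC1 d]; have s := oct_sub mM o; have [c dj b] := o.
have eC : C = C :\: C' :|: C' by rewrite setDUK.
split=> //; split=> //; first by apply: disjointWl dj; apply: subsetDl.
move=> x y xQ yQ xy; have nQ z : z \in Q -> z \notin C' by move=> /(oct_notin o); apply: contra; apply: subsetP.
have eX : x |: (y |: C :\: C') = (x |: (y |: C)) :\: C'.
  by rewrite !setDUl; congr (_ :|: (_ :|: _)); apply/esym/setDidPl; apply: disjointP => z; rewrite inE => /eqP->; apply: nQ.
rewrite e.
  by rewrite -!setUA -eC b.
rewrite eX; apply: in_ground; first exact: base_sub (b _ _ xQ yQ xy).
by apply: disjointWr d; rewrite !subUset !sub1set !inE xQ yQ !orbT subsetUl.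
Qed.

(** Adding [C'] identifies the bases of [N] with the bases of [M] that contain [C'] and avoid the
    deleted set; octahedra and free bases are carried along in both directions. *)
Lemma rR_minor : rR M C' D' <-> rR N set0 set0.
Proof.
split=> r [C [Q o]].
  have [o' _ _] := o; have [|H [[bH CH DH ex] val]] := r; first by exists (C :|: C'), Q; apply: roct_up.
  have sH : H :\: C' \subset ground N by apply: in_ground; rewrite ?(base_sub mM bH).
  have eH : H :\: C' :|: C' = H by apply: setDUK.
  exists (H :\: C'); split; first split; rewrite ?sub0set ?disjoints_subset ?sub0set //.
  - by rewrite e // eH.
  - move=> u p; rewrite !inE => /andP[uC uH] _ pN + _; have pC : p \notin C' by apply: contraL pN; apply: nC.
    rewrite pC /= => pH; rewrite e; last by rewrite subUset sub1set pN (subset_trans (subD1set _ _)).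
    have -> : (p |: H :\: C' :\ u) :|: C' = p |: H :\ u.
      rewrite -{2}eH; apply/setP=> z; rewrite !inE.
      by case: (eqVneq z p) => //= _; case: (eqVneq z u) => [->|] //=; rewrite (negbTE uC).
    apply: ex => //; first exact: (subsetP sN).
    by rewrite !inE pN andbF.
  move=> C1 Q1 [o1 _ _]; have /andP[s1 s2] := val _ _ (roct_up o1).
  have d1 := dC (subset_trans (subsetUl _ _) (oct_sub mN o1)).
  apply/andP; split; first by rewrite subsetD d1 andbT; apply: subset_trans s1; apply: subsetUl.
  by rewrite subDset setUA [C' :|: _]setUC.
have [o1 eC] := roct_down o; have [|H [[bH _ _ ex] val]] := r; first by exists (C :\: C'), Q; apply: roct0.
have sH := base_sub mN bH; have dH := dC sH.
exists (H :|: C'); split; first split.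
- by rewrite -e.
- exact: subsetUr.
- apply: disjointP => z; rewrite !inE => /and3P[zC zN _]; rewrite (negbTE zC) orbF.
  by apply: contra zN; apply: (subsetP sH).
- move=> u p; rewrite !inE => /orP[uH|->] // uC pE /norP[pH pC]; rewrite !negb_and negbK (negbTE pC) pE orbF /= negbK => pN.
  have -> : p |: (H :|: C') :\ u = (p |: H :\ u) :|: C'.
    apply/setP=> z; rewrite !inE; case: (eqVneq z p) => //= _.
    by case: (eqVneq z u) => [->|] //=; rewrite (negbTE uC).
  rewrite -e; first by apply: ex; rewrite ?inE.
  by rewrite subUset sub1set pN (subset_trans (subD1set _ _)).
move=> C1 Q1 o2; have [o3 eC1] := roct_down o2; have /andP[s1 s2] := val _ _ (roct0 o3).
by rewrite eC1 /inoct setUSS // setUAC setSU.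
Qed.

End MinorR.

(* This is the minor [M / C0 \ D0] only if some basis contains [C0] and avoids [D0]. *)
Definition del_con M C0 D0 : matroid T :=
  Matroid (ground M :\: (C0 :|: D0)) [set X : {set T} | (X \subset ground M :\: (C0 :|: D0)) && (X :|: C0 \in bases M)].

Lemma del_con_minor M C0 D0 B : is_matroid M -> B \in bases M -> C0 \subset B -> [disjoint D0 & B] ->
  is_matroid (del_con M C0 D0) /\ minor (del_con M C0 D0) M.
Proof.
move=> mM b sC dD; set G := ground M :\: (C0 :|: D0).
have dG X : X \subset G -> [disjoint X & C0].
  by move=> sX; apply: disjointP => x /(subsetP sX); rewrite !inE => /andP[/norP[]].
have eB Y : C0 \subset Y -> Y :\: C0 :|: C0 = Y by apply: setDUK.
have inG Y : Y \in bases M -> [disjoint D0 & Y] -> Y :\: C0 \subset G.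
  move=> bY d; apply/subsetP=> x; rewrite !inE => /andP[xC xY].
  by rewrite (negbTE xC) (base_in mM bY xY) andbT /= (disjointFl d xY).
split.
  split.
  - by apply/set0Pn; exists (B :\: C0); rewrite !inE inG // eB.
  - by move=> X; rewrite inE => /andP[].
  move=> X1 X2 x; rewrite !inE => /andP[s1 b1] /andP[s2 b2] /andP[x2 x1].
  have xC := disjointFr (dG _ s1) x1.
  have [||y [y2 y1 b3]] := exch mM b1 b2 (x := x); rewrite ?inE ?x1 ?(negbTE x2) ?xC //.
  move: y2 y1; rewrite !inE => yX /norP[y1 yC]; rewrite (negbTE yC) orbF in yX.
  exists y; first by rewrite inE y1.
  rewrite inE subUset sub1set (subsetP s2) // (subset_trans (subD1set _ _)) //=.
  suff -> : (y |: X1 :\ x) :|: C0 = y |: (X1 :|: C0) :\ x by [].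
  apply/setP=> z; rewrite !inE; case: (eqVneq z y) => //= _.
  by case: (eqVneq z x) => [->|] //=; rewrite xC.
have iC : indep M C0 by apply/indepP; exists B.
split; first exact: subsetDl.
exists C0; split.
  apply/subsetP=> x xC; rewrite /= !inE xC /=.
  by apply: (base_in mM b); apply: (subsetP sC).
move=> X /= sX; have := indep_rank C0 mM; rewrite iC => /esym/eqP ->.
have -> : #|X| + #|C0| = #|X :|: C0|.
  by have [_ h] := leq_card_setU X C0; have := dG _ sX; rewrite -h => /eqP.
rewrite -indep_rank //; apply/indepP/indepP=> [[Y]|[Y bY]].
  by rewrite inE => /andP[_ bY] sY; exists (Y :|: C0) => //; apply: setSU.
move=> sY; have [B' [b' sI sU]] := extend mM bY sY b.
have sC' : C0 \subset B' by apply: subset_trans sI; apply: subsetUr.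
exists (B' :\: C0); last by rewrite subsetD dG // andbT; apply: subset_trans sI; apply: subsetUl.
rewrite inE eB // b' andbT inG //; apply: disjointP => x xD; apply/negP=> /(subsetP sU).
rewrite !inE (disjointFr dD xD) orbF => /orP[/(subsetP sX)|/(subsetP sC)]; first by rewrite !inE xD orbT.
by rewrite (disjointFr dD xD).
Qed.

(** An octahedron of the pair provides a basis that contains [C0] and avoids [D0], which makes
    [del_con] an actual minor. When there is no octahedron the claim holds trivially. *)
Lemma rR_del_con M C0 D0 : excluded_minor_R M -> C0 \subset ground M -> D0 \subset ground M ->
  [disjoint C0 & D0] -> C0 :|: D0 != set0 -> rR M C0 D0.
Proof.
move=> [mM _ ex] sC sD dCD /set0Pn[x xCD] [C [Q [o sC0 dD]]].
have [B [b CB BQ]] := oct_ex o.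
have [mN miN] : is_matroid (del_con M C0 D0) /\ minor (del_con M C0 D0) M.
  by apply: (del_con_minor mM b); [apply: subset_trans CB | apply: disjointWr dD].
have /(in_R_rR mN) r : in_R (del_con M C0 D0).
  apply: ex => //; split=> //; apply/eqP=> /= e; have : x \in ground M.
    by move: xCD; rewrite inE => /orP[/(subsetP sC)|/(subsetP sD)].
  by rewrite -e inE xCD.
have [|||_ h] := @rR_minor M (del_con M C0 D0) mM mN C0.
- exact: subsetDl.
- by apply/subsetP=> y yC; rewrite /= !inE yC (subsetP sC).
- by move=> X /= sX; rewrite inE sX.
have := h r; rewrite /=; have -> : ground M :\: (ground M :\: (C0 :|: D0)) :\: C0 = D0; last first.
  by apply; exists C, Q.
rewrite setDDK ?subUset ?sC //; apply/setP=> y; rewrite !inE.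
by case: (boolP (y \in C0)) => //= yC; rewrite (disjointFr dCD yC).
Qed.

Lemma excluded_excl M : is_matroid M -> excluded_minor_R M <-> excl M.
Proof.
move=> mM; split=> [exM|[_ nR ex]].
  have [_ nR _] := exM; split=> //; first by move/(in_R_rR mM).
  move=> e eE; split; apply: rR_del_con; rewrite ?sub0set ?sub1set ?setU0 ?set0U //;
    try (by apply/set0Pn; exists e; rewrite inE).
  - by rewrite disjoint_sym disjoints_subset sub0set.
  - by rewrite disjoints_subset sub0set.
split=> //; first by move/(in_R_rR mM).
move=> N mN [miN neN]; have [C' sC e] := minor_base mM mN miN; have [sN _] := miN.
apply/(in_R_rR mN)/(rR_minor mM mN sN sC e); apply: excl_mono; first by split.
- by apply: subset_trans sC _; apply: subsetDl.
- by rewrite setDDl subsetDl.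
rewrite -negb_and; apply: contra neN => /andP[/eqP C0]; rewrite C0 setD0 setD_eq0 => s.
by rewrite eqEsubset sN.
Qed.

End Minors.

(** * Double exchanges from a free basis *)

Section DoubleExchange.
Variable T : finType.
Implicit Types (M N : matroid T) (B C D E H I P X Y Q : {set T}).

(* If [H] and all its single exchanges are bases, the fundamental matrix of [H] has no zero entry, and [dx M H u v p q]
   says that its 2x2 minor with rows [u], [v] and columns [p], [q] does not vanish. *)
Definition dx M H u v p q : bool := p |: (q |: (H :\ u :\ v)) \in bases M.

Lemma cardsD2 H u v : u \in H -> v \in H -> u != v -> #|H| = #|H :\ u :\ v|.+2.
Proof.
by move=> uH vH uv; rewrite (cardsD1 u H) uH (cardsD1 v (H :\ u)) !inE vH (eq_sym v) uv.
Qed.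

Lemma dxCr M H u v p q : dx M H u v p q = dx M H v u p q.
Proof. by rewrite /dx setDDl (setUC [set u]) -setDDl. Qed.

Lemma dxCc M H u v p q : dx M H u v p q = dx M H u v q p.
Proof. by rewrite /dx setUCA. Qed.

Section Transitivity.
Variables (M : matroid T) (mM : is_matroid M).

(** The contrapositive of transitivity: on columns [p, q], vanishing of the determinant is
    transitive through a row [v] with a nonzero entry at [p]. *)
Lemma dx_row H u v w p q : v \in H -> u \in H -> w \in H -> v != u -> v != w -> u != w ->
  p \notin H -> q \notin H -> p != q -> p |: (H :\ v) \in bases M ->
  dx M H u w p q -> dx M H u v p q || dx M H v w p q.
Proof.
move=> vH uH wH vu vw uw pH qH pq b1; rewrite /dx => b2.
set K := p |: (H :\ u :\ v :\ w).
have e1 : p |: (H :\ v) = u |: (w |: K) by rewrite /K; set_eq.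
have e2 : p |: (q |: (H :\ u :\ w)) = q |: (v |: K) by rewrite /K; set_eq.
have e3 : p |: (q |: (H :\ v :\ w)) = u |: (q |: K) by rewrite /K; set_eq.
have e4 : p |: (q |: (H :\ u :\ v)) = w |: (q |: K) by rewrite /K; set_eq.
rewrite e1 in b1; rewrite e2 in b2; rewrite e3 e4.
have [||->|->] := rank2_exchange mM b1 b2; rewrite ?orbT // /K ?inE; atoms => //.
Qed.

(** The same transitivity for columns on rows [u, v], through a column [q] with a nonzero entry at
    [v]. *)
Lemma dx_col H u v p q s : u \in H -> v \in H -> u != v ->
  p \notin H -> q \notin H -> s \notin H -> q |: (H :\ v) \in bases M ->
  dx M H u v p s -> dx M H u v p q || dx M H u v q s.
Proof.
move=> uH vH uv pH qH sH b2; rewrite /dx => b1.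
have e : q |: (H :\ v) = q |: (u |: (H :\ u :\ v)) by set_eq.
rewrite e in b2; have [||->|h] := rank2_exchange mM b1 b2; rewrite ?inE ?eqxx ?andbF //; atoms => //.
by rewrite [X in _ || (X \in _)]setUCA h orbT.
Qed.

End Transitivity.

(** The six bases are [H], four of its single exchanges, and the double exchange. *)
Lemma oct_at M C0 D0 H u v p q : is_matroid M -> rfree M C0 D0 H ->
  u \in H :\: C0 -> v \in H :\: C0 -> u != v ->
  p \in ground M :\: (H :|: D0) -> q \in ground M :\: (H :|: D0) -> p != q ->
  dx M H u v p q -> roct M C0 D0 (H :\ u :\ v) [set u; v; p; q].
Proof.
move=> mM [bH CH DH ex]; rewrite !inE => /andP[uC uH] /andP[vC vH] uv.
rewrite negb_or => /andP[/andP[pH pD] pE]; rewrite negb_or => /andP[/andP[qH qD] qE] pq d.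
split.
- apply: octI; rewrite /= ?inE; atoms => //.
  + by have -> : u |: (v |: (H :\ u :\ v)) = H by set_eq.
  + have -> : u |: (p |: (H :\ u :\ v)) = p |: (H :\ v) by set_eq.
    exact: ex.
  + have -> : u |: (q |: (H :\ u :\ v)) = q |: (H :\ v) by set_eq.
    exact: ex.
  + have -> : v |: (p |: (H :\ u :\ v)) = p |: (H :\ u) by set_eq.
    exact: ex.
  + have -> : v |: (q |: (H :\ u :\ v)) = q |: (H :\ u) by set_eq.
    exact: ex.
- apply/subsetP=> z zC; rewrite !inE (subsetP CH) // andbT.
  by apply/andP; split; [apply: contraNneq vC => <- | apply: contraNneq uC => <-].
apply: disjointP => z zD; have zH := disjointFr DH zD; rewrite !inE zH !andbF /=.
rewrite !negb_or -!andbA; apply/and4P; split; apply: contraTneq zD => ->.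
- by apply: contraT => /negPn/(disjointFr DH); rewrite uH.
- by apply: contraT => /negPn/(disjointFr DH); rewrite vH.
- exact: pD.
- exact: qD.
Qed.

Lemma at_oct M H C Q : is_matroid M -> oct M C Q -> H \in bases M -> inoct H C Q ->
  exists u v p q, [/\ [/\ u \in H, v \in H & u != v], [/\ p \notin H, q \notin H & p != q],
    C = H :\ u :\ v, Q = [set u; v; p; q] & dx M H u v p q].
Proof.
move=> mM o bH /andP[CH HQ]; have [c dj b] := o.
have cH : #|H :\: C| == 2.
  have [x [y [xQ yQ xy]]] := card4_2 c.
  by rewrite cardsD (setIidPr CH) (card_bases mM bH (b x y xQ yQ xy)) (card_oct o) // -addn2 addKn.
case/cards2P: cH => u [v [uv e]].
have [uH vH] : u \in H :\: C /\ v \in H :\: C by rewrite e !inE !eqxx orbT.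
move: uH vH; rewrite !inE => /andP[uC uH] /andP[vC vH].
have uQ : u \in Q by have := subsetP HQ u uH; rewrite inE (negbTE uC).
have vQ : v \in Q by have := subsetP HQ v vH; rewrite inE (negbTE vC).
have [p [q [uq eQ]]] := card4P c uQ vQ uv.
have eC : C = H :\ u :\ v by rewrite setDDl -e setDDK.
move: uq; rewrite /= !inE => /and4P[/norP[_ /norP[up uq]] /norP[vp vq] pq _].
have nH z : z \in Q -> z != u -> z != v -> z \notin H.
  by move=> zQ zu zv; have := oct_notin o zQ; rewrite eC !inE zu zv.
have [pQ qQ] : p \in Q /\ q \in Q by rewrite eQ !inE !eqxx !orbT.
exists u, v, p, q; split=> //.
- by split=> //; apply: nH; rewrite // eq_sym.
- by rewrite /dx -eC b.
Qed.

(* In a non-binary member of the class, un-relaxing any free basis that lies in an octahedron gives a binary matroid. *)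
Lemma rfree_rvalid M C0 D0 H1 H u v p q : is_matroid M -> rvalid M C0 D0 H1 -> rfree M C0 D0 H ->
  u \in H :\: C0 -> v \in H :\: C0 -> u != v ->
  p \in ground M :\: (H :|: D0) -> q \in ground M :\: (H :|: D0) -> p != q ->
  dx M H u v p q -> rvalid M C0 D0 H.
Proof.
move=> mM [f1 val1] f uR vR uv pS qS pq d.
have all a b y z : a \in H :\: C0 -> b \in H :\: C0 -> a != b ->
  y \in ground M :\: (H :|: D0) -> z \in ground M :\: (H :|: D0) -> y != z ->
  dx M H a b y z -> inoct H1 (H :\ a :\ b) [set a; b; y; z].
  by move=> aR bR ab yS zS yz dd; apply: val1; apply: oct_at.
have [bH CH DH ex] := f; have [bH1 CH1 DH1 ex1] := f1.
have cH := card_bases mM bH1 bH.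
have [e|neH] := eqVneq H1 H; first by split=> // C Q; rewrite -e; apply: val1.
split=> // C Q o.
(* The witness [H1] lies in the octahedron at [H], so it consists of [H :\ u :\ v] and two of
   [u, v, p, q]. *)
have := all _ _ _ _ uR vR uv pS qS pq d => /andP[s1 s2].
move: (uR) (vR) (pS) (qS); rewrite !inE => /andP[uC uH] /andP[vC vH].
rewrite !negb_or => /andP[/andP[pH pD] pE] /andP[/andP[qH qD] qE].
(* The case of a single exchange, [H1 = c |: (H :\ x)]. By [F] every nonvanishing determinant of [H]
   uses row [x] and column [c]. Read at [H1], this makes every octahedron exchange [c] out and [x]
   in, so that [H] lies in it. *)
have one x : x \in H -> x \notin H1 -> H :\ x \subset H1 -> inoct H C Q.
  move=> xH xH1 sx.
  have : #|H1 :\: (H :\ x)| == 1.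
    by rewrite cardsD (setIidPr sx) cH (cardsD1 x H) xH addnK.
  case/cards1P=> c ec.
  have : c \in H1 :\: (H :\ x) by rewrite ec !inE.
  rewrite !inE negb_and negbK => /andP[cx cH1].
  have cx' : c != x by apply: contraTneq cH1 => ->.
  have cnH : c \notin H by case/orP: cx => // /eqP e; rewrite e eqxx in cx'.
  have e1 : H1 = c |: (H :\ x) by rewrite -ec setUC -{1}(setIidPr sx) setID.
  have xC : x \notin C0 by apply: contra xH1; apply: subsetP.
  have cD : c \notin D0 by apply: contraL cH1 => /(disjointFr DH1) ->.
  have cE := base_in mM bH1 cH1.
  have F a b y z : a \in H :\: C0 -> b \in H :\: C0 -> a != b ->
     y \in ground M :\: (H :|: D0) -> z \in ground M :\: (H :|: D0) -> y != z ->
     dx M H a b y z -> ((x == a) || (x == b)) && ((c == y) || (c == z)).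
    move=> aR bR ab yS zS yz dd; have /andP[t1 t2] := all _ _ _ _ aR bR ab yS zS yz dd.
    apply/andP; split.
      have := contra (subsetP t1 x) xH1; rewrite !inE xH andbT negb_and !negbK orbC.
      by [].
    have [aH bH'] : a \in H /\ b \in H by move: aR bR; rewrite !inE => /andP[_ ->] /andP[_ ->].
    by have := subsetP t2 c cH1; rewrite !inE; atoms.
  have K1 b y z : b \in H1 -> b != c -> b \notin C0 -> y \notin H1 -> z \notin H1 ->
     y \in ground M -> z \in ground M -> y \notin D0 -> z \notin D0 -> y != z ->
     dx M H1 c b y z -> (x == y) || (x == z).
    move=> b1 bc bC y1 z1 yE zE yD zD yz; have bH' : b \in H.
      by move: b1; rewrite e1 !inE (negbTE bc) /= => /andP[].
    have bx : b != x by apply: contraTneq b1 => ->.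
    have -> : dx M H1 c b y z = dx M H x b y z.
      rewrite /dx; suff -> : H1 :\ c :\ b = H :\ x :\ b by [].
      by rewrite e1; set_eq.
    move=> dd; apply: contraT; rewrite negb_or => /andP[xy xz].
    have nH w : w \notin H1 -> x != w -> w \notin H.
      by move=> w1 xw; apply: contra w1 => wH; rewrite e1 !inE; atoms.
    have yH := nH _ y1 xy; have zH := nH _ z1 xz; rewrite eq_sym in bx.
    by have := F x b y z; rewrite !inE; atoms => /(_ isT isT isT isT isT isT dd).
  have K2 a b z : a \in H1 -> b \in H1 -> a != c -> b != c -> a != b -> a \notin C0 -> b \notin C0 ->
     z \notin H1 -> z != x -> z \in ground M -> z \notin D0 -> dx M H1 a b x z -> False.
    move=> a1 b1 ac bc ab aC bC z1 zx zE zD.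
    have [aH bH'] : a \in H /\ b \in H.
      by move: a1 b1; rewrite e1 !inE (negbTE ac) (negbTE bc) /= => /andP[_ ->] /andP[].
    have ax : a != x by apply: contraTneq a1 => ->.
    have bx : b != x by apply: contraTneq b1 => ->.
    have zH : z \notin H by apply: contra z1 => zH; rewrite e1 !inE zx zH orbT.
    have cz : c != z by apply: contraNneq z1 => <-.
    have -> : dx M H1 a b x z = dx M H a b c z.
      rewrite /dx; suff -> : x |: (z |: H1 :\ a :\ b) = c |: (z |: H :\ a :\ b) by [].
      by rewrite e1; set_eq.
    by move=> dd; have := F a b c z; rewrite !inE; atoms => /(_ isT isT isT isT isT isT dd).
  have [o' sC0 dQ] := o.
  have [a [b [y [z [[a1 b1 ab] [y1 z1 yz] eC eQ dd]]]]] := at_oct mM o' bH1 (val1 _ _ o).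
  have aC : a \notin C0 by apply: contraL sC0 => aC; apply/negP=> /subsetP/(_ a aC); rewrite eC !inE eqxx andbF.
  have bC : b \notin C0 by apply: contraL sC0 => bC; apply/negP=> /subsetP/(_ b bC); rewrite eC !inE eqxx.
  have yE : y \in ground M by apply: (subsetP (oct_sub mM o')); rewrite eQ !inE eqxx !orbT.
  have zE : z \in ground M by apply: (subsetP (oct_sub mM o')); rewrite eQ !inE eqxx !orbT.
  have yD : y \notin D0 by apply: contraL dQ => yD; apply/pred0Pn; exists y; rewrite /= yD eQ !inE eqxx !orbT.
  have zD : z \notin D0 by apply: contraL dQ => zD; apply/pred0Pn; exists z; rewrite /= zD eQ !inE eqxx !orbT.
  suff /andP[cab xyz] : ((c == a) || (c == b)) && ((x == y) || (x == z)).
    apply/andP; split; apply/subsetP=> w.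
      rewrite eC e1 !inE => /and3P[wb wa /orP[/eqP e|/andP[]//]].
      by move: cab; rewrite -e (eq_sym w a) (eq_sym w b) eq_sym (negbTE wa) eq_sym (negbTE wb).
    rewrite eC eQ e1 !inE => wH; have [->|wx] := eqVneq w x; first by rewrite -orbA xyz !orbT.
    by rewrite wH !orbT; case: (w == a); case: (w == b); rewrite ?orbT.
  have [ca|ca] := eqVneq c a.
    rewrite -ca in dd ab; have bc : b != c by rewrite eq_sym.
    by rewrite (K1 b y z).
  have [cb|cb] := eqVneq c b.
    rewrite -cb in dd ab; rewrite dxCr in dd.
    by rewrite (K1 a y z).
  rewrite eq_sym in ca; rewrite eq_sym in cb.
  have [xy|xy] := eqVneq x y.
    rewrite -xy in dd yz; case: (@K2 a b z) => //; by rewrite eq_sym.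
  have [xz|xz] := eqVneq x z.
    rewrite -xz in dd yz; rewrite dxCc in dd; by case: (@K2 a b y).
  (* An octahedron at [H1] involving neither [c] nor [x] is compared with row [c]: this gives one
     that exchanges [c] out without bringing [x] in, against [K1]. *)
  have [] : dx M H1 a c y z || dx M H1 c b y z.
    by apply: dx_row => //; rewrite 1?eq_sym //; apply: ex1 => //; apply: contra xC; rewrite ?inE; move=> cC0; case/negP: cnH; apply: (subsetP CH).
  case/orP=> h; [rewrite dxCr in h; have := K1 a y z a1 ca aC y1 z1 yE zE yD zD yz h
                |have := K1 b y z b1 cb bC y1 z1 yE zE yD zD yz h]; by rewrite (negbTE xy) (negbTE xz).
have [u1|u1] := boolP (u \in H1); have [v1|v1] := boolP (v \in H1).
- case/negP: neH; rewrite eq_sym eqEcard cH leqnn andbT; apply/subsetP=> z zH.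
  have [->//|zu] := eqVneq z u; have [->//|zv] := eqVneq z v.
  by apply: (subsetP s1); rewrite !inE zu zv.
- apply: (one v) => //; apply/subsetP=> z; rewrite !inE => /andP[zv zH].
  by have [->//|zu] := eqVneq z u; apply: (subsetP s1); rewrite !inE zu zv.
- apply: (one u) => //; apply/subsetP=> z; rewrite !inE => /andP[zu zH].
  by have [->//|zv] := eqVneq z v; apply: (subsetP s1); rewrite !inE zu zv.
have two y : H1 \subset y |: (H :\ u :\ v) -> False.
  move/subset_leq_card; rewrite cH leqNgt => /negP[].
  by rewrite cardsU1 (cardsD2 uH vH uv); case: (_ \notin _); rewrite /= ltnS ?leqnSn.
have p1 : p \in H1.
  apply: contraT => p1; case: (two q); apply/subsetP=> z z1; have := subsetP s2 z z1; rewrite !inE.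
  by atoms; rewrite orbC.
have q1 : q \in H1.
  apply: contraT => q1; case: (two p); apply/subsetP=> z z1; have := subsetP s2 z z1; rewrite !inE.
  by atoms; rewrite orbC.
(* The case of a double exchange, [H1 = p |: (q |: (H :\ u :\ v))]. One more row or column would
   give an octahedron at [H] in which [H1] does not lie, so the minor has only the elements
   [u, v, p, q], and a single octahedron. *)
have R2 w : w \in H :\: C0 -> (w == u) || (w == v).
  move=> wR; apply: contraT; rewrite negb_or => /andP[wu wv]; move: (wR); rewrite inE => /andP[wC wH].
  have := dx_row mM wH uH vH wu wv uv pH qH pq (ex w p wH wC pE pH pD) d.
  case/orP=> h; [have := all _ _ _ _ uR wR _ pS qS pq h | have := all _ _ _ _ wR vR _ pS qS pq h];
    rewrite ?(eq_sym u) => /(_ _) /andP[//|/subsetP].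
  + by move/(_ v); rewrite !inE (eq_sym v u) (eq_sym v w) uv wv vH (negbTE v1) => /(_ isT).
  + by move/(_ u); rewrite !inE uv (eq_sym u w) wu uH (negbTE u1) => /(_ isT).
have S2 s : s \in ground M :\: (H :|: D0) -> (s == p) || (s == q).
  move=> sS; apply: contraT; rewrite negb_or => /andP[sp sq].
  move: (sS); rewrite !inE negb_or => /andP[/andP[sH sD] sE].
  have := dx_col mM uH vH uv pH sH qH (ex v s vH vC sE sH sD) d.
  have ps : p != s by rewrite eq_sym.
  case/orP=> h; [have := all _ _ _ _ uR vR uv pS sS ps h | have := all _ _ _ _ uR vR uv sS qS sq h];
    case/andP=> _ /subsetP.
  + by move/(_ q q1); rewrite !inE; atoms.
  + by move/(_ p p1); rewrite !inE; atoms.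
have [o' sC0 dQ] := o; have [c dj b] := o'.
have sCH : H :\ u :\ v \subset C0.
  apply/subsetP=> z; rewrite !inE => /and3P[zv zu zH]; apply: contraT => zC.
  by have := R2 z; rewrite !inE zC zH (negbTE zu) (negbTE zv) => /(_ isT).
have eC : C = H :\ u :\ v.
  apply/eqP; rewrite eq_sym eqEcard (subset_trans sCH sC0) /=.
  have [x [y [xQ yQ xy]]] := card4_2 c.
  have := card_oct o' xQ yQ xy; rewrite (card_bases mM (b x y xQ yQ xy) bH) => e.
  by rewrite -ltnS -ltnS -e (cardsD2 uH vH uv).
have sQ : Q \subset [set u; v; p; q].
  apply/subsetP=> z zQ; rewrite !inE -!orbA orbA; have zC := oct_notin o' zQ.
  have zE : z \in ground M by apply: (subsetP (oct_sub mM o')); rewrite inE zQ orbT.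
  have zD : z \notin D0 by apply: contraL dQ => zD; apply/pred0Pn; exists z; rewrite /= zD inE zQ orbT.
  have [zH|zH] := boolP (z \in H).
    by move: zC; rewrite eC !inE zH andbT negb_and !negbK orbC => ->.
  by rewrite S2 ?orbT // !inE zE negb_or zH zD.
have eQ : Q = [set u; v; p; q].
  apply/eqP; rewrite eqEcard sQ c card4E // /= !inE; atoms => //.
rewrite /inoct eC eQ; apply/andP; split; first by rewrite setDDl subsetDl.
by apply/subsetP=> z zH; rewrite !inE zH; case: (z == u); case: (z == v).
Qed.

End DoubleExchange.

(** * The small excluded minors *)

Section Embeddings.
Variables T T' : finType.
Implicit Types (M : matroid T) (N : matroid T').

(* [N] is a copy of the minor of [M] obtained by contracting [C] and deleting all other elements outside the image of [g]. *)
Definition emb M N (g : T' -> T) (C : {set T}) : Prop :=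
  [/\ {in ground N &, injective g}, g @: ground N \subset ground M,
      [disjoint C & g @: ground N] &
      forall X : {set T'}, X \subset ground N -> (X \in bases N) = (g @: X :|: C \in bases M)].

(* [excl] without the requirement that [N] be a matroid, which for the concrete [N] follows from an isomorphism. *)
Definition excl_core (S : finType) (N : matroid S) : Prop :=
  ~ rR N set0 set0 /\ forall e, e \in ground N -> rR N [set e] set0 /\ rR N set0 [set e].

Section Transfer.
Variables (M : matroid T) (N : matroid T') (g : T' -> T) (C : {set T}).
Hypotheses (mM : is_matroid M) (sN : forall B, B \in bases N -> B \subset ground N).
Hypotheses (em : emb M N g C) (sC : C \subset ground M).
Local Notation D := (ground M :\: (C :|: g @: ground N)).

Let inj : {in ground N &, injective g}. Proof. by case: em. Qed.

Let im_in (X : {set T'}) x : X \subset ground N -> x \in ground N -> (g x \in g @: X) = (x \in X).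
Proof.
move=> sX xN; apply/imsetP/idP => [[y yX e]|xX]; last by exists x.
by rewrite (inj xN _ e) // (subsetP sX).
Qed.

Let im_C x : x \in ground N -> g x \in C = false.
Proof. by case: em => _ _ d _ xN; rewrite (disjointFl d) ?imset_f. Qed.

Lemma oct_subN C1 Q1 : oct N C1 Q1 -> C1 :|: Q1 \subset ground N.
Proof.
move=> o; have [c _ b] := o; have [x [y [xQ yQ xy]]] := card4_2 c.
apply/subsetP=> z; rewrite inE => /orP[zC|zQ].
  by apply: (subsetP (sN (b x y xQ yQ xy))); rewrite !inE zC !orbT.
have [e|zx] := eqVneq z x; first by apply: (subsetP (sN (b x y xQ yQ xy))); rewrite !inE e eqxx.
by apply: (subsetP (sN (b z x zQ xQ zx))); rewrite !inE eqxx.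
Qed.

Lemma emb_oct C1 Q1 : oct N C1 Q1 -> oct M (g @: C1 :|: C) (g @: Q1).
Proof.
move=> o; have s := oct_subN o; have [c dj b] := o.
have /subsetP sQ := subset_trans (subsetUr _ _) s; have /subsetP sC1 := subset_trans (subsetUl _ _) s.
split.
- by rewrite card_in_imset // => x y /sQ xN /sQ yN; apply: inj.
- apply: disjointP => z /setUP[/imsetP[x xC ->]|zC].
    by rewrite im_in ?sC1 // ?(disjointFr dj xC) //; apply/subsetP.
  by apply/negP=> /imsetP[y /sQ yN e]; rewrite e im_C in zC.
move=> _ _ /imsetP[x xQ ->] /imsetP[y yQ ->] gxy.
have xy : x != y by apply: contraNneq gxy => ->.
have [_ _ _ e] := em; have := b x y xQ yQ xy; rewrite e; last exact: sN (b x y xQ yQ xy).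
by rewrite !imsetU1 -!setUA.
Qed.

(** A witness in [M] contains [C] and avoids all deleted elements, so it is determined by its
    preimage under [g], which is a witness in [N]. *)
Lemma emb_rR (C0 D0 : {set T'}) : C0 \subset ground N -> D0 \subset ground N ->
  rR M (g @: C0 :|: C) (D :|: g @: D0) -> rR N C0 D0.
Proof.
move=> sC0 sD0 r [C1 [Q1 o1]]; have [_ sE dC e] := em.
have up C2 Q2 : roct N C0 D0 C2 Q2 -> roct M (g @: C0 :|: C) (D :|: g @: D0) (g @: C2 :|: C) (g @: Q2).
  move=> [o s d]; split; first exact: emb_oct.
    by rewrite setSU // imsetS.
  have s2 := oct_subN o; rewrite setUAC -imsetU.
  apply: disjointP => z; rewrite !inE => /orP[/andP[/norP[zC zN] zE]|/imsetP[x xD ->]].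
    rewrite negb_or zC andbT; apply: contra zN; apply: subsetP; exact: imsetS.
  by rewrite im_C ?(subsetP sD0) // orbF im_in ?(subsetP sD0) // (disjointFr d xD).
have [|H [[bH CH DH ex] val]] := r; first by exists (g @: C1 :|: C), (g @: Q1); apply: up.
pose H' := [set i in ground N | g i \in H].
have sH' : H' \subset ground N by apply/subsetP=> x; rewrite inE => /andP[].
have CH' : C \subset H by apply: subset_trans CH; apply: subsetUr.
have eH : g @: H' :|: C = H.
  apply/eqP; rewrite eqEsubset subUset CH' andbT; apply/andP; split.
    by apply/subsetP=> _ /imsetP[x + ->]; rewrite inE => /andP[].
  apply/subsetP=> z zH; rewrite inE orbC; case zC: (z \in C) => //=.
  have := disjointFl DH zH; rewrite !inE zC (base_in mM bH zH) andbT => /norP[/negbNE/imsetP[x xN ez] _].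
  by apply/imsetP; exists x => //; rewrite inE xN -ez.
exists H'; split; first split.
- by rewrite e // eH.
- apply/subsetP=> x xC; rewrite inE (subsetP sC0) //=; apply: (subsetP CH).
  by rewrite inE imset_f.
- apply: disjointP => x xD; rewrite inE (subsetP sD0) //=; apply/negbT.
  by apply: (disjointFr DH); rewrite inE imset_f ?orbT.
- move=> u p; rewrite !inE => /andP[uN uH] uC pN; rewrite pN /= => pH pD.
  have uH' : u \in H' by rewrite inE uN.
  rewrite e; last by rewrite subUset sub1set pN (subset_trans (subD1set _ _)).
  have -> : g @: (p |: H' :\ u) :|: C = g p |: (H :\ g u).
    rewrite imsetU1 -setUA; congr (_ |: _).
    apply/setP=> z; rewrite -eH !inE; have [->|zu] := eqVneq z (g u).
      by rewrite im_C // orbF /= im_in ?inE ?eqxx // (subset_trans (subD1set _ _)).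
    congr (_ || _); apply/imsetP/imsetP => [[x + ez]|[x xH ez]].
      by rewrite inE => /andP[_ xH]; exists x.
    by exists x => //; rewrite !inE in xH *; rewrite xH andbT; apply: contraNneq zu => <-; rewrite ez.
  apply: ex => //.
  + by rewrite inE im_C // orbF im_in.
  + by apply: (subsetP sE); apply: imset_f.
  + by rewrite !inE im_C // (imset_f g pN) /= im_in.
move=> C2 Q2 o2; have /andP[s1 s2] := val _ _ (up _ _ o2).
have [o2' _ _] := o2; have s := oct_subN o2'; have sC2 := subset_trans (subsetUl _ _) s.
apply/andP; split; apply/subsetP=> x.
  move=> xC; rewrite inE (subsetP sC2) //=; apply: (subsetP s1); by rewrite inE imset_f.
rewrite inE => /andP[xN xH]; have := subsetP s2 _ xH; rewrite !inE im_C // orbF.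
by rewrite im_in // im_in // (subset_trans (subsetUr _ _) s).
Qed.

(** A copy of a non-member must be all of [M], because any contraction or deletion would put it into
    the class. *)
Lemma excl_emb : excl M -> ~ rR N set0 set0 -> C = set0 /\ g @: ground N = ground M.
Proof.
move=> exM nR; have [_ sE _ _] := em.
have : ~~ ((g @: set0 :|: C != set0) || (D :|: g @: set0 != set0)).
  apply/negP=> h; apply: nR; apply: emb_rR; rewrite ?sub0set //.
  by apply: excl_mono; rewrite ?imset0 ?set0U ?setU0 ?subsetDl // in h *.
rewrite !imset0 set0U setU0 negb_or !negbK => /andP[/eqP C0]; rewrite C0 set0U setD_eq0 => s.
by split=> //; apply/eqP; rewrite eqEsubset sE.
Qed.

End Transfer.

End Embeddings.

Section Iso.

Lemma emb_iso (T T' : finType) (M : matroid T) (N : matroid T') g : g @: ground N = ground M ->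
  emb M N g set0 -> iso N M.
Proof.
move=> eE [inj _ _ e]; exists g; split=> // X sX.
by rewrite e // setU0.
Qed.

Lemma iso_emb (T T' : finType) (M : matroid T) (N : matroid T') : iso M N ->
  exists2 f, emb N M f set0 & f @: ground M = ground N.
Proof.
case=> f [inj eE e]; exists f => //; split=> //.
- by rewrite eE.
- by rewrite disjoints_subset sub0set.
by move=> X sX; rewrite setU0 e.
Qed.

Lemma iso_sym (T T' : finType) (M : matroid T) (N : matroid T') x : x \in ground M ->
  (forall B, B \in bases N -> B \subset ground N) -> iso M N -> iso N M.
Proof.
move=> xM sN [f [inj eE e]].
pose g y := odflt x [pick z in ground M | f z == y].
have gK z : z \in ground M -> g (f z) = z.
  move=> zM; rewrite /g; case: pickP => [w /andP[wM /eqP /inj -> //]|/(_ z)].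
  by rewrite /= zM eqxx.
have fK y : y \in ground N -> f (g y) = y /\ g y \in ground M.
  by rewrite -eE => /imsetP[z zM ->]; rewrite gK.
have im (Y : {set T'}) : Y \subset ground N -> f @: (g @: Y) = Y.
  move=> /subsetP sY; rewrite -imset_comp -[RHS]imset_id; apply: eq_in_imset => y yY /=.
  by have [] := fK y (sY y yY).
exists g; split.
- by move=> y z /fK[ey _] /fK[ez _] eyz; rewrite -ey -ez eyz.
- apply/setP=> z; apply/imsetP/idP => [[y /fK[_ ?] ->] //|zM].
  by exists (f z); rewrite ?gK // -eE imset_f.
move=> Y sY; rewrite e ?im //; apply/subsetP=> _ /imsetP[y yY ->].
by have [] := fK y (subsetP sY y yY).
Qed.

Lemma rR_iso (T T' : finType) (M : matroid T) (N : matroid T') f (C0 D0 : {set T}) :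
  (forall B, B \in bases N -> B \subset ground N) -> (forall B, B \in bases M -> B \subset ground M) ->
  is_matroid N -> emb N M f set0 -> f @: ground M = ground N -> C0 \subset ground M -> D0 \subset ground M ->
  rR N (f @: C0) (f @: D0) -> rR M C0 D0.
Proof.
move=> sN sM mN em eE sC sD r; apply: (emb_rR mN sM em); rewrite ?sub0set //.
by rewrite set0U eE setDv set0U setU0.
Qed.

Lemma emb0_matroid (T T' : finType) (M : matroid T) (N : matroid T') g : is_matroid M ->
  bases N != set0 -> (forall B, B \in bases N -> B \subset ground N) ->
  emb M N g set0 -> is_matroid N.
Proof.
move=> mM ne sN [inj _ _ e]; split=> // B1 B2 x b1 b2; rewrite inE => /andP[x2 x1].
have [s1 s2] := (sN _ b1, sN _ b2); have xN := subsetP s1 x x1.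
have im (X : {set T'}) y : X \subset ground N -> y \in ground N -> (g y \in g @: X) = (y \in X).
  move=> sX yN; apply/imsetP/idP => [[z zX ez]|yX]; last by exists y.
  by rewrite (inj _ _ yN _ ez) // (subsetP sX).
have d1 : g @: B1 \in bases M by rewrite -[g @: _]setU0 -e.
have d2 : g @: B2 \in bases M by rewrite -[g @: _]setU0 -e.
have [||_ [/imsetP[y y2 ->] + b]] := exch mM d1 d2 (x := g x); rewrite ?im //; try exact: (subsetP s2).
have yN := subsetP s2 y y2 => y1.
exists y; rewrite ?inE ?y1 // e ?setU0; last by rewrite subUset sub1set yN (subset_trans (subD1set _ _)).
suff -> : g @: (y |: B1 :\ x) = g y |: g @: B1 :\ g x by [].
rewrite imsetU1; congr (_ |: _); apply/setP=> z; rewrite !inE; apply/imsetP/andP.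
  case=> w; rewrite !inE => /andP[wx w1] ->; rewrite imset_f //; split=> //.
  by apply: contraNneq wx => /inj -> //; apply: (subsetP s1).
by case=> zx /imsetP[w w1 ez]; exists w => //; rewrite !inE w1 andbT; apply: contraNneq zx => <-; rewrite ez.
Qed.

Lemma excl_core_iso (T T' : finType) (M : matroid T) (N : matroid T') x : x \in ground M ->
  is_matroid M -> (forall B, B \in bases N -> B \subset ground N) -> iso M N ->
  excl_core N -> excl M.
Proof.
move=> xM mM sN i [nR ex]; have sM B := @base_sub _ M B mM.
have [f emf eE] := iso_emb i; have [g emg eE'] := iso_emb (iso_sym xM sN i).
have mN : is_matroid N.
  apply: emb0_matroid emg => //; have [/set0Pn[B b] _ _] := mM; apply/set0Pn; exists (f @: B).
  by have [_ _ _ e] := emf; rewrite -[_ @: B]setU0 -e ?sM.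
split=> //.
  by move=> r; apply: nR; apply: (rR_iso sM sN mM emg eE'); rewrite ?sub0set ?imset0.
move=> e eM; have [|r1 r2] := ex (f e); first by rewrite -eE imset_f.
by split; apply: (rR_iso sN sM mN emf eE); rewrite ?sub0set ?sub1set ?imset0 ?imset_set1.
Qed.

Lemma excl_minor_iso (T T' : finType) (M : matroid T) (N : matroid T') g C x : x \in ground N ->
  excl M -> (forall B, B \in bases N -> B \subset ground N) -> emb M N g C ->
  C \subset ground M -> ~ rR N set0 set0 -> iso M N.
Proof.
move=> xN exM sN em sC nR; have [mM _ _] := exM.
have [C0 eE] := excl_emb mM sN em sC exM nR; rewrite C0 in em.
by apply: (@iso_sym _ _ N M x xN) (emb_iso eE em) => B; apply: base_sub.
Qed.

End Iso.

(** * The small matroids are excluded minors *)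

Section Concrete.

Lemma oct_card (T : finType) (M : matroid T) C Q n : oct M C Q ->
  (forall B, B \in bases M -> #|B| = n) -> n = #|C|.+2.
Proof.
move=> o cn; have [c _ b] := o; have [x [y [xQ yQ xy]]] := card4_2 c.
by rewrite -(card_oct o xQ yQ xy) cn // b.
Qed.

Lemma rR_con_rank2 (T : finType) (M : matroid T) e D0 : (forall B, B \in bases M -> #|B| = 2) -> rR M [set e] D0.
Proof.
move=> c2 [C [Q [o s _]]]; have [c] := oct_card o c2.
by have := subset_leq_card s; rewrite cards1 -c.
Qed.

Lemma oct_rank2 (T : finType) (M : matroid T) C Q : (forall B, B \in bases M -> #|B| = 2) -> oct M C Q -> C = set0.
Proof. by move=> c2 o; have [] := oct_card o c2; move/esym/eqP; rewrite cards_eq0 => /eqP. Qed.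

Lemma U25_base (B : {set 'I_5}) : (B \in bases (U 2 5)) = (#|B| == 2).
Proof. by rewrite inE. Qed.

(** All four-element sets are octahedra with empty [C], and no element belongs to all of them. After
    a deletion a single one remains, and any pair inside it is free. *)
Lemma excl_core_U25 : excl_core (U 2 5).
Proof.
have c2 (B : {set 'I_5}) : B \in bases (U 2 5) -> #|B| = 2 by rewrite U25_base => /eqP.
have oQ (Q : {set 'I_5}) : #|Q| = 4 -> oct (U 2 5) set0 Q.
  move=> c; split=> //; first by rewrite disjoints_subset sub0set.
  by move=> x y _ _ xy; rewrite U25_base setU0 cards2 xy.
have cD e : #|[set: 'I_5] :\ e| = 4 by have := cardsD1 e [set: 'I_5]; rewrite cardsT card_ord inE => -[].
split=> [r|e _].
  have [|H [[bH _ _ _] val]] := r.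
    by exists set0, ([set: 'I_5] :\ ord0); apply: roct0; apply: oQ.
  have := c2 _ bH; suff -> : H = set0 by rewrite cards0.
  apply/setP=> z; rewrite inE; apply/negP=> zH.
  have /andP[_ /subsetP/(_ z zH)] := val _ _ (roct0 (oQ _ (cD z))).
  by rewrite !inE eqxx.
split; first exact: rR_con_rank2.
move=> [C [Q [o _ d]]]; have [c _ b] := o; have [x [y [xQ yQ xy]]] := card4_2 c.
have Q1 C1 Q1 : roct (U 2 5) set0 [set e] C1 Q1 -> C1 = set0 /\ Q1 = [set: 'I_5] :\ e.
  move=> [o1 _ d1]; have [c1 _ _] := o1; split; first exact: oct_rank2 o1.
  apply/eqP; rewrite eqEcard cD c1 leqnn andbT subsetD1 subsetT /=; apply/negP=> eQ.
  by have := disjointFr d1 (set11 e); rewrite inE eQ orbT.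
have [_ eQ] := Q1 C Q (And3 o (sub0set _) d).
exists [set x; y]; split; first split.
- by rewrite U25_base cards2 xy.
- exact: sub0set.
- apply: disjointWr d; rewrite subUset !sub1set !inE xQ yQ !orbT //.
- by move=> u p uH _ _ pH _; rewrite U25_base card_swap // cards2 xy.
move=> C1 Q2 /Q1[-> ->]; rewrite -eQ /inoct sub0set set0U /=.
by rewrite subUset !sub1set xQ yQ.
Qed.

Lemma dsum_base (B : {set 'I_4 + 'I_1}) :
  (B \in bases (dsum (U 2 4) (U 0 1))) = (inr ord0 \notin B) && (#|B| == 2).
Proof.
apply/imset2P/andP => [[B1 B2]|[nB /eqP c]].
  rewrite !inE => /eqP c1; rewrite cards_eq0 => /eqP -> ->; rewrite imset0 setU0; split.
    by apply/imsetP=> -[].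
  by rewrite card_imset ?c1 //; apply: inl_inj.
have eB : B = inl @: (inl @^-1: B).
  apply/setP=> -[i|i].
    by rewrite mem_imset ?inE //; apply: inl_inj.
  rewrite (ord1 i) (negbTE nB); apply/esym/negbTE; by apply/imsetP=> -[].
exists (inl @^-1: B) set0; rewrite ?inE ?cards0 // ?imset0 ?setU0 //.
by have := card_imset (mem (inl @^-1: B)) (@inl_inj _ 'I_1); rewrite -eB c => <-.
Qed.

(** The complement of the loop [z] is the only octahedron, but [z] cannot be exchanged into a basis,
    so nothing is free. Deleting [z] makes every pair free, and deleting any other element destroys
    the octahedron. *)
Lemma excl_core_dsum : excl_core (dsum (U 2 4) (U 0 1)).
Proof.
set N := dsum _ _; set z : 'I_4 + 'I_1 := inr ord0.
have c2 (B : {set 'I_4 + 'I_1}) : B \in bases N -> #|B| = 2 by rewrite dsum_base => /andP[_ /eqP].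
have n z' : z' != z -> exists i, z' = inl i by case: z' => [i|i]; [exists i | rewrite (ord1 i) eqxx].
have cT : #|[set: 'I_4 + 'I_1] :\ z| = 4.
  by have := cardsD1 z [set: 'I_4 + 'I_1]; rewrite cardsT card_sum !card_ord inE => -[].
have oQ C Q : oct N C Q -> C = set0 /\ Q = [set: 'I_4 + 'I_1] :\ z.
  move=> o; have [c _ b] := o; split; first exact: oct_rank2 o.
  apply/eqP; rewrite eqEcard cT c leqnn andbT subsetD1 subsetT /=; apply/negP=> zQ.
  have [x [y [xQ yQ xy]]] := card4_2 c; have [x' xQ' xz] : exists2 x', x' \in Q & x' != z.
    by have [e|ne] := eqVneq x z; [exists y => //; rewrite -e eq_sym | exists x].
  by have := b x' z xQ' zQ xz; rewrite dsum_base !inE eqxx orbT.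
have o0 : oct N set0 ([set: 'I_4 + 'I_1] :\ z).
  split=> //; first by rewrite disjoints_subset sub0set.
  move=> x y; rewrite !inE !andbT => xz yz xy.
  by rewrite dsum_base setU0 cards2 xy andbT !inE !(eq_sym z) negb_or xz yz.
have zN : z \in ground N by rewrite !inE; apply/orP; right; apply/imsetP; exists ord0; rewrite ?inE.
split=> [r|e _].
  have [|H [[bH _ _ ex] _]] := r; first by exists set0, ([set: 'I_4 + 'I_1] :\ z); apply: roct0.
  have [u uH] : exists u, u \in H by apply/card_gt0P; rewrite (c2 H).
  have zH : z \notin H by move: bH; rewrite dsum_base => /andP[].
  by have := ex u z uH (negbT (in_set0 u)) zN zH (negbT (in_set0 z)); rewrite dsum_base !inE eqxx.
split; first exact: rR_con_rank2.
move=> [C [Q [o _ d]]]; have [_ eQ] := oQ _ _ o; have [c _ b] := o.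
have ez : e = z.
  apply/eqP/negPn/negP=> ez; have := disjointFr d (set11 e).
  by rewrite inE eQ !inE ez orbT.
have [x [y [xQ yQ xy]]] := card4_2 c; rewrite ez in d *.
have xyz : (z == x) = false /\ (z == y) = false.
  by move: xQ yQ; rewrite eQ !inE !andbT !(eq_sym z) => /negbTE -> /negbTE ->.
exists [set x; y]; split; first split.
- by rewrite dsum_base cards2 xy !inE xyz.1 xyz.2.
- exact: sub0set.
- by apply: disjointWr d; rewrite subUset !sub1set !inE xQ yQ !orbT.
- move=> u p uH _ _ pH; rewrite inE => pz; rewrite dsum_base card_swap // cards2 xy andbT.
  by rewrite !inE xyz.1 xyz.2 andbF orbF eq_sym.
move=> C1 Q1 [o1 _ _]; have [-> ->] := oQ _ _ o1.
by rewrite /inoct sub0set set0U -eQ subUset !sub1set xQ yQ.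
Qed.

Lemma K_base (B : {set 'I_7}) :
  (B \in bases K) = [exists a, exists b, (B == [set a; b]) && (Kcls a != Kcls b)].
Proof. by rewrite inE. Qed.

Lemma K_pair a b : ([set a; b] \in bases K) = (Kcls a != Kcls b).
Proof.
rewrite K_base; apply/existsP/idP => [[c /existsP[d /andP[/eqP e cd]]]|ab]; last first.
  by exists a; apply/existsP; exists b; rewrite eqxx.
have : a \in [set c; d] by rewrite -e !inE eqxx.
have : b \in [set c; d] by rewrite -e !inE eqxx orbT.
have : c \in [set a; b] by rewrite e !inE eqxx.
have : d \in [set a; b] by rewrite e !inE eqxx orbT.
by move: cd; rewrite !inE => cd /orP[]/eqP hd /orP[]/eqP hc _ _; move: cd; rewrite hd hc ?eqxx // eq_sym.
Qed.

Lemma Kcls_lt (a : 'I_7) : Kcls a < 4.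
Proof. by have := ltn_ord a; rewrite /Kcls; case: ifP; lia. Qed.

Lemma Kcls3 (a : 'I_7) : Kcls a = 3 -> a = inord 3.
Proof.
move=> e; apply: val_inj; rewrite /= inordK //; move: e (ltn_ord a); rewrite /Kcls.
by case: ifP; lia.
Qed.

(** The octahedra are the transversals of the four parallel classes. Opposite choices in the three
    doubled classes give two that share only the element 3, so no basis lies in both. Deleting 3
    leaves no octahedron; deleting another [e] puts its partner [a] into all of them, as 3 is
    already, and the pair of [a] and 3 is free. *)
Lemma excl_core_K : excl_core K.
Proof.
have c2 (B : {set 'I_7}) : B \in bases K -> #|B| = 2.
  rewrite K_base => /existsP[a /existsP[b /andP[/eqP-> ab]]]; rewrite cards2.
  by case: (eqVneq a b) ab => [->|] //; rewrite eqxx.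
have oK C Q : oct K C Q -> [/\ C = set0, #|Q| = 4 & {in Q &, injective Kcls}].
  move=> o; have C0 := oct_rank2 c2 o; have [c _ b] := o; split=> //.
  move=> x y xQ yQ e; apply/eqP/negPn/negP=> xy; have := b x y xQ yQ xy.
  by rewrite C0 setU0 K_pair e eqxx.
have Q3 C Q : oct K C Q -> inord 3 \in Q /\ forall k, k < 4 -> exists2 a, a \in Q & Kcls a = k.
  move=> /oK[_ c inj]; pose h a : 'I_4 := Ordinal (Kcls_lt a).
  have ih : {in Q &, injective h} by move=> x y xQ yQ [e]; apply: inj.
  have eT : h @: Q = [set: 'I_4].
    by apply/eqP; rewrite eqEcard subsetT card_in_imset // c cardsT card_ord.
  have sur k : k < 4 -> exists2 a, a \in Q & Kcls a = k.
    move=> kl; have : Ordinal kl \in h @: Q by rewrite eT inE.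
    by case/imsetP=> a aQ [e]; exists a.
  split=> //; have [a aQ /Kcls3 <-] := sur 3 isT; exact: aQ.
have octK (Q : {set 'I_7}) : #|Q| = 4 -> {in Q &, injective Kcls} -> oct K set0 Q.
  move=> c inj; split=> //; first by rewrite disjoints_subset sub0set.
  by move=> x y xQ yQ xy; rewrite setU0 K_pair; apply: contraNneq xy => /inj ->.
split=> [r|e _].
  have o1 : oct K set0 [set i : 'I_7 | i < 4].
    apply: octK.
      rewrite -sum1_card; under eq_bigl do rewrite inE; by rewrite big_mkcond !big_ord_recl big_ord0.
    move=> x y; rewrite !inE => x4 y4 e; apply: val_inj; move: e; rewrite /Kcls /=.
    by rewrite leqNgt x4 leqNgt y4.
  have o2 : oct K set0 [set i : 'I_7 | 3 <= i].
    apply: octK.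
      rewrite -sum1_card; under eq_bigl do rewrite inE; by rewrite big_mkcond !big_ord_recl big_ord0.
    move=> x y; rewrite !inE => x4 y4 e; apply: val_inj; move: e x4 y4 (ltn_ord x) (ltn_ord y); rewrite /Kcls /=.
    by do 2 case: ifP; lia.
  have [|H [[bH _ _ _] val]] := r; first by exists set0, [set i : 'I_7 | i < 4]; apply: roct0.
  have sH : H \subset [set inord 3].
    apply/subsetP=> x xH; rewrite inE; apply/eqP/val_inj; rewrite /= inordK //.
    have /andP[_ /subsetP/(_ x xH)] := val _ _ (roct0 o1).
    have /andP[_ /subsetP/(_ x xH)] := val _ _ (roct0 o2).
    by rewrite !inE; lia.
  by have := subset_leq_card sH; rewrite cards1 (c2 H bH).
split; first exact: rR_con_rank2.
move=> [C [Q [o _ d]]]; have [Q3' sur] := Q3 _ _ o; have [c _ b] := o.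
have eQ : e \notin Q by apply/negP=> eQ; have := disjointFr d (set11 e); rewrite inE eQ orbT.
have e3 : e != inord 3 by apply: contraNneq eQ => ->.
have [a aQ ea] := sur (Kcls e) (Kcls_lt e).
have ae : a != e by apply: contraNneq eQ => <-.
have uniq3 (p : 'I_7) : Kcls p = Kcls e -> p != e -> p = a.
  move=> pe pne; apply: val_inj; move: pe ea pne ae; rewrite -!val_eqE /= /Kcls.
  by move: (ltn_ord p) (ltn_ord e) (ltn_ord a); clear; do 3 case: ifP; lia.
have a3 : Kcls a != 3.
  by rewrite ea; apply: contra e3 => /eqP/Kcls3 ->.
have K3 : Kcls (inord 3 : 'I_7) = 3 by rewrite /Kcls inordK.
have a3' : a != inord 3 by apply: contraNneq a3 => ->; rewrite K3.
exists [set a; inord 3]; split; first split.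
- by rewrite K_pair K3.
- exact: sub0set.
- by apply: disjointWr d; rewrite subUset !sub1set !inE aQ Q3' !orbT.
- move=> u p uH _ _ pH pE; move: uH pH pE; rewrite !in_set2 in_set1 negb_or => uH /andP[pa p3] pe.
  have -> : p |: [set a; inord 3] :\ u = [set p; if u == a then inord 3 else a].
    case/orP: uH => /eqP->; rewrite ?eqxx 1?(eq_sym (inord 3)) ?(negbTE a3'); set_eq.
  rewrite K_pair; case: ifP => _.
    by rewrite K3; apply: contra p3 => /eqP/Kcls3 ->.
  by rewrite ea; apply: contra pa => /eqP/uniq3 ->.
move=> C1 Q1 [o1 _ d1]; have [C0 _ _] := oK _ _ o1; have [q3 sur1] := Q3 _ _ o1.
rewrite C0 /inoct sub0set set0U subUset !sub1set q3 andbT /=.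
have [a' a'Q ea'] := sur1 (Kcls e) (Kcls_lt e); rewrite -(uniq3 a') //.
by apply: contraTneq a'Q => ->; apply/negP=> eQ1; have := disjointFr d1 (set11 e); rewrite inE eQ1 orbT.
Qed.

Definition R6line (b : bool) : {set 'I_6} := [set i : 'I_6 | (i < 3) == b].

Lemma card_R6line b : #|R6line b| = 3.
Proof.
rewrite -sum1_card; under eq_bigl do rewrite inE.
by rewrite big_mkcond !big_ord_recl big_ord0; case: b.
Qed.

Lemma R6_base (B : {set 'I_6}) : (B \in bases R6) = (#|B| == 3) && [forall b, ~~ (B \subset R6line b)].
Proof.
rewrite inE -andbA; case: eqP => //= c.
have e b : (B == R6line b) = (B \subset R6line b) by rewrite eqEcard c card_R6line leqnn andbT.
have -> : [set i : 'I_6 | i < 3] = R6line true by apply/setP=> i; rewrite !inE eqb_id.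
have -> : [set i : 'I_6 | 3 <= i] = R6line false by apply/setP=> i; rewrite !inE leqNgt eqbF_neg.
rewrite !e; apply/andP/forallP => [[h1 h2] []//|h]; by split; apply: h.
Qed.

Lemma R6_baseI (B : {set 'I_6}) x y : #|B| = 3 -> x \in B -> y \in B -> (x < 3) != (y < 3) -> B \in bases R6.
Proof.
move=> c xB yB xy; rewrite R6_base c /=; apply/forallP=> b; apply/negP=> /subsetP s.
by move: (s x xB) (s y yB); rewrite !inE => /eqP ex /eqP ey; rewrite ex ey eqxx in xy.
Qed.

Lemma card_del2 (e f : 'I_6) : e != f -> #|[set: 'I_6] :\ f :\ e| = 4.
Proof.
move=> ef; have := cardsD1 f [set: 'I_6]; rewrite cardsT card_ord inE add1n => -[].
by rewrite (cardsD1 e) !inE ef add1n => -[<-].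
Qed.

(** Contracting a point [f] makes the other two points of its line parallel, so [Q] has to omit one
    of them. *)
Lemma R6_octP C Q : oct R6 C Q ->
  exists f e : 'I_6, [/\ C = [set f], Q = [set: 'I_6] :\ f :\ e, e != f & (e < 3) = (f < 3)].
Proof.
move=> o; have [c dj b] := o.
have c3 (B : {set 'I_6}) : B \in bases R6 -> #|B| = 3 by rewrite R6_base => /andP[/eqP].
have [/esym/eqP/cards1P[f eC]] := oct_card o c3.
have fQ : f \notin Q by apply/negP=> /(oct_notin o); rewrite eC inE eqxx.
have [e] : exists2 e, e \in R6line (f < 3) & e \notin f |: Q.
  apply/subsetPn; apply/negP=> s.
  have : #|R6line (f < 3) :\ f| == 2.
    by have := cardsD1 f (R6line (f < 3)); rewrite card_R6line inE eqxx add1n => -[<-].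
  case/cards2P=> x [y [xy e]].
  have [] : x \in R6line (f < 3) :\ f /\ y \in R6line (f < 3) :\ f by rewrite e !inE !eqxx orbT.
  rewrite !in_setD1 => /andP[xf xL] /andP[yf yL].
  have xQ : x \in Q by have := subsetP s x xL; rewrite !inE (negbTE xf).
  have yQ : y \in Q by have := subsetP s y yL; rewrite !inE (negbTE yf).
  have := b x y xQ yQ xy; rewrite R6_base => /andP[_ /forallP/(_ (f < 3)) /negP[]].
  by rewrite eC !subUset !sub1set xL yL inE eqxx.
rewrite !inE => /eqP eL /norP[ef eQ]; exists f, e; split=> //.
by apply/eqP; rewrite eqEcard c card_del2 // !subsetD1 subsetT fQ eQ.
Qed.

Lemma R6_oct (f e : 'I_6) : e != f -> (e < 3) = (f < 3) -> oct R6 [set f] ([set: 'I_6] :\ f :\ e).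
Proof.
move=> ef eL; split.
- exact: card_del2.
- by rewrite disjoints1 !inE eqxx andbF.
move=> x y; rewrite !in_setD1 !in_setT !andbT => /andP[xe xf] /andP[ye yf] xy.
rewrite R6_base; have -> /= : #|x |: (y |: [set f])| == 3.
  by rewrite !cardsU1 !inE cards1 (negbTE xy) (negbTE xf) (negbTE yf).
apply/forallP=> b; rewrite !subUset !sub1set; apply/negP=> /and3P[xL yL fL].
have eb : e \in R6line b by move: fL; rewrite !inE eL.
have : #|x |: (y |: (e |: [set f]))| <= #|R6line b|.
  by apply: subset_leq_card; rewrite !subUset !sub1set xL yL fL eb.
by rewrite card_R6line !cardsU1 !inE cards1; atoms.
Qed.

Lemma R6_other (e : 'I_6) : exists x y : 'I_6, [/\ (x < 3) != (e < 3), (y < 3) != (e < 3) & x != y].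
Proof.
have /card_gt1P[x [y [+ + xy]]] : 1 < #|R6line (~~ (e < 3))| by rewrite card_R6line.
by rewrite !inE => /eqP ex /eqP ey; exists x, y; rewrite ex ey; split=> //; case: (e < 3).
Qed.

(** Of the points 0 and 1 on one line, an octahedron may contract 0 and omit 1, or contract 1 and
    omit 0; a common witness would have to contain 0 and to avoid it. *)
Lemma excl_core_R6 : excl_core R6.
Proof.
split=> [r|e _].
  have i0 : (inord 0 : 'I_6) = 0 :> nat by rewrite inordK.
  have i1 : (inord 1 : 'I_6) = 1 :> nat by rewrite inordK.
  have ne : (inord 0 : 'I_6) != inord 1 by rewrite -val_eqE /= i0 i1.
  have o1 : oct R6 [set inord 0] ([set: 'I_6] :\ inord 0 :\ inord 1).
    by apply: R6_oct; rewrite ?i0 ?i1 // eq_sym.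
  have o2 : oct R6 [set inord 1] ([set: 'I_6] :\ inord 1 :\ inord 0).
    by apply: R6_oct; rewrite ?i0 ?i1.
  have [|H [_ val]] := r; first by eexists; eexists; apply: roct0 o1.
  have /andP[s1 _] := val _ _ (roct0 o1); have /andP[_ s2] := val _ _ (roct0 o2).
  move: s1; rewrite sub1set => /(subsetP s2); rewrite !inE eqxx /= orbF.
  by rewrite (negbTE ne).
have [x [y [xe ye xy]]] := R6_other e.
have n2 (v : 'I_6) : (v < 3) != (e < 3) -> v != e by apply: contraNneq => ->.
have [xne yne] := (n2 x xe, n2 y ye).
have c3 : #|[set e; x; y]| = 3.
  by rewrite -setUA !cardsU1 cards1 !inE; atoms.
split=> [[C [Q [o s d]]]|].
  (* The contracted point with two points of the other line: after an exchange [e] and one of [x, y]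
     are still present, so the set is neither line. *)
  exists [set e; x; y]; split; first split.
  - by apply: (R6_baseI c3 (x := x) (y := e)); rewrite ?inE ?eqxx ?orbT.
  - by rewrite sub1set !inE eqxx.
  - by rewrite disjoints_subset sub0set.
  - move=> u p uH uC _ pH _; have ue : u != e by move: uC; rewrite inE.
    have [v vH [vu ve]] : exists2 v, v \in [set e; x; y] & v != u /\ (v < 3) != (e < 3).
      move: uH; rewrite !inE (negbTE ue) /= => /orP[] /eqP->; [exists y|exists x];
        by rewrite ?inE ?eqxx ?orbT //; split=> //; rewrite eq_sym.
    apply: (@R6_baseI _ v e) => //; first by rewrite card_swap.
      by rewrite in_setU1 in_setD1 vu vH orbT.
    by rewrite !inE; atoms.
  move=> C1 Q1 [o1 s1 _]; have [f [e' [eC eQ e'f e'L]]] := R6_octP o1.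
  have ef : e = f by move: s1; rewrite eC sub1set inE => /eqP.
  have n3 (v : 'I_6) : (v < 3) != (e < 3) -> v != e' by apply: contraNneq => ->; rewrite e'L ef.
  rewrite /inoct eC eQ -ef sub1set !subUset !sub1set !inE !eqxx /=.
  by rewrite xne yne (n3 x xe) (n3 y ye) !orbT.
move=> [C [Q [o s d]]]; have [f0 [e0 [eC0 eQ0 e0f0 e0L]]] := R6_octP o.
have eqe f1 e1 C1 Q1 : C1 = [set f1] -> Q1 = [set: 'I_6] :\ f1 :\ e1 -> [disjoint [set e] & C1 :|: Q1] -> e1 = e.
  move=> -> ->; rewrite disjoints1 !inE andbT; case: (eqVneq e f1) => //= _.
  by rewrite andbT negbK => /eqP.
have ee0 := eqe _ _ _ _ eC0 eQ0 d; rewrite ee0 in e0f0 e0L eQ0.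
have : #|R6line (e < 3) :\ e| == 2.
  by have := cardsD1 e (R6line (e < 3)); rewrite card_R6line inE eqxx add1n => -[<-].
case/cards2P=> a [b [ab eab]].
have [] : a \in R6line (e < 3) :\ e /\ b \in R6line (e < 3) :\ e by rewrite eab !inE !eqxx orbT.
rewrite !inE => /andP[ae /eqP aL] /andP[be /eqP bL].
have xa : x != a by apply: contraNneq xe => ->; rewrite aL.
have xb : x != b by apply: contraNneq xe => ->; rewrite bL.
have c3' : #|[set a; b; x]| = 3 by rewrite -setUA !cardsU1 cards1 !inE; atoms.
(* The two points left on the line of [e], with one point of the other line. Any point that may
   enter lies on the other line, and [a] or [b] always stays. *)
exists [set a; b; x]; split; first split.
- by apply: (R6_baseI c3' (x := x) (y := a)); rewrite ?inE ?eqxx ?orbT // aL.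
- exact: sub0set.
- by rewrite disjoints1 !inE; atoms.
- move=> u p uH _ _ pH; rewrite inE => pe.
  have pL : (p < 3) != (e < 3).
    apply/negP=> /eqP pL; have : p \in R6line (e < 3) :\ e by rewrite !inE pe pL eqxx.
    by rewrite eab; move: pH; rewrite !inE !negb_or -!andbA => /and3P[/negbTE-> /negbTE->].
  have [v vH [vu vL]] : exists2 v, v \in [set a; b; x] & v != u /\ (v < 3) = (e < 3).
    have [ua|ua] := eqVneq u a; first by exists b; rewrite ?inE ?eqxx ?orbT // ua eq_sym.
    by exists a; rewrite ?inE ?eqxx // eq_sym.
  apply: (@R6_baseI _ p v); rewrite ?card_swap ?vL //; first by rewrite in_setU1 eqxx.
  by rewrite in_setU1 in_setD1 vu vH orbT.
move=> C1 Q1 [o1 _ d1]; have [f [e' [eC eQ e'f e'L]]] := R6_octP o1.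
have ee' := eqe _ _ _ _ eC eQ d1; rewrite ee' in e'f e'L eQ.
have fab : f \in [set a; b] by rewrite -eab !inE (eq_sym f) e'f e'L eqxx.
rewrite /inoct eC eQ sub1set; apply/andP; split; first by move: fab; rewrite !inE => ->.
by apply/subsetP=> w; rewrite !inE => wH; case: (w == f) => //=; move: wH => /orP[/orP[]|] /eqP->; rewrite ?ae ?be ?xne.
Qed.

End Concrete.

(** * Isomorphism and the small matroids under duality *)

Section DualIso.

Lemma iso_dual (T T' : finType) (M : matroid T) (N : matroid T') :
  (forall B, B \in bases M -> B \subset ground M) -> (forall B, B \in bases N -> B \subset ground N) ->
  iso M N -> iso (dual M) (dual N).
Proof.
move=> sM sN [f [inj eE e]].
have imD (X : {set T}) : X \subset ground M -> f @: (ground M :\: X) = ground N :\: f @: X.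
  move=> sX; apply/setP=> y; rewrite inE -eE; apply/imsetP/andP.
    case=> x; rewrite inE => /andP[xX xM] ->; rewrite (imset_f f xM); split=> //.
    apply: contra xX => /imsetP[z zX ez]; by rewrite (inj x z _ _ ez) // (subsetP sX).
  case=> yX /imsetP[x xM ey]; exists x => //; rewrite inE xM andbT.
  by apply: contra yX => xX; rewrite ey imset_f.
exists f; split=> // X sX; apply/imsetP/imsetP => -[B b eX].
  by exists (f @: B); rewrite -?e ?sM // eX imD // sM.
exists (ground M :\: X); last by rewrite setDDK.
have sB := sN B b; rewrite e ?subsetDl // imD // eX setDDK //.
Qed.

Lemma dualK_sub (T : finType) (N : matroid T) : (forall B, B \in bases N -> B \subset ground N) -> dual (dual N) = N.
Proof.
case: N => E Bs /= s; congr Matroid; apply/setP=> X; apply/imsetP/idP => [[Y /imsetP[Z b ->] ->]|b].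
  by rewrite /= setDDK ?s.
by exists (E :\: X); [apply/imsetP; exists X | rewrite /= setDDK ?s].
Qed.

Lemma K_sub (B : {set 'I_7}) : B \in bases K -> B \subset ground K.
Proof. by move=> _; apply: subsetT. Qed.

Lemma dual_U25 : dual (U 2 5) = U 3 5.
Proof.
congr Matroid; apply/setP=> X; rewrite inE; apply/imsetP/eqP => [[B + ->]|c].
  by rewrite inE => /eqP c; rewrite cardsD setIC setIT cardsT card_ord c.
exists (~: X); last by rewrite setTD setCK.
by rewrite inE cardsCs setCK card_ord c.
Qed.

Lemma dsum_sub k (B : {set 'I_4 + 'I_1}) : B \in bases (dsum (U 2 4) (U k 1)) -> B \subset ground (dsum (U 2 4) (U k 1)).
Proof.
move=> _; apply/subsetP=> -[i|i] _; rewrite inE; [apply/orP; left|apply/orP; right]; apply: imset_f; exact: in_setT.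
Qed.

Lemma dual_dsum : dual (dsum (U 2 4) (U 0 1)) = dsum (U 2 4) (U 1 1).
Proof.
have eT k : ground (dsum (U 2 4) (U k 1)) = [set: 'I_4 + 'I_1].
  by apply/setP=> -[i|i]; rewrite !inE; [apply/orP; left|apply/orP; right]; apply: imset_f; rewrite in_setT.
have C4 (B : {set 'I_4}) : #|B| = 2 -> #|~: B| = 2 by move=> c; rewrite cardsCs setCK card_ord c.
have in_inl (B : {set 'I_4}) (S : {set 'I_1}) i : (inl i \in (inl @: B :|: inr @: S : {set 'I_4 + 'I_1})) = (i \in B).
  rewrite inE; apply/orP/idP => [[/imsetP[j jB [->]]|/imsetP[j _]]|iB] //.
  by left; apply: imset_f.
have in_inr (B : {set 'I_4}) (S : {set 'I_1}) i : (inr i \in (inl @: B :|: inr @: S : {set 'I_4 + 'I_1})) = (i \in S).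
  rewrite inE; apply/orP/idP => [[/imsetP[j _]|/imsetP[j jB [->]]]|iB] //.
  by right; apply: imset_f.
have C (B : {set 'I_4}) (S : {set 'I_1}) :
  [set: 'I_4 + 'I_1] :\: (inl @: B :|: inr @: S) = inl @: (~: B) :|: inr @: (~: S).
  by apply/setP=> -[i|i]; rewrite in_setD in_setT andbT ?in_inl ?in_inr in_setC.
congr Matroid; apply/setP=> X; apply/imsetP/imset2P => [[_ /imset2P[B S + + ->] ->]|[B S + + ->]].
  rewrite !inE => /eqP cB; rewrite cards_eq0 => /eqP ->; rewrite eT C.
  by exists (~: B) (~: set0); rewrite ?inE ?C4 // setC0 cardsT card_ord.
rewrite !inE => /eqP cB /eqP cS; exists (inl @: (~: B) :|: inr @: (~: S)); last by rewrite eT C !setCK.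
by apply/imset2P; exists (~: B) (~: S); rewrite ?inE ?C4 // cardsCs setCK card_ord cS.
Qed.

End DualIso.

(** * Recognising the small matroids inside an excluded minor *)

Section Configurations.
Variables (T : finType) (M : matroid T).
Implicit Types (B C D E H P Q X : {set T}).

Lemma emb_seq n (N : matroid 'I_n) x0 (s : seq T) C : ground N = setT -> uniq s -> size s = n ->
  (forall x, x \in s -> (x \in ground M) && (x \notin C)) ->
  (forall X : {set 'I_n}, (X \in bases N) = ((fun i : 'I_n => nth x0 s i) @: X :|: C \in bases M)) ->
  emb M N (fun i : 'I_n => nth x0 s i) C.
Proof.
move=> eN us ss sE e; have ms (i : 'I_n) : nth x0 s i \in s by rewrite mem_nth ?ss.
split=> //.
- by move=> i j _ _ /eqP; rewrite nth_uniq ?ss // => /eqP/val_inj.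
- by apply/subsetP=> _ /imsetP[i _ ->]; have /andP[] := sE _ (ms i).
- rewrite disjoint_sym; apply: disjointP => _ /imsetP[i _ ->].
  by have /andP[] := sE _ (ms i).
Qed.

Lemma pairs_card2 n (g : 'I_n -> T) (X : {set 'I_n}) C : injective g -> (forall i, g i \notin C) ->
  #|g @: X :|: C| = #|X| + #|C|.
Proof.
move=> ig gC; have := (leq_card_setU (g @: X) C).2; rewrite card_imset //.
have -> : [disjoint g @: X & C] by apply: disjointP => _ /imsetP[i _ ->].
by move/eqP.
Qed.

Lemma add_cancel2 a c : a + c = c.+2 -> a == 2.
Proof. lia. Qed.

Lemma two_base C x y B : is_matroid M -> x \notin C -> y \notin C -> x != y -> x |: (y |: C) \in bases M ->
  B \in bases M -> #|B| = #|C|.+2.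
Proof.
move=> mM xC yC xy b bB; rewrite (card_bases mM bB b).
by rewrite !cardsU1 !inE (negbTE xy) (negbTE xC) yC.
Qed.

Lemma U25_config C P : excl M -> #|P| = 5 -> [disjoint C & P] ->
  (forall x y, x \in P -> y \in P -> x != y -> x |: (y |: C) \in bases M) -> iso M (U 2 5).
Proof.
move=> exM cP dj b; have [mM _ _] := exM.
have [x0 [y0 [x0P y0P xy0]]] : exists x y, [/\ x \in P, y \in P & x != y] by apply/card_gt1P; rewrite cP.
have nC z : z \in P -> z \notin C by move=> zP; rewrite (disjointFl dj zP).
pose s := enum P; have us : uniq s := enum_uniq _; have ss : size s = 5 by rewrite -cardE.
have gP (i : 'I_5) : nth x0 s i \in P by rewrite -mem_enum mem_nth ?ss.
have ig : injective (fun i : 'I_5 => nth x0 s i).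
  by move=> i j /eqP; rewrite nth_uniq ?ss // => /eqP/val_inj.
have sE z : z \in P -> z \in ground M.
  move=> zP; have [w [wP wz]] : exists w, w \in P /\ z != w.
    by have [->|zx] := eqVneq z x0; [exists y0 | exists x0].
  by apply: (base_in mM (b z w zP wP wz)); rewrite !inE eqxx.
have em : emb M (U 2 5) (fun i : 'I_5 => nth x0 s i) C.
  apply: emb_seq => // [z|X]; first by rewrite mem_enum => zP; rewrite sE // nC.
  rewrite U25_base; apply/idP/idP => [/cards2P[i [j [ij ->]]]|h].
    by rewrite imsetU1 imset_set1 -setUA b // (inj_eq ig).
  have := two_base mM (nC _ x0P) (nC _ y0P) xy0 (b _ _ x0P y0P xy0) h.
  by rewrite pairs_card2 // => [|i]; [move/add_cancel2 | apply: nC].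
apply: (@excl_minor_iso _ _ M (U 2 5) _ C ord0) em _ excl_core_U25.1; rewrite ?inE //.
  by move=> B _; apply: subsetT.
by apply: subset_trans (base_sub mM (b _ _ x0P y0P xy0)); rewrite setUA subsetUr.
Qed.

(** The hypothesis on bases says that [e] is a loop of [M / C], so this contraction has the required
    sum on [Q] and [e]. *)
Lemma loop_config C Q e : excl M -> oct M C Q -> e \in ground M -> e \notin C -> e \notin Q ->
  (forall B, B \in bases M -> C \subset B -> e \notin B) -> iso M (dsum (U 2 4) (U 0 1)).
Proof.
move=> exM o eE eC eQ nb; have [mM _ _] := exM; have [c _ b] := o.
have [x0 [y0 [x0P y0P xy0]]] := card4_2 c.
have nC z : z \in Q -> z \notin C := @oct_notin _ _ _ _ z o.
pose s := enum Q; have us : uniq s := enum_uniq _; have ss : size s = 4 by rewrite -cardE.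
pose g (i : 'I_4 + 'I_1) := match i with inl i => nth x0 s i | inr _ => e end.
have gQ (i : 'I_4) : nth x0 s i \in Q by rewrite -mem_enum mem_nth ?ss.
have ig : injective g.
  move=> [i|i] [j|j] //=.
  - by move/eqP; rewrite nth_uniq ?ss // => /eqP/val_inj->.
  - by move=> h; move: eQ; rewrite -h gQ.
  - by move=> h; move: eQ; rewrite h gQ.
  - by rewrite !ord1.
have gC i : g i \notin C by case: i => i //=; apply: nC.
have gE i : g i \in ground M.
  by case: i => i //=; apply: (subsetP (oct_sub mM o)); rewrite inE gQ orbT.
have cX (X : {set 'I_4 + 'I_1}) : #|g @: X :|: C| = #|X| + #|C|.
  have := (leq_card_setU (g @: X) C).2; rewrite card_imset //.
  have -> : [disjoint g @: X & C] by apply: disjointP => _ /imsetP[i _ ->].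
  by move/eqP.
have em : emb M (dsum (U 2 4) (U 0 1)) g C.
  split.
  - by move=> i j _ _; apply: ig.
  - by apply/subsetP=> _ /imsetP[i _ ->].
  - by rewrite disjoint_sym; apply: disjointP => _ /imsetP[i _ ->].
  move=> X _; rewrite dsum_base; apply/andP/idP => [[nX /cards2P[i [j [ij eX]]]]|h].
    rewrite eX imsetU1 imset_set1 -setUA.
    have inl_of k : k \in X -> exists k', k = inl k'.
      by case: k => [k _|k kX]; [exists k | case/negP: nX; move: kX; rewrite (ord1 k)].
    have [|i' ei] := inl_of i; first by rewrite eX !inE eqxx.
    have [|j' ej] := inl_of j; first by rewrite eX !inE eqxx orbT.
    by rewrite ei ej /= b ?gQ // -/(g (inl i')) -/(g (inl j')) (inj_eq ig) -ei -ej.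
  split; last first.
    have := two_base mM (nC _ x0P) (nC _ y0P) xy0 (b _ _ x0P y0P xy0) h.
    by rewrite cX => /add_cancel2.
  apply/negP=> eX; have := nb _ h (subsetUr _ _); rewrite inE.
  by rewrite (imset_f g eX).
apply: (@excl_minor_iso _ _ M (dsum (U 2 4) (U 0 1)) _ C (inl ord0)) em _ excl_core_dsum.1 => //.
- by rewrite inE; apply/orP; left; apply: imset_f; rewrite inE.
- exact: dsum_sub.
by apply: subset_trans (oct_sub mM o); apply: subsetUl.
Qed.

Lemma K_config C x0 (s : seq T) : excl M -> uniq s -> size s = 7 -> (forall z, z \in s -> z \notin C) ->
  (forall i j : 'I_7, i != j -> (nth x0 s i |: (nth x0 s j |: C) \in bases M) = (Kcls i != Kcls j)) -> iso M K.
Proof.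
move=> exM us ss nC b; have [mM _ _] := exM.
pose g (i : 'I_7) := nth x0 s i.
have gs (i : 'I_7) : g i \in s by rewrite mem_nth ?ss.
have ig : injective g by move=> i j /eqP; rewrite nth_uniq ?ss // => /eqP/val_inj.
have K3 : Kcls (inord 3 : 'I_7) = 3 by rewrite /Kcls inordK.
have K0 : Kcls (inord 0 : 'I_7) = 0 by rewrite /Kcls inordK.
have K1 : Kcls (inord 1 : 'I_7) = 1 by rewrite /Kcls inordK.
have b01 : g (inord 0) |: (g (inord 1) |: C) \in bases M.
  by rewrite b ?K0 ?K1 // -val_eqE /= !inordK.
have gE (i : 'I_7) : g i \in ground M.
  have [j Kij] : exists j : 'I_7, Kcls i != Kcls j.
    by have [e|ne] := eqVneq (Kcls i) 0; [exists (inord 1) | exists (inord 0)]; rewrite ?K1 ?K0 ?e.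
  have ij : i != j by apply: contraNneq Kij => ->.
  have : g i |: (g j |: C) \in bases M by rewrite b.
  by move/(base_in mM); apply; rewrite !inE eqxx.
have em : emb M K g C.
  apply: emb_seq => // [z /(nthP x0)[k + <-]|X].
    rewrite ss => k7; have := gE (Ordinal k7); rewrite /g /= => ->; apply: nC.
    by rewrite mem_nth ?ss.
  apply/idP/idP => [|h].
    rewrite K_base => /existsP[i /existsP[j /andP[/eqP-> Kij]]].
    have ij : i != j by apply: contraNneq Kij => ->.
    by rewrite imsetU1 imset_set1 -setUA b.
  have : #|X| == 2.
    have g01 : g (inord 0) != g (inord 1) by rewrite (inj_eq ig) -val_eqE /= !inordK.
    have := two_base mM (nC _ (gs _)) (nC _ (gs _)) g01 b01 h.
    by rewrite (pairs_card2 X ig) => [|i]; [move/add_cancel2 | apply: nC].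
  case/cards2P=> i [j [ij eX]]; move: h; rewrite eX imsetU1 imset_set1 -setUA b // => Kij.
  by rewrite K_pair.
have sC : C \subset ground M by apply: subset_trans (base_sub mM b01); rewrite setUA subsetUr.
have oK : (ord0 : 'I_7) \in ground K by apply: in_setT.
exact: excl_minor_iso oK exM K_sub em sC excl_core_K.1.
Qed.

Lemma R6_config (C L1 L2 : {set T}) : excl M -> #|L1| = 3 -> #|L2| = 3 -> [disjoint L1 & L2] ->
  [disjoint C & L1 :|: L2] -> L1 :|: C \notin bases M -> L2 :|: C \notin bases M ->
  (forall x y z, x \in L1 -> y \in L1 -> x != y -> z \in L2 -> x |: (y |: (z |: C)) \in bases M) ->
  (forall x y z, x \in L1 -> y \in L2 -> z \in L2 -> y != z -> x |: (y |: (z |: C)) \in bases M) ->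
  iso M R6.
Proof.
move=> exM c1 c2 d12 dC n1 n2 b1 b2; have [mM _ _] := exM.
have [x1 [y1 [x1L y1L xy1]]] : exists x y, [/\ x \in L1, y \in L1 & x != y] by apply/card_gt1P; rewrite c1.
have [x2 [y2 [x2L y2L xy2]]] : exists x y, [/\ x \in L2, y \in L2 & x != y] by apply/card_gt1P; rewrite c2.
pose s := enum L1 ++ enum L2.
have ss : size s = 6 by rewrite size_cat -!cardE c1 c2.
have us : uniq s.
  rewrite cat_uniq !enum_uniq /= andbT; apply/hasPn=> z; rewrite !mem_enum => z2.
  by rewrite (disjointFl d12 z2).
pose g (i : 'I_6) := nth x1 s i.
have g1 (i : 'I_6) : i < 3 -> g i \in L1.
  by move=> i3; rewrite /g nth_cat -cardE c1 i3 -mem_enum mem_nth // -cardE c1.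
have g2 (i : 'I_6) : ~~ (i < 3) -> g i \in L2.
  move=> i3; rewrite /g nth_cat -cardE c1 (negbTE i3) -mem_enum mem_nth // -cardE c2.
  by move: (ltn_ord i) i3; clear; lia.
have g12 i : g i \in L1 :|: L2.
  by rewrite inE; case: (boolP (i < 3)) => [/g1->|/g2->]; rewrite ?orbT.
have ig : injective g by move=> i j /eqP; rewrite nth_uniq ?ss // => /eqP/val_inj.
have gC i : g i \notin C by rewrite (disjointFl dC (g12 i)).
have sE z : z \in L1 :|: L2 -> z \in ground M.
  rewrite inE => /orP[zL|zL].
    by apply: (base_in mM (b2 z x2 y2 zL x2L y2L xy2)); rewrite !inE eqxx.
  by apply: (base_in mM (b1 x1 y1 z x1L y1L xy1 zL)); rewrite !inE eqxx !orbT.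
have cB B : B \in bases M -> #|B| = #|C| + 3.
  move=> b; rewrite (card_bases mM b (b1 x1 y1 x2 x1L y1L xy1 x2L)).
  have nC z : z \in L1 :|: L2 -> z \notin C by move=> zL; rewrite (disjointFl dC zL).
  have ne z w : z \in L1 -> w \in L2 -> z != w by move=> zL; apply: contraTneq => <-; rewrite (disjointFr d12 zL).
  by rewrite !cardsU1 !inE (negbTE xy1) !(negbTE (ne _ _ _ x2L)) // !(negbTE (nC _ _)) ?inE ?x1L ?y1L ?x2L ?orbT //=; clear; lia.
have em : emb M R6 g C.
  apply: emb_seq => // [z|X].
    rewrite mem_cat !mem_enum => zL; rewrite sE ?inE //= (disjointFl dC) // inE; exact: zL.
  apply/idP/idP => [|h].
    rewrite R6_base => /andP[/eqP cX /forallP nX].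
    have /subsetPn[i iX] := nX false; rewrite inE eqbF_neg negbK => i3.
    have /subsetPn[j jX] := nX true; rewrite inE eqb_id => j3.
    have ij : i != j by apply: contraNneq j3 => <-.
    have : #|X :\ i :\ j| == 1 by have := cardsD2 iX jX ij; rewrite cX => -[<-].
    case/cards1P=> k eX; have : k \in X :\ i :\ j by rewrite eX inE.
    rewrite !inE => /and3P[kj ki kX].
    have -> : X = [set i; j; k].
      apply/eqP; rewrite eq_sym eqEcard cX !subUset !sub1set iX jX kX -setUA !cardsU1 cards1 !inE; atoms => //.
    rewrite -!setUA !imsetU1 imset_set1 -!setUA; case: (boolP (k < 3)) => k3.
      rewrite [g j |: _]setUCA; apply: b1; rewrite ?g1 ?g2 // (inj_eq ig) eq_sym //.
    by apply: b2; rewrite ?g1 ?g2 // (inj_eq ig) eq_sym.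
  have cX : #|X| = 3 by have := cB _ h; rewrite (pairs_card2 X ig gC) addnC => /addnI.
  rewrite R6_base cX eqxx /=; apply/forallP=> b; apply/negP=> sX.
  have sub (L : {set T}) : #|L| = 3 -> (forall i, i \in X -> g i \in L) -> g @: X = L.
    move=> cL hL; apply/eqP; rewrite eqEcard cL card_imset // cX leqnn andbT.
    by apply/subsetP=> _ /imsetP[i iX ->]; apply: hL.
  case: b sX => /subsetP sX.
    move: n1; rewrite -(sub L1) ?h // => i /sX; rewrite inE eqb_id; exact: g1.
  move: n2; rewrite -(sub L2) ?h // => i /sX; rewrite inE eqbF_neg; exact: g2.
have sC : C \subset ground M.
  by apply: subset_trans (base_sub mM (b1 _ _ _ x1L y1L xy1 x2L)); rewrite !setUA subsetUr.
have oK : (ord0 : 'I_6) \in ground R6 by apply: in_setT.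
have sR (B : {set 'I_6}) : B \in bases R6 -> B \subset ground R6 by move=> _; apply: subsetT.
exact: excl_minor_iso oK exM sR em sC excl_core_R6.1.
Qed.

End Configurations.

(** * Loops, parallel pairs, and rank two *)

Section Reduction.
Variables (T : finType) (M : matroid T).
Hypothesis exM : excl M.
Implicit Types (B C D E H P Q X : {set T}).

Let mM : is_matroid M. Proof. by case: exM. Qed.
Let nR : ~ rR M set0 set0. Proof. by case: exM. Qed.

Lemma excl_oct : exists C Q, oct M C Q.
Proof.
have [/existsP[C /existsP[Q /octP o]]|no] := boolP [exists C : {set T}, [exists Q : {set T}, octb M C Q]].
  by exists C, Q.
case: nR => -[C [Q [/octP o _ _]]]; case/negP: no.
by apply/existsP; exists C; apply/existsP; exists Q.
Qed.

Lemma excl_del e : e \in ground M -> rR M set0 [set e].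
Proof. by case: exM => _ _ ex /ex[]. Qed.

Lemma excl_con e : e \in ground M -> rR M [set e] set0.
Proof. by case: exM => _ _ ex /ex[]. Qed.

Lemma roct_del e C Q : oct M C Q -> e \notin C -> e \notin Q -> roct M set0 [set e] C Q.
Proof. by move=> o eC eQ; split; rewrite ?sub0set // disjoints1 inE negb_or eC. Qed.

Lemma roct_con e C Q : oct M C Q -> e \in C -> roct M [set e] set0 C Q.
Proof. by move=> o eC; split; rewrite ?sub1set // disjoints_subset sub0set. Qed.

Lemma excl_loop e : e \in ground M -> (forall B, B \in bases M -> e \notin B) -> iso M (dsum (U 2 4) (U 0 1)).
Proof.
move=> eE lp; have [C [Q o]] := excl_oct; have [c _ b] := o.
have [x [y [xQ yQ xy]]] := card4_2 c.
apply: (loop_config exM o eE) => [||B bB _]; last exact: lp.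
  by have := lp _ (b x y xQ yQ xy); rewrite !inE !negb_or => /and3P[].
apply/negP=> eQ; have [z [zQ ez]] : exists z, z \in Q /\ e != z.
  by have [->|ne] := eqVneq e x; [exists y | exists x].
by have := lp _ (b e z eQ zQ ez); rewrite !inE eqxx.
Qed.

Definition loopless : Prop := forall e, e \in ground M -> exists2 B, B \in bases M & e \in B.

Lemma parallel_swap e e' B : loopless -> e' \in ground M ->
  (forall B, B \in bases M -> ~~ ((e \in B) && (e' \in B))) ->
  B \in bases M -> e \in B -> e' |: (B :\ e) \in bases M.
Proof.
move=> ll e'E pl b eB; have [B' b' e'B'] := ll e' e'E.
have e'B : e' \notin B by have := pl B b; rewrite eB.
have [y [yB _ b2]] := extend1 mM b b' e'B' e'B.
have ee' : e != e' by apply: contraNneq e'B => <-.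
suff <- : y = e by [].
apply/eqP; have := pl _ b2; rewrite !inE eqxx andbT (negbTE ee') eB andbT /=.
by rewrite negbK eq_sym.
Qed.

(** A basis [H] witnessing [M \ e] must contain [e'], since otherwise [e] could be put back beside
    its twin without harm. Every octahedron at [H] in [M \ e] then exchanges [e'], which forces a
    twin for each of two columns. Over [H :\ e' :\ x] the three parallel pairs and [x] form [K]. *)
Lemma excl_parallel e e' : loopless -> e \in ground M -> e' \in ground M -> e != e' ->
  (forall B, B \in bases M -> ~~ ((e \in B) && (e' \in B))) -> iso M K.
Proof.
move=> ll eE e'E ee' pl.
have sw B : B \in bases M -> e \in B -> e' |: (B :\ e) \in bases M by apply: parallel_swap.
have sw' B : B \in bases M -> e' \in B -> e |: (B :\ e') \in bases M.
  by apply: parallel_swap => // B1 /pl; rewrite andbC.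
have n1 B : B \in bases M -> e \in B -> e' \notin B by move=> /pl + eB; rewrite eB.
have n2 B : B \in bases M -> e' \in B -> e \notin B by move=> /pl + eB; rewrite eB andbT.
have e'e : e' != e by rewrite eq_sym.
(* Replacing [e] by its parallel [e'] turns octahedra into octahedra. *)
have so C Q : oct M C Q -> (e \in C -> oct M (e' |: C :\ e) Q /\ e' \notin Q) /\
    (e \in Q -> oct M C (e' |: Q :\ e) /\ e' \notin C).
  move=> o; have [c dj b] := o; have [x [y [xQ yQ xy]]] := card4_2 c; split=> [eC|eQ].
    have oth z : z \in Q -> z != e'.
      move=> zQ; have [w [wQ zw]] : exists w, w \in Q /\ z != w.
        by have [->|zx] := eqVneq z x; [exists y | exists x].
      apply: contraTneq (b z w zQ wQ zw) => ->; apply/negP=> bb.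
      by have := n1 _ bb; rewrite !inE eC !orbT eqxx => /(_ isT).
    have e'Q : e' \notin Q by apply/negP=> /oth; rewrite eqxx.
    split=> //; split=> //.
      apply: disjointP => z; rewrite !inE => /orP[/eqP->//|/andP[_ zC]].
      by rewrite (disjointFr dj zC).
    move=> z w zQ wQ zw; have := sw _ (b z w zQ wQ zw); rewrite !inE eC !orbT => /(_ isT).
    have [ze we] : z != e /\ w != e.
      by split; [have := oct_notin o zQ|have := oct_notin o wQ]; apply: contraNneq => ->.
    have -> : e' |: (z |: (w |: C)) :\ e = z |: (w |: (e' |: C :\ e)) by set_eq.
    by [].
  have [w [wQ ew]] : exists w, w \in Q /\ e != w.
    by have [->|zx] := eqVneq e x; [exists y | exists x].
  have := n1 _ (b e w eQ wQ ew); rewrite !inE eqxx /= => /(_ isT); rewrite !negb_or => /and3P[_ _ e'C].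
  have e'Q : e' \notin Q.
    by apply/negP=> e'Q; have := n1 _ (b e e' eQ e'Q ee'); rewrite !inE !eqxx orbT => /(_ isT).
  have eC := oct_notin o eQ.
  have be z : z \in Q -> z != e -> e' |: (z |: C) \in bases M.
    move=> zQ ze; have := sw _ (b e z eQ zQ _); rewrite eq_sym => /(_ ze); rewrite !inE eqxx => /(_ isT).
    suff -> : e' |: (e |: (z |: C)) :\ e = e' |: (z |: C) by [].
    by rewrite setU1K // !inE negb_or eq_sym ze.
  split=> //; split=> [||z v].
  - by rewrite card_swap.
  - apply: disjointP => z zC; rewrite !inE negb_or (disjointFr dj zC) andbF andbT.
    by apply: contraNneq e'C => <-.
  rewrite !inE => /orP[/eqP->|/andP[ze zQ]] /orP[/eqP->|/andP[ve vQ]] zv.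
  - by rewrite eqxx in zv.
  - exact: be.
  - by rewrite setUCA; apply: be.
  - exact: b.
have [C [Q o]] := excl_oct.
have [C1 [Q1 [o1 [eC1 eQ1]]]] : exists C Q, oct M C Q /\ e \notin C /\ e \notin Q.
  have [so1 so2] := so _ _ o.
  have [eC|eC] := boolP (e \in C).
    have [o1 _] := so1 eC; exists (e' |: C :\ e), Q; split=> //.
    rewrite !inE negb_or ee' eqxx /=; split=> //; apply/negP=> /(oct_notin o); by rewrite eC.
  have [eQ|eQ] := boolP (e \in Q); last by exists C, Q.
  have [o1 _] := so2 eQ; exists C, (e' |: Q :\ e); split=> //.
  by rewrite !inE negb_or ee' eqxx.
have [|H [fH val]] := excl_del eE; first by exists C1, Q1; apply: roct_del.
have [bH _ eH ex] := fH; rewrite disjoints1 in eH.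
have inH C2 Q2 : oct M C2 Q2 -> e \notin C2 -> e \notin Q2 -> inoct H C2 Q2.
  by move=> o2 eC2 eQ2; apply: val; apply: roct_del.
(* If [H1] missed [e'], its exchanges with [e] would follow from those with [e'], and octahedra
   through [e] would be controlled by their mirror images, so [H1] would be a witness for [M]
   itself. *)
have frH H1 : rvalid M set0 [set e] H1 -> e' \in H1.
  move=> [[bH1 _ eH1 ex1] val1]; apply: contraT => e'H1; rewrite disjoints1 in eH1; case: nR => _; exists H1.
  split; first split; rewrite ?sub0set ?disjoints_subset ?sub0set //.
    move=> u p uH uC pE pH _; have [pe|pe] := eqVneq p e; last by apply: ex1; rewrite // inE.
    have := sw' _ (ex1 u e' uH uC e'E e'H1 _); rewrite inE e'e !inE eqxx => /(_ isT isT).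
    by rewrite setU1K ?pe // !inE (negbTE e'H1) andbF.
  move=> C2 Q2 [o2 _ _]; have [so1 so2] := so _ _ o2.
  have [eC|eC] := boolP (e \in C2).
    have [o3 e'Q] := so1 eC; have eQ : e \notin Q2 by apply/negP=> /(oct_notin o2); rewrite eC.
    have /andP[/subsetP s _] : inoct H1 (e' |: C2 :\ e) Q2.
      by apply/val1/roct_del => //; rewrite !inE negb_or ee' eqxx.
    by case/negP: e'H1; apply: s; rewrite !inE eqxx.
  have [eQ|eQ] := boolP (e \in Q2); last by apply/val1/roct_del.
  have [o3 e'C] := so2 eQ.
  have /andP[s1 s2] : inoct H1 C2 (e' |: Q2 :\ e).
    by apply/val1/roct_del => //; rewrite !inE negb_or ee' eqxx.
  rewrite /inoct s1; apply/subsetP=> z zH; have := subsetP s2 z zH; rewrite !inE.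
  by atoms; case: (z \in C2) => //= /andP[].
have e'H := frH H (conj fH val).
(* Contracting [e'] turns [e] into a loop. *)
have noe C2 Q2 : oct M C2 Q2 -> e' \notin C2.
  move=> o2; apply/negP=> e'C.
  have [|H1 [[bH1 e'H1 _ ex1] val1]] := excl_con e'E; first by exists C2, Q2; apply: roct_con.
  rewrite sub1set in e'H1; have eH1 := n2 _ bH1 e'H1.
  have /andP[CH1 H1Q] := val1 _ _ (roct_con o2 e'C).
  have [u [v [p [q [[uH vH uv] _ eC _ _]]]]] := at_oct mM o2 bH1 (val1 _ _ (roct_con o2 e'C)).
  have ue' : u != e' by apply: contraTneq e'C => <-; rewrite eC !inE eqxx andbF.
  have := ex1 u e uH _ eE eH1 _; rewrite !inE ue' => /(_ isT isT) bb.
  by have := n1 _ bb; rewrite !inE; atoms => /(_ isT).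
have rfE C0 u : u \in H -> u \in H :\: set0 by move=> uH; rewrite !inE uH.
have rfE' p : p \in ground M -> p \notin H -> p != e -> p \in ground M :\: (H :|: [set e]).
  by move=> pE pH pe; rewrite !inE negb_or pH pe pE.
(* By [noe] the contracted part of an octahedron at [H] misses [e'], so [e'] is one of the two
   exchanged rows. *)
have oat u v p q : u \in H -> v \in H -> u != v -> p \in ground M -> q \in ground M ->
   p \notin H -> q \notin H -> p != e -> q != e -> p != q -> dx M H u v p q -> (u == e') || (v == e').
  move=> uH vH uv pE qE pH qH pe qe pq d; apply: contraT; rewrite negb_or => /andP[ue ve].
  have [o2 _ _] := oct_at mM fH (rfE set0 u uH) (rfE set0 v vH) uv (rfE' p pE pH pe) (rfE' q qE qH qe) pq d.
  by have := noe _ _ o2; rewrite !inE; atoms.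
have exH u p : u \in H -> p \in ground M -> p \notin H -> p != e -> p |: (H :\ u) \in bases M.
  by move=> uH pE pH pe; apply: ex; rewrite ?inE.
have [x [c [d [[xH xe'] [cE cH ce] [dE dH de] cd dcd]]]] : exists x c d,
    [/\ x \in H /\ x != e', [/\ c \in ground M, c \notin H & c != e],
        [/\ d \in ground M, d \notin H & d != e], c != d & dx M H e' x c d].
  have [u [v [p [q [[uH vH uv] [pH qH pq] eC eQ dd]]]]] := at_oct mM o1 bH (inH _ _ o1 eC1 eQ1).
  have pE : p \in ground M by apply: (subsetP (oct_sub mM o1)); rewrite eQ !inE eqxx !orbT.
  have qE : q \in ground M by apply: (subsetP (oct_sub mM o1)); rewrite eQ !inE eqxx !orbT.
  have pe : p != e by apply: contraNneq eQ1 => <-; rewrite eQ !inE eqxx !orbT.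
  have qe : q != e by apply: contraNneq eQ1 => <-; rewrite eQ !inE eqxx !orbT.
  have [ue|ue] := eqVneq u e'; first by exists v, p, q; rewrite -ue eq_sym; split.
  exists u, p, q; split=> //; have := oat u v p q uH vH uv pE qE pH qH pe qe pq dd.
  by rewrite (negbTE ue) /= => /eqP <-; rewrite dxCr.
have e'x : e' != x by rewrite eq_sym.
have row y a b : y \in H -> y != e' -> a \in ground M -> a \notin H -> a != e -> b \in ground M -> b \notin H -> b != e ->
    a != b -> dx M H e' x a b -> dx M H e' y a b.
  move=> yH ye' aE aH ae bE bH' be ab d1; have [->//|yx] := eqVneq y x.
  have := dx_row mM yH e'H xH ye' yx e'x aH bH' ab (exH y a yH aE aH ae) d1.
  case/orP=> // d2; have := oat y x a b yH xH yx aE bE aH bH' ae be ab d2.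
  by rewrite (negbTE ye') (negbTE xe').
(* If column [a] differed from all other columns on rows [e', x], hence by [row] on every pair of
   rows with [e'], then pivoting [a] in for [e'] would give a free basis of [M \ e] that lies in an
   octahedron. It would be a witness missing [e']. *)
have twin a b : a \in ground M -> a \notin H -> a != e -> b \in ground M -> b \notin H -> b != e -> a != b ->
    dx M H e' x a b -> exists a', [/\ a' \in ground M, a' \notin H, a' != e, a' != a & (a' != b) && ~~ dx M H e' x a a'].
  move=> aE aH ae bE bH' be ab d1.
  case: (boolP [exists a' in ground M, [&& a' \notin H, a' != e, a' != a & (a' != b) && ~~ dx M H e' x a a']]) => [|no].
    by case/exists_inP=> a' a'E /and4P[? ? ? ?]; exists a'.
  have allp p : p \in ground M -> p \notin H -> p != e -> p != a -> dx M H e' x a p.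
    move=> pE pH pe pa; have [->//|pb] := eqVneq p b; apply: contraT => nd; case/negP: no.
    by apply/exists_inP; exists p => //; apply/and4P; split=> //; rewrite pb.
  pose H1 := a |: (H :\ e').
  have a1 : a \in H1 by rewrite /H1 !inE eqxx.
  have bH1 : H1 \in bases M by apply: exH.
  have f1 : rfree M set0 [set e] H1.
    split; rewrite ?sub0set //.
      by rewrite disjoints1 /H1 !inE; atoms.
    move=> u p u1 _ pE p1; rewrite inE => pe.
    move: p1; rewrite /H1 !inE negb_or negb_and negbK => /andP[pa /orP[/eqP pe'|pH]].
      have [ua|ua] := eqVneq u a.
        have -> : p |: H1 :\ u = H by rewrite /H1 ua pe'; set_eq.
        exact: bH.
      have uH : u \in H by move: u1; rewrite /H1 !inE (negbTE ua) => /andP[].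
      have ue' : u != e' by move: u1; rewrite /H1 !inE (negbTE ua) => /andP[].
      have -> : p |: H1 :\ u = a |: H :\ u by rewrite /H1 pe'; set_eq.
      exact: exH.
    have [ua|ua] := eqVneq u a.
      have -> : p |: H1 :\ u = p |: H :\ e' by rewrite /H1 ua; set_eq.
      exact: exH.
    have uH : u \in H by move: u1; rewrite /H1 !inE (negbTE ua) => /andP[].
    have ue' : u != e' by move: u1; rewrite /H1 !inE (negbTE ua) => /andP[].
    have ap : a != p by rewrite eq_sym.
    have -> : p |: H1 :\ u = a |: (p |: H :\ e' :\ u) by rewrite /H1; set_eq.
    exact: row uH ue' aE aH ae pE pH pe ap (allp p pE pH pe pa).
  have /frH : rvalid M set0 [set e] H1.
    have e'a : e' != a by apply: contraNneq aH => <-.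
    have e'1 : e' \notin H1 by rewrite /H1 !inE; atoms.
    have e'b : e' != b by apply: contraNneq bH' => <-.
    apply: (@rfree_rvalid _ M set0 [set e] H H1 a x e' b) => //.
    - by rewrite /H1 !inE; atoms.
    - by rewrite /H1 !inE; atoms.
    - by apply: contraNneq aH => ->.
    - by rewrite /H1 !inE; atoms.
    - by rewrite /H1 !inE; atoms.
    rewrite /dx; have -> : e' |: (b |: H1 :\ a :\ x) = b |: H :\ x by rewrite /H1; set_eq.
    exact: exH.
  have e'a : e' != a by apply: contraNneq aH => <-.
  by rewrite !inE; atoms.
have [c' [c'E c'H c'e c'c /andP[c'd ncc]]] := twin c d cE cH ce dE dH de cd dcd.
have dc : d != c by rewrite eq_sym.
have [d' [d'E d'H d'e d'd /andP[d'c ndd]]] : exists a', [/\ a' \in ground M, a' \notin H, a' != e, a' != d & (a' != c) && ~~ dx M H e' x d a'].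
  by apply: (twin d c) => //; rewrite dxCc.
have col a b f : a \in ground M -> a \notin H -> a != e -> b \in ground M -> b \notin H -> b != e ->
    f \in ground M -> f \notin H -> f != e -> dx M H e' x a b -> dx M H e' x a f || dx M H e' x f b.
  by move=> aE aH ae bE bH' be fE fH' fe; apply: dx_col => //; apply: exH.
have dcd' : dx M H e' x c d'.
  by have := col c d d' cE cH ce dE dH de d'E d'H d'e dcd; rewrite (dxCc _ _ _ _ d') (negbTE ndd) orbF.
have dc'd : dx M H e' x c' d.
  by have := col c d c' cE cH ce dE dH de c'E c'H c'e dcd; rewrite (negbTE ncc).
have dc'd' : dx M H e' x c' d'.
  by have := col c d' c' cE cH ce d'E d'H d'e c'E c'H c'e dcd'; rewrite (negbTE ncc).
have c'd' : c' != d' by apply: contraTneq dc'd => ->; rewrite dxCc.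
set C2 := H :\ e' :\ x.
(* The order matches [Kcls]: positions 0, 1, 2 are parallel to 4, 5, 6, and [x] at position 3 is the
   single element. *)
pose s := [:: e'; c; d; x; e; c'; d'].
have xe : x != e by apply: contraNneq eH => <-.
have sC z : z \in s -> z \notin C2.
  by rewrite !inE => /or4P[/eqP->|/eqP->|/eqP->|/or4P[/eqP->|/eqP->|/eqP->|/eqP->]]; rewrite ?eqxx ?andbF //; atoms.
have us : uniq s.
  have ne a b : a \in H -> b \notin H -> a != b by move=> aH; apply: contraNneq => <-.
  have cc' : c != c' by rewrite eq_sym.
  have dd' : d != d' by rewrite eq_sym.
  have cd' : c != d' by rewrite eq_sym.
  by rewrite /= !inE; atoms.
have base_x y : y \in ground M -> y \notin H -> y != e ->
    [/\ (y |: (x |: C2) \in bases M) = true, (y |: (e' |: C2) \in bases M) = true & (y |: (e |: C2) \in bases M) = true].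
  move=> yE yH ye.
  have b2 : y |: (e' |: C2) \in bases M.
    have -> : y |: (e' |: C2) = y |: H :\ x by rewrite /C2; set_eq.
    exact: exH.
  split=> //.
    have -> : y |: (x |: C2) = y |: H :\ e' by rewrite /C2; set_eq.
    exact: exH.
  have := sw' _ b2; rewrite !inE eqxx orbT => /(_ isT).
  by have -> : e |: (y |: (e' |: C2)) :\ e' = y |: (e |: C2) by rewrite /C2; set_eq.
have [cx ce' ce2] := base_x c cE cH ce; have [dx' de' de2] := base_x d dE dH de.
have [c'x c'e' c'e2] := base_x c' c'E c'H c'e; have [d'x d'e' d'e2] := base_x d' d'E d'H d'e.
have bHx : (e' |: (x |: C2) \in bases M) = true.
  by have -> : e' |: (x |: C2) = H by rewrite /C2; set_eq.
have bex : (x |: (e |: C2) \in bases M) = true.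
  have := sw' _ bH e'H; have -> : e |: H :\ e' = x |: (e |: C2) by rewrite /C2; set_eq.
  by [].
have nee : (e' |: (e |: C2) \in bases M) = false.
  by apply/negP=> bb; have := n1 _ bb; rewrite !inE !eqxx orbT => /(_ isT).
have main (i j : 'I_7) : i < j -> (nth x s i |: (nth x s j |: C2) \in bases M) = (Kcls i != Kcls j).
  case: i => [[|[|[|[|[|[|[|i]]]]]]] Hi]; case: j => [[|[|[|[|[|[|[|j]]]]]]] Hj] //= _;
    rewrite /Kcls /=; rewrite /dx in dcd dcd' dc'd dc'd' ncc ndd;
    rewrite ?(setUCA [set e'] [set c]) ?(setUCA [set e'] [set d]) ?(setUCA [set e'] [set c']) ?(setUCA [set e'] [set d'])
       ?(setUCA [set x] [set c']) ?(setUCA [set x] [set d']) ?(setUCA [set e] [set c']) ?(setUCA [set e] [set d']) ?(setUCA [set d] [set c']) //;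
    by [exact/negbTE].
apply: (@K_config T M C2 x s exM us erefl sC) => i j; rewrite -val_eqE neq_ltn => /orP[] ij; first exact: main.
by rewrite setUCA eq_sym main.
Qed.

(** A simple matroid of rank two is uniform. The four elements of an octahedron alone would give
    [U_{2,4}], a member of the class, so there is a fifth. *)
Lemma excl_rank2 : loopless -> (forall e e', e \in ground M -> e' \in ground M -> e != e' ->
    exists2 B, B \in bases M & (e \in B) && (e' \in B)) ->
  (exists2 B, B \in bases M & #|B| <= 2) -> iso M (U 2 5).
Proof.
move=> ll simple [B bB cB]; have [C [Q o]] := excl_oct; have [c dj b] := o.
have [x [y [xQ yQ xy]]] := card4_2 c.
have cC : #|B| = #|C|.+2 by rewrite (card_bases mM bB (b x y xQ yQ xy)) (card_oct o).
have c2 B' : B' \in bases M -> #|B'| = 2 by move=> b'; rewrite (card_bases mM b' bB); lia.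
have C0 : C = set0 by apply/eqP; rewrite -cards_eq0; lia.
have [s|] := boolP (ground M \subset Q).
  case: nR => _; exists [set x; y]; split; first split.
  - by have := b x y xQ yQ xy; rewrite C0 setU0.
  - exact: sub0set.
  - by rewrite disjoints_subset sub0set.
  - move=> u p uH _ pE; rewrite !inE negb_or => /andP[px py] _.
    have pQ := subsetP s p pE.
    move: uH; rewrite !inE => /orP[] /eqP->.
      have -> : p |: [set x; y] :\ x = p |: (y |: C) by rewrite C0; set_eq; rewrite eq_sym.
      exact: b.
    have -> : p |: [set x; y] :\ y = p |: (x |: C) by rewrite C0; set_eq.
    exact: b.
  move=> C1 Q1 [o1 _ _]; have s1 := oct_sub mM o1; have [c1 dj1 b1] := o1.
  have C10 : C1 = set0.
    have [x1 [y1 [x1Q y1Q xy1]]] := card4_2 c1.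
    have := card_oct o1 x1Q y1Q xy1; rewrite c2 ?b1 // => -[/esym/eqP]; rewrite cards_eq0 => /eqP //.
  rewrite C10 set0U in s1 *.
  have -> : Q1 = Q by apply/eqP; rewrite eqEcard c1 c leqnn (subset_trans s1).
  by rewrite /inoct sub0set set0U subUset !sub1set xQ yQ.
case/subsetPn=> e eE eQ; apply: (@U25_config _ M C (e |: Q)) => //.
- by rewrite cardsU1 eQ c.
- by rewrite C0 disjoints_subset sub0set.
have QE z : z \in e |: Q -> z \in ground M.
  rewrite !inE => /orP[/eqP->//|zQ]; apply: (subsetP (oct_sub mM o)); by rewrite inE zQ orbT.
move=> u v /QE uE /QE vE uv; have [B' b' /andP[uB vB]] := simple u v uE vE uv.
suff -> : u |: (v |: C) = B' by [].
apply/eqP; rewrite eqEcard c2 // C0 setU0 cards2 uv andbT.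
by rewrite subUset !sub1set uB vB.
Qed.

End Reduction.

(** * Fundamental circuits and double exchanges of an arbitrary basis *)

Section FundamentalCircuits.
Variable T : finType.
Implicit Types (M : matroid T) (B C H Q S : {set T}).

Lemma fundamental_circuit M B f : is_matroid M -> B \in bases M -> f \in ground M -> f \notin B ->
  circuit M (f |: [set b in B | f |: (B :\ b) \in bases M]).
Proof.
move=> mM bB fE fB; set S := f |: _.
have fS : f \in S by rewrite !inE eqxx.
have sS : S \subset f |: B by rewrite setUS //; apply/subsetP=> z; rewrite inE => /andP[].
apply/and3P; split.
- by apply: subset_trans sS _; rewrite subUset sub1set fE (base_sub mM bB).
- apply/indepP=> -[B1 b1 s1]; have [B' [b' s' u']] := extend mM b1 s1 bB.
  have fB' : f \in B' by apply: (subsetP s').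
  have [|c [cB cB' e]] := base_swap mM bB b' fB' fB.
    by apply: subset_trans u' _; rewrite subUset sS subsetUr.
  case/negP: cB'; apply: (subsetP s'); rewrite inE; apply/orP; right.
  by rewrite inE cB -e b'.
apply/forall_inP=> x; rewrite in_setU1 in_set => /orP[/eqP->|/andP[xB bx]].
  apply/indepP; exists B => //; apply/subsetP=> z; rewrite in_setD1 => /andP[zf /(subsetP sS)].
  by rewrite in_setU1 (negbTE zf).
apply/indepP; exists (f |: (B :\ x)) => //; apply/subsetP=> z; rewrite in_setD1 => /andP[zx /(subsetP sS)].
by rewrite !inE zx.
Qed.

Lemma dx_of_base M H B p q : is_matroid M -> H \in bases M -> B \in bases M -> p \in B -> q \in B ->
  p \notin H -> q \notin H -> p != q -> B \subset p |: (q |: H) ->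
  exists u v, [/\ u \in H /\ u \notin B, v \in H /\ v \notin B, u != v & dx M H u v p q].
Proof.
move=> mM bH b pB qB pH qH pq sB.
have e : B = p |: (q |: (H :&: B)).
  apply/setP=> z; rewrite !inE; case: (eqVneq z p) => [->//|zp]; case: (eqVneq z q) => [->//|zq] /=.
  by apply/idP/andP => [zB|[]//]; split=> //; have := subsetP sB z zB; rewrite !inE (negbTE zp) (negbTE zq).
have c : #|H :\: B| == 2.
  have cB : #|B| = #|H :&: B|.+2.
    by rewrite {1}e !cardsU1 !inE (negbTE pq) (negbTE pH) (negbTE qH).
  by rewrite -(eqn_add2l #|H :&: B|) cardsID (card_bases mM bH b) cB addn2.
case/cards2P: c => u [v [uv eD]].
have : u \in H :\: B by rewrite eD !inE eqxx.
have : v \in H :\: B by rewrite eD !inE eqxx orbT.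
rewrite !inE => /andP[vB vH] /andP[uB uH]; exists u, v; split=> //.
rewrite /dx setDDl -eD; suff -> : H :\: (H :\: B) = H :&: B by rewrite -e.
by rewrite setDDr setDv set0U.
Qed.

End FundamentalCircuits.

(** * Free bases of a large excluded minor *)

Section FreeBases.
Variables (T : finType) (M : matroid T).
Hypothesis exM : excl M.
Hypothesis simple : forall e e', e \in ground M -> e' \in ground M -> e != e' ->
  exists2 B, B \in bases M & (e \in B) && (e' \in B).
Hypothesis cosimple : forall e e', e \in ground M -> e' \in ground M -> e != e' ->
  exists2 B, B \in bases M & (e \notin B) && (e' \notin B).
Hypothesis rank3 : forall B, B \in bases M -> 3 <= #|B|.
Hypothesis corank3 : forall B, B \in bases M -> 3 <= #|ground M :\: B|.
Hypothesis nU25 : ~ iso M (U 2 5).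
Hypothesis nU35 : ~ iso (dual M) (U 2 5).
Hypothesis nloop : ~ iso M (dsum (U 2 4) (U 0 1)).
Hypothesis ncoloop : ~ iso (dual M) (dsum (U 2 4) (U 0 1)).
Hypothesis nR6 : ~ iso M R6.
Implicit Types (B C D E H P Q X : {set T}).

Let mM : is_matroid M. Proof. by case: exM. Qed.
Local Notation E := (ground M).

(** Here [f] is a coloop of the restriction to [C :|: Q]. In the dual it becomes a loop of a
    contraction, where [loop_config] applies. *)
Lemma coloop_config C Q f : oct M C Q -> f \in C -> (forall B, B \in bases M -> B \subset C :|: Q -> f \in B) -> False.
Proof.
move=> o fC h; have sE := oct_sub mM o; apply: ncoloop.
have fE : f \in E by apply: (subsetP sE); rewrite inE fC.
apply: (@loop_config _ _ _ _ f (excl_dual exM) (oct_dual mM o)) => //=.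
- by rewrite !inE fC.
- by apply/negP=> /(oct_notin o); rewrite fC.
move=> B /(dual_base mM)[b sB] s; apply/negP=> fB; have : f \in E :\: B.
  apply: h => //; rewrite subDset; apply/subsetP=> z zE; rewrite inE.
  by rewrite orbC; case: (boolP (z \in C :|: Q)) => //= zN; apply: (subsetP s); rewrite in_setD zN.
by rewrite inE fB.
Qed.

Section AtBase.
Variables (D0 H : {set T}).
Hypothesis bH : H \in bases M.
Hypothesis fr : forall u p, u \in H -> p \in E -> p \notin H -> p \notin D0 -> p |: (H :\ u) \in bases M.

(* Three columns that are pairwise independent on two rows give a [U_{2,5}]-minor. *)
Lemma dx_col3 u v p q s : u \in H -> v \in H -> u != v -> p \in E -> q \in E -> s \in E ->
  p \notin H -> q \notin H -> s \notin H -> p \notin D0 -> q \notin D0 -> s \notin D0 ->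
  p != q -> p != s -> q != s -> dx M H u v p q -> dx M H u v p s -> ~~ dx M H u v q s.
Proof.
move=> uH vH uv pE qE sE pH qH sH pD qD sD pq ps qs d1 d2; apply/negP=> d3; apply: nU25.
have inC z : z \in [set u; v; p; q; s] -> z \notin H :\ u :\ v.
  by rewrite !inE -!orbA => /or4P[||| /orP[]] /eqP->; atoms.
apply: (@U25_config _ M (H :\ u :\ v) [set u; v; p; q; s] exM).
- rewrite -!setUA !cardsU1 cards1 !inE; atoms => //.
- by rewrite disjoint_sym; apply: disjointP.
have hu z : z \in E -> z \notin H -> z \notin D0 -> u |: (z |: H :\ u :\ v) \in bases M.
  by move=> zE zH zD; have -> : u |: (z |: H :\ u :\ v) = z |: H :\ v by [set_eq]; apply: fr.
have hv z : z \in E -> z \notin H -> z \notin D0 -> v |: (z |: H :\ u :\ v) \in bases M.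
  by move=> zE zH zD; have -> : v |: (z |: H :\ u :\ v) = z |: H :\ u by [set_eq]; apply: fr.
have huv : u |: (v |: H :\ u :\ v) \in bases M by have -> : u |: (v |: H :\ u :\ v) = H by [set_eq].
rewrite /dx in d1 d2 d3.
by move=> x y; rewrite !inE -!orbA => /or4P[||| /orP[]] /eqP-> /or4P[||| /orP[]] /eqP->; rewrite ?eqxx // => _;
  first [exact: huv | exact: d1 | exact: d2 | exact: d3 | by apply: hu | by apply: hv
    | rewrite setUCA; first [exact: huv | exact: d1 | exact: d2 | exact: d3 | by apply: hu | by apply: hv]].
Qed.

(** The dual of [dx_col3]: removing any two of [u, v, w, p, q] from [H :|: [set p; q]] leaves a
    basis, which means [U_{3,5}] in [M] and [U_{2,5}] in the dual. *)
Lemma dx_row3 u v w p q : u \in H -> v \in H -> w \in H -> u != v -> u != w -> v != w ->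
  p \in E -> q \in E -> p \notin H -> q \notin H -> p \notin D0 -> q \notin D0 -> p != q ->
  dx M H u v p q -> dx M H u w p q -> ~~ dx M H v w p q.
Proof.
move=> uH vH wH uv uw vw pE qE pH qH pD qD pq d1 d2; apply/negP=> d3; apply: nU35.
pose P := [set u; v; w; p; q].
have sH := base_sub mM bH.
have sP : H :|: P \subset E.
  by rewrite subUset sH !subUset !sub1set (subsetP sH u) // (subsetP sH v) // (subsetP sH w) // pE qE.
pose C := E :\: (H :|: P).
have base x y : x \in P -> y \in P -> x != y -> (H :|: [set p; q]) :\ x :\ y \in bases M.
  have swp a b : (H :|: [set p; q]) :\ a :\ b = (H :|: [set p; q]) :\ b :\ a by rewrite !setDDl (setUC [set a]).
  have e1 a b : a \in H -> b \in H -> a != b -> dx M H a b p q -> (H :|: [set p; q]) :\ a :\ b \in bases M.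
    by move=> aH bH' ab; rewrite /dx; suff -> : (H :|: [set p; q]) :\ a :\ b = p |: (q |: H :\ a :\ b) by []; set_eq.
  have e2 a : a \in H -> (H :|: [set p; q]) :\ a :\ p \in bases M.
    by move=> aH; have -> : (H :|: [set p; q]) :\ a :\ p = q |: H :\ a by [set_eq]; apply: fr.
  have e3 a : a \in H -> (H :|: [set p; q]) :\ a :\ q \in bases M.
    by move=> aH; have -> : (H :|: [set p; q]) :\ a :\ q = p |: H :\ a by [set_eq]; apply: fr.
  have e4 : (H :|: [set p; q]) :\ p :\ q \in bases M.
    by have -> : (H :|: [set p; q]) :\ p :\ q = H by [set_eq].
  rewrite !inE -!orbA => /or4P[||| /orP[]] /eqP-> /or4P[||| /orP[]] /eqP->; rewrite ?eqxx // => _;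
    first [exact: e4 | exact: e2 | exact: e3 | by apply: e1 | by rewrite swp; first [exact: e4 | exact: e2 | exact: e3 | by apply: e1]].
apply: (@U25_config _ (dual M) C P (excl_dual exM)).
- rewrite /P -!setUA !cardsU1 cards1 !inE; atoms => //.
- by apply: disjointP => z; rewrite !inE => /andP[/norP[_ ->]].
move=> x y xP yP xy.
have -> : x |: (y |: C) = E :\: ((H :|: [set p; q]) :\ x :\ y).
  have sub z : z \in H :|: P -> z \in E := subsetP sP z.
  have xE : x \in E by apply: sub; rewrite inE xP orbT.
  have yE : y \in E by apply: sub; rewrite inE yP orbT.
  have eHP : H :|: P = H :|: [set p; q].
    apply/setP=> z; rewrite !inE; case zH: (z \in H) => //=.
    have ne a : a \in H -> (z == a) = false by move=> aH; apply: contraFF zH => /eqP->.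
    by rewrite ne // ne // ne.
  rewrite /C eHP; apply/setP=> z; rewrite !inE.
  case: (eqVneq z x) => [->|zx]; first by rewrite xE andbF.
  by case: (eqVneq z y) => [->|zy] /=; rewrite ?yE.
rewrite base_dual ?base // (subset_trans (subD1set _ _)) // (subset_trans (subD1set _ _)) //.
apply: subset_trans sP; rewrite setUS //; apply/subsetP=> z.
by rewrite !inE => /orP[]->; rewrite !orbT.
Qed.

End AtBase.

(** Proportional columns would mean parallel elements. In terms of bases: one that contains both [p]
    and [q], completed from [H], loses exactly two elements of [H]. *)
Lemma dx_simple H p q : H \in bases M -> p \in E -> q \in E -> p \notin H -> q \notin H -> p != q ->
  exists u v, [/\ u \in H, v \in H, u != v & dx M H u v p q].
Proof.
move=> bH pE qE pH qH pq; have [B b /andP[pB qB]] := simple pE qE pq.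
have [|B' [b' sI sU]] := @extend _ M B H [set p; q] mM b _ bH.
  by rewrite subUset !sub1set pB.
move: (sI); rewrite subUset !sub1set => /andP[pB' qB'].
rewrite -setUA in sU.
by have [u [v [[uH _] [vH _] uv d]]] := dx_of_base mM bH b' pB' qB' pH qH pq sU; exists u, v.
Qed.

Lemma dx_cosimple H u v : H \in bases M -> u \in H -> v \in H -> u != v ->
  exists p q, [/\ p \in E /\ p \notin H, q \in E /\ q \notin H, p != q & dx M H u v p q].
Proof.
move=> bH uH vH uv; have [uE vE] := (base_in mM bH uH, base_in mM bH vH).
have [B b /andP[uB vB]] := cosimple uE vE uv.
have [|B' [b' sI sU]] := @extend _ M H B (H :\ u :\ v) mM bH _ b.
  by rewrite setDDl subsetDl.
have [uB' vB'] : u \notin B' /\ v \notin B'.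
  by split; [apply: contra uB | apply: contra vB] => /(subsetP sU); rewrite !inE eqxx ?andbF.
have c : #|B' :\: (H :\ u :\ v)| == 2.
  rewrite cardsD (setIidPr sI) (card_bases mM b' bH) (cardsD2 uH vH uv).
  by rewrite -addn2 addKn.
case/cards2P: c => p [q [pq eD]].
have n z : z \in B' :\: (H :\ u :\ v) -> z \in E /\ z \notin H.
  rewrite inE => /andP[zI zB]; split; first exact: base_in b' zB.
  apply: contra zI => zH; rewrite !inE zH andbT; apply/andP; split.
    by apply: contraNneq vB' => <-.
  by apply: contraNneq uB' => <-.
exists p, q; split=> //; try by apply: n; rewrite eD !inE eqxx ?orbT.
by rewrite /dx setUA -eD setDUK.
Qed.

Definition freeb H : Prop := H \in bases M /\
  forall u p, u \in H -> p \in E -> p \notin H -> p |: (H :\ u) \in bases M.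

Lemma freeb_rfree H C0 D0 : freeb H -> C0 \subset H -> [disjoint D0 & H] -> rfree M C0 D0 H.
Proof. by move=> [bH fr] sC dD; split=> // u p uH _ pE pH _; apply: fr. Qed.

Lemma pick_two (S : {set T}) e : 3 <= #|S| -> exists a b, [/\ a \in S, b \in S, a != b, a != e & b != e].
Proof.
move=> c; have : 1 < #|S :\ e| by have := cardsD1 e S; case: (e \in S) => /=; lia.
by case/card_gt1P=> a [b [+ + ab]]; rewrite !inE => /andP[ae aS] /andP[be bS]; exists a, b.
Qed.

Lemma pick_two4 (S : {set T}) e e' : 4 <= #|S| -> exists a b, [/\ a \in S, b \in S, a != b, (a != e) && (b != e) & (a != e') && (b != e')].
Proof.
move=> c; have : 3 <= #|S :\ e'| by have := cardsD1 e' S; case: (e' \in S) => /=; lia.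
case/(pick_two e)=> a [b [+ + ab ae be]]; rewrite !inE => /andP[ae' aS] /andP[be' bS].
by exists a, b; rewrite ae be ae' be'.
Qed.

(* If [e] lies in [C] and [H], then [H] stays free in [M / e], which is in the class, so [rfree_rvalid] applies there;
   dually for deletion. *)
Lemma free_avoid H C Q : freeb H -> oct M C Q -> ~~ inoct H C Q ->
  (forall x, x \in C -> x \notin H) /\ (forall x, x \in E -> x \notin C -> x \notin Q -> x \in H).
Proof.
move=> fH o nin; have [bH _] := fH; split=> [e eC|d dE dC dQ].
  apply: contra nin => eH; have eE := base_in mM bH eH.
  have [|H1 v1] := excl_con exM eE; first by exists C, Q; apply: roct_con.
  have [u [v [uH vH uv ue ve]]] := pick_two e (rank3 bH).
  have [p [q [[pE pH] [qE qH] pq d]]] := dx_cosimple bH uH vH uv.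
  have rf : rfree M [set e] set0 H.
    by apply: freeb_rfree; rewrite ?sub1set // disjoints_subset sub0set.
  have [_ val] : rvalid M [set e] set0 H.
    by apply: (rfree_rvalid mM v1 rf (u := u) (v := v) (p := p) (q := q)) => //; rewrite !inE; atoms.
  exact/val/roct_con.
apply: contraNT nin => dH.
have [|H1 v1] := excl_del exM dE; first by exists C, Q; apply: roct_del.
have [p [q [+ + pq pd qd]]] := pick_two d (corank3 bH).
rewrite !inE => /andP[pH pE] /andP[qH qE].
have [u [v [uH vH uv dd]]] := dx_simple bH pE qE pH qH pq.
have rf : rfree M set0 [set d] H by apply: freeb_rfree; rewrite ?sub0set // disjoints1.
have [_ val] : rvalid M set0 [set d] H.
  by apply: (rfree_rvalid mM v1 rf (u := u) (v := v) (p := p) (q := q)) => //; rewrite !inE; atoms.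
exact/val/roct_del.
Qed.

(** * A basis that becomes free when one element is deleted *)

Section FreeInOctahedron.
Variables (H : {set T}) (e : T).
Hypothesis rf : rfree M set0 [set e] H.
Hypothesis eE : e \in E.

Let bH : H \in bases M. Proof. by case: rf. Qed.
Let eH : e \notin H. Proof. by case: rf => _ _ + _; rewrite disjoints1. Qed.
Let fr u p : u \in H -> p \in E -> p \notin H -> p != e -> p |: (H :\ u) \in bases M.
Proof. by move=> uH pE pH pe; case: rf => _ _ _; apply; rewrite ?inE. Qed.

(** If both exchanges failed, [e] would be a loop after contracting [H :\ v :\ v']; with the
    octahedron at rows [v, v'] from [dx_cosimple] this gives the sum of [U_{2,4}] and a loop. *)
Lemma rfree_one_bad v v' : v \in H -> v' \in H -> v != v' ->
  e |: (H :\ v) \notin bases M -> e |: (H :\ v') \in bases M.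
Proof.
move=> vH vH' vv nv; apply: contraT => nv'.
have noB B : B \in bases M -> H :\ v :\ v' \subset B -> e \notin B.
  move=> b sB; apply/negP=> eB.
  have [|B' [b' sI sU]] := @extend _ M B H (e |: (H :\ v :\ v')) mM b _ bH.
    by rewrite subUset sub1set eB.
  have eB' : e \in B' by apply: (subsetP sI); rewrite !inE eqxx.
  have sB' : B' \subset e |: H.
    by apply/subsetP=> z /(subsetP sU); rewrite !inE; case: (z == e) => //=; case: (z \in H); rewrite ?andbF.
  have [w [wH wB' defB']] := base_swap mM bH b' eB' eH sB'.
  have [wv|wv] := eqVneq w v; first by rewrite -wv -defB' b' in nv.
  have [wv'|wv'] := eqVneq w v'; first by rewrite -wv' -defB' b' in nv'.
  by case/negP: wB'; apply: (subsetP sI); rewrite !inE wv wv' wH orbT.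
have [p [q [[pE pH] [qE qH] pq d]]] := dx_cosimple bH vH vH' vv.
have [pe qe] : p != e /\ q != e.
  have := noB _ d; rewrite !inE !negb_or (eq_sym p) (eq_sym q); case/(_ _)/and3P=> //.
  by apply/subsetP=> z zC; rewrite !inE -!in_setD1 zC !orbT.
have [o _ _] : roct M set0 [set e] (H :\ v :\ v') [set v; v'; p; q].
  by apply: oct_at; rewrite // ?inE; atoms => //.
case: nloop; apply: (loop_config exM o eE) => //; rewrite !inE.
  by rewrite (negbTE eH) !andbF.
by atoms => //.
Qed.

Variable v : T.
Hypothesis vH : v \in H.
(* By [rfree_one_bad] this exchange is the only obstruction to [H] being free in [M]. *)
Hypothesis ve : e |: (H :\ v) \notin bases M.

Let he u : u \in H -> u != v -> e |: (H :\ u) \in bases M.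
Proof. by move=> uH uv; rewrite eq_sym in uv; apply: rfree_one_bad ve. Qed.

(** The entry at row [v] and column [e] is zero, so the determinant is the product of the nonzero
    entries at [v, p] and [f, e]. *)
Lemma dx_bad f p : f \in H -> f != v -> p \in E -> p \notin H -> p != e -> dx M H v f p e.
Proof.
move=> fH fv pE pH pe; have b1 := fr vH pE pH pe; have b2 := he fH fv.
have e1 : p |: (H :\ v) = p |: (f |: H :\ v :\ f) by set_eq.
have e2 : e |: (H :\ f) = e |: (v |: H :\ v :\ f) by set_eq.
rewrite e1 in b1; rewrite e2 in b2; have [||//|h] := rank2_exchange mM b1 b2.
- by rewrite !inE eqxx andbF.
- by apply: contraNneq eH => <-.
case/negP: ve; suff -> : e |: (H :\ v) = f |: (e |: H :\ v :\ f) by [].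
by set_eq.
Qed.

(* Otherwise contracting [H - {u, v, f}] leaves [R6] on [u, v, f, e, p, q], or [U_{2,4}] with a coloop on five of these. *)
Lemma dx_spread u f p q : u \in H -> f \in H -> u != v -> f != v -> f != u ->
  p \in E -> q \in E -> p \notin H -> q \notin H -> p != e -> q != e -> p != q ->
  dx M H u v p q -> dx M H f u p q.
Proof.
move=> uH fH uv fv fu pE qE pH qH pe qe pq d; apply: contraT => nd.
have d2 : dx M H f v p q.
  have := dx_row mM fH uH vH fu fv uv pH qH pq (fr fH pE pH pe) d.
  by rewrite dxCr (negbTE nd).
have [C defC] : exists C, C = H :\ u :\ v :\ f by exists (H :\ u :\ v :\ f).
pose t a b c := a |: (b |: (c |: C)) \in bases M.
have t12 a b c : t a b c = t b a c by rewrite /t setUCA.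
have t23 a b c : t a b c = t a c b by rewrite /t (setUCA [set b]).
have uC : u \notin C by rewrite defC !inE eqxx !andbF.
have vC : v \notin C by rewrite defC !inE eqxx !andbF.
have fC : f \notin C by rewrite defC !inE eqxx.
have nC x : x \notin H -> x \notin C by apply: contra; rewrite defC !inE => /and4P[].
(* The predicate [t] lists the bases of the rank-three matroid [M / C]; contracting [x] as well
   reduces exchange to [rank2_exchange]. *)
have ex a b c w x : w \notin C -> w != x -> w != b -> t a c x -> t b w x -> t a b x \/ t c b x.
  by move=> wC wx wb b1 b2; apply: (rank2_exchange mM b1 b2 _ wb); rewrite in_setU1 negb_or wx.
have uvp x : x \in E -> x \notin H -> x != e -> t u v x.
  by move=> xE xH xe; rewrite /t; have -> : u |: (v |: (x |: C)) = x |: (H :\ f) by [rewrite defC; set_eq]; apply: fr.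
have ufp x : x \in E -> x \notin H -> x != e -> t u f x.
  by move=> xE xH xe; rewrite /t; have -> : u |: (f |: (x |: C)) = x |: (H :\ v) by [rewrite defC; set_eq]; apply: fr.
have vfp x : x \in E -> x \notin H -> x != e -> t v f x.
  by move=> xE xH xe; rewrite /t; have -> : v |: (f |: (x |: C)) = x |: (H :\ u) by [rewrite defC; set_eq]; apply: fr.
have uvf : t u v f by rewrite /t; have -> : u |: (v |: (f |: C)) = H by [rewrite defC; set_eq].
have uve : t u v e.
  by rewrite /t; have -> : u |: (v |: (e |: C)) = e |: (H :\ f) by [rewrite defC; set_eq]; apply: he.
have vfe : t v f e.
  by rewrite /t; have -> : v |: (f |: (e |: C)) = e |: (H :\ u) by [rewrite defC; set_eq]; apply: he.
have ufe : ~~ t u f e.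
  by rewrite /t; have -> : u |: (f |: (e |: C)) = e |: (H :\ v) by [rewrite defC; set_eq].
have fpq : t f p q.
  by rewrite /t; have -> : f |: (p |: (q |: C)) = p |: (q |: H :\ u :\ v) by [rewrite defC; set_eq].
have upq : t u p q.
  by rewrite /t; have -> : u |: (p |: (q |: C)) = p |: (q |: H :\ f :\ v) by [rewrite defC; set_eq].
have vpq : ~~ t v p q.
  by rewrite /t; have -> : v |: (p |: (q |: C)) = p |: (q |: H :\ f :\ u) by [rewrite defC; set_eq].
have perm a b c : t a b c -> (t a b c * t a c b * t b a c) * (t b c a * t c a b * t c b a)%type.
  by move=> h; split; [split; [split|]|split; [split|]]; rewrite ?h //; [rewrite t23|rewrite t12|rewrite t23 t12|rewrite t12 t23|rewrite t12 t23 t12].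
have fpe x : x \in E -> x \notin H -> x != e -> t f x e.
  move=> xE xH xe; have h1 := perm _ _ _ (ufp x xE xH xe); have h2 := perm _ _ _ vfe.
  have := ex x e u v f vC; rewrite h1 h2; atoms => /(_ isT isT isT isT)[] /perm h; rewrite ?h //.
  by rewrite h in ufe.
have upe x : x \in E -> x \notin H -> x != e -> t u x e.
  move=> xE xH xe; have h1 := perm _ _ _ (ufp x xE xH xe); have h2 := perm _ _ _ uve.
  have := ex x e f v u vC; rewrite h1 h2; atoms => /(_ isT isT isT isT)[] /perm h; rewrite ?h //.
  by rewrite h in ufe.
(* If [v, x, y] and [v, x, e] are both dependent over [C], then [y] and [e] lie in the span of
   [v, x], and [f] is a coloop beside the octahedron on [v, x, y, e] over [f |: C]. *)
have vxe x y : x \in E -> y \in E -> x \notin H -> y \notin H -> x != e -> y != e -> x != y ->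
   t f x y -> ~~ t v x y -> ~~ t v x e -> False.
  move=> xE yE xH yH xe ye xy k6 n1 n2.
  have h1 := perm _ _ _ (uvp x xE xH xe).
  have n3 : ~~ t v y e.
    apply/negP=> /perm h; have := ex y x e u v uC; rewrite h1 h; atoms => /(_ isT isT isT isT)[] /perm h'.
      by rewrite h' in n1.
    by rewrite h' in n2.
  have n4 : ~~ t x y e.
    apply/negP=> /perm h; have := ex y v e u x uC; rewrite h1 h; atoms => /(_ isT isT isT isT)[] /perm h'.
      by rewrite h' in n1.
    by rewrite h' in n2.
  have [xC yC eNC] : [/\ x \notin C, y \notin C & e \notin C] by split; apply: nC.
  case: (@coloop_config (f |: C) [set v; x; y; e] f).
  - have k1 := perm _ _ _ (vfp x xE xH xe); have k2 := perm _ _ _ (vfp y yE yH ye).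
    have k3 := perm _ _ _ (fpe x xE xH xe); have k4 := perm _ _ _ (fpe y yE yH ye).
    have k5 := perm _ _ _ vfe; have {}k6 := perm _ _ _ k6.
    by apply: octI; rewrite -?/(t _ _ _) ?k1 ?k2 ?k3 ?k4 ?k5 ?k6 //= ?inE; atoms.
  - by rewrite !inE eqxx.
  move=> B b sB; apply: contraT => fB; have b1 : u |: (v |: (x |: C)) \in bases M by rewrite -/(t _ _ _) h1.
  have [||w [wB wN b2]] := exch mM b1 b (x := u); first by rewrite !inE eqxx.
    by apply/negP=> /(subsetP sB); rewrite !inE; atoms.
  have e1 : w |: (u |: (v |: (x |: C))) :\ u = w |: (v |: (x |: C)) by set_eq.
  rewrite e1 -/(t w v x) in b2; have h := perm _ _ _ b2.
  have := subsetP sB w wB; move: wN; rewrite !inE !negb_or => /and4P[wu wv wx wC].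
  have wf : w != f by apply: contraNneq fB => <-.
  rewrite (negbTE wC) (negbTE wv) (negbTE wf) (negbTE wx) /= => /orP[]/eqP ew; rewrite ew in h.
    by rewrite h in n1.
  by rewrite h in n2.
have vpe : t v p e by apply: contraT => /(vxe p q pE qE pH qH pe qe pq fpq vpq).
have vqe : t v q e by apply: contraT => /(vxe q p qE pE qH pH qe pe); rewrite eq_sym [t f q p]t23 [t v q p]t23 => /(_ pq fpq vpq).
have pqe : t p q e.
  have h1 := perm _ _ _ vpe; have h2 := perm _ _ _ fpq; rewrite t23 t12.
  have := ex v q e f p fC; rewrite h1 h2; atoms => /(_ isT isT isT isT)[] /perm h; rewrite ?h //.
  by rewrite h in vpq.
case: nR6; apply: (@R6_config _ M C [set f; u; e] [set v; p; q] exM).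
- by rewrite -!setUA !cardsU1 cards1 !inE; atoms.
- by rewrite -!setUA !cardsU1 cards1 !inE; atoms.
- by apply: disjointP => z; rewrite !inE -!orbA => /or3P[] /eqP->; atoms.
- rewrite disjoint_sym; apply: disjointP => z; rewrite !inE -!orbA.
  by have [pC qC eNC] : [/\ p \notin C, q \notin C & e \notin C] by [split; apply: nC];
     move=> /or4P[|||/or3P[]] /eqP->.
- by rewrite -!setUA -/(t f u e) t12.
- by rewrite -!setUA -/(t v p q).
- have h1 := perm _ _ _ uvf; have h2 := perm _ _ _ uve; have h3 := perm _ _ _ vfe.
  have h4 := perm _ _ _ (ufp p pE pH pe); have h5 := perm _ _ _ (ufp q qE qH qe).
  have h6 := perm _ _ _ (fpe p pE pH pe); have h7 := perm _ _ _ (fpe q qE qH qe).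
  have h8 := perm _ _ _ (upe p pE pH pe); have h9 := perm _ _ _ (upe q qE qH qe).
  by move=> x y z; rewrite !inE -!orbA => /or3P[]/eqP-> /or3P[]/eqP->; rewrite ?eqxx // => _ /or3P[]/eqP->;
    rewrite -/(t _ _ _) ?uvf ?h1 ?uve ?h2 ?vfe ?h3 ?h4 ?h5 ?h6 ?h7 ?h8 ?h9 // ?(ufp _ pE) ?(ufp _ qE) ?fpe ?upe.
have h1 := perm _ _ _ (vfp p pE pH pe); have h2 := perm _ _ _ (vfp q qE qH qe).
have h3 := perm _ _ _ (uvp p pE pH pe); have h4 := perm _ _ _ (uvp q qE qH qe).
have h5 := perm _ _ _ fpq; have h6 := perm _ _ _ upq.
have h7 := perm _ _ _ vpe; have h8 := perm _ _ _ vqe; have h9 := perm _ _ _ pqe.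
by move=> x y z; rewrite !inE -!orbA => /or3P[]/eqP-> /or3P[]/eqP-> /or3P[]/eqP->; rewrite ?eqxx // => _;
    rewrite -/(t _ _ _) ?h1 ?h2 ?h3 ?h4 ?h5 ?h6 ?h7 ?h8 ?h9 // ?fpq ?upq.
Qed.

Let frD u p : u \in H -> p \in E -> p \notin H -> p \notin [set e] -> p |: (H :\ u) \in bases M.
Proof. by rewrite in_set1; apply: fr. Qed.

(** Columns [q] and [s] agree on rows [u, v] by [dx_col3], but simplicity separates them on [v] and
    some row [a]. As [p] differs from both on [u, v], [dx_spread] and [dx_row3] make it agree with
    both on [a, v], against transitivity. *)
Lemma no_third_col u p q s : u \in H -> u != v -> p \in E -> q \in E -> s \in E ->
  p \notin H -> q \notin H -> s \notin H -> p != e -> q != e -> s != e ->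
  p != q -> p != s -> q != s -> dx M H u v p q -> dx M H u v p s -> False.
Proof.
move=> uH uv pE qE sE pH qH sH pe qe se pq ps qs d1 d2.
have nd : ~~ dx M H u v q s.
  by apply: (dx_col3 bH frD uH vH uv pE qE sE pH qH sH) => //; rewrite in_set1.
have [a [aH av d3]] : exists a, [/\ a \in H, a != v & dx M H a v q s].
  have [a [b [aH bH' ab d]]] := dx_simple bH qE sE qH sH qs.
  have [ev|va] := eqVneq v a.
    by exists b; rewrite dxCr ev eq_sym; split.
  have [ev|vb] := eqVneq v b; first by exists a; rewrite ev; split.
  have := dx_row mM vH aH bH' va vb ab qH sH qs (fr vH qE qH qe) d; rewrite eq_sym in va.
  case/orP=> d'; first by exists a.
  by exists b; rewrite dxCr eq_sym.
have au : a != u by apply: contraNneq nd => <-.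
have vu : v != u by rewrite eq_sym.
have no y : y \in E -> y \notin H -> y != e -> p != y -> dx M H u v p y -> ~~ dx M H a v p y.
  move=> yE yH ye py d; have d' := dx_spread uH aH uv av au pE yE pH yH pe ye py d.
  rewrite dxCr in d'; rewrite dxCr; rewrite eq_sym in au; rewrite eq_sym in av.
  by apply: (dx_row3 bH frD uH vH aH uv au av pE yE) => //; rewrite in_set1.
have := dx_col mM aH vH av qH pH sH (fr vH pE pH pe) d3.
by rewrite dxCc (negbTE (no q qE qH qe pq d1)) (negbTE (no s sE sH se ps d2)).
Qed.

Lemma bad_ground u p q : u \in H -> u != v -> p \in E -> q \in E ->
  p \notin H -> q \notin H -> p != e -> q != e -> p != q -> dx M H u v p q ->
  forall s, s \in E -> s \notin H -> s != e -> (s == p) || (s == q).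
Proof.
move=> uH uv pE qE pH qH pe qe pq d s sE sH se; apply: contraT; rewrite negb_or => /andP[sp sq].
have ps : p != s by rewrite eq_sym.
have qs : q != s by rewrite eq_sym.
have := dx_col mM uH vH uv pH sH qH (fr vH sE sH se) d; rewrite [dx _ _ _ _ s q]dxCc.
case/orP=> d2; first by case: (no_third_col uH uv pE qE sE pH qH sH pe qe se pq ps qs d d2).
rewrite dxCc in d; rewrite eq_sym in pq.
by case: (no_third_col uH uv qE pE sE qH pH sH qe pe se pq qs ps d d2).
Qed.

(** Suppose there are rows [f, g] besides [u, v]. By [dx_spread] and [dx_row3] all rows except [u]
    agree on [p, q], so cosimplicity separates [f] and [g] only with the help of column [e].
    Contracting [q] and [H :\ v :\ f :\ g] then leaves an octahedron on [v, f, g, e] with [p] as a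
    loop. *)
Lemma bad_rank u p q : u \in H -> u != v -> p \in E -> q \in E ->
  p \notin H -> q \notin H -> p != e -> q != e -> p != q -> dx M H u v p q -> #|H :\ u :\ v| = 1.
Proof.
move=> uH uv pE qE pH qH pe qe pq d; apply/eqP; rewrite eqn_leq; apply/andP; split; last first.
  by have := rank3 bH; rewrite (cardsD2 uH vH uv) !ltnS.
rewrite leqNgt; apply/negP=> /card_gt1P[f [g [+ + fg]]].
rewrite !inE => /and3P[fv fu fH] /and3P[gv gu gH].
have vu : v != u by rewrite eq_sym.
have [vf vg gf] : [/\ v != f, v != g & g != f] by split; rewrite eq_sym.
have uf : u != f by rewrite eq_sym.
have ug : u != g by rewrite eq_sym.
have du x : x \in H -> x != u -> x != v -> dx M H u x p q.
  by move=> xH xu xv; rewrite dxCr; apply: dx_spread.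
have no x y : x \in H -> y \in H -> x != u -> y != u -> x != y -> dx M H x y p q -> False.
  move=> xH yH xu yu xy dd.
  have dx' : dx M H u x p q by have [->//|xv] := eqVneq x v; apply: du.
  have dy' : dx M H u y p q by have [->//|yv] := eqVneq y v; apply: du.
  have ux : u != x by rewrite eq_sym.
  have uy : u != y by rewrite eq_sym.
  have pD : p \notin [set e] by rewrite in_set1.
  have qD : q \notin [set e] by rewrite in_set1.
  by have := dx_row3 bH frD uH xH yH ux uy xy pE qE pH qH pD qD pq dx' dy'; rewrite dd.
have dfg : dx M H f g q e.
  have [x [y [[xE xH] [yE yH] xy d1]]] := dx_cosimple bH fH gH fg.
  have [x' [x'E x'H x'e d2]] : exists x', [/\ x' \in E, x' \notin H, x' != e & dx M H f g x' e].
    have [ex|ne] := eqVneq x e; first by exists y; rewrite dxCc -ex eq_sym.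
    have [ey|ne'] := eqVneq y e; first by exists x; rewrite -ey.
    case: (@no f g) => //.
    case/orP: (bad_ground uH uv pE qE pH qH pe qe pq d xE xH ne) => /eqP ex;
    case/orP: (bad_ground uH uv pE qE pH qH pe qe pq d yE yH ne') => /eqP ey; rewrite ex ey ?eqxx // in xy d1 *.
    by rewrite dxCc.
  case/orP: (bad_ground uH uv pE qE pH qH pe qe pq d x'E x'H x'e) => /eqP ex; rewrite ex // in d2.
  have := dx_col mM fH gH fg pH qH eH (fr gH qE qH qe) d2.
  by case/orP=> // /(no f g fH gH fu gu fg).
have ec : e \notin q |: (H :\ v :\ f :\ g) by rewrite !inE eq_sym; atoms.
have nc x : (x == v) || (x == f) || (x == g) -> x \notin q |: (H :\ v :\ f :\ g).
  by case/orP=> [/orP[]|] /eqP->; rewrite !inE; atoms.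
case: nloop; apply: (@loop_config _ M (q |: (H :\ v :\ f :\ g)) [set v; f; g; e] p exM) => //.
- have b x : x \in H -> q |: (H :\ x) \in bases M by move=> xH; apply: fr.
  have bf := dx_bad fH fv qE qH qe; have bg := dx_bad gH gv qE qH qe.
  rewrite /dx in bf bg dfg.
  apply: octI; rewrite ?ec ?nc ?eqxx ?orbT //= ?inE; atoms => //.
  + by have -> : v |: (f |: (q |: H :\ v :\ f :\ g)) = q |: (H :\ g) by [set_eq]; apply: b.
  + by have -> : v |: (g |: (q |: H :\ v :\ f :\ g)) = q |: (H :\ f) by [set_eq]; apply: b.
  + by have -> : v |: (e |: (q |: H :\ v :\ f :\ g)) = q |: (e |: H :\ f :\ g) by [set_eq].
  + by have -> : f |: (g |: (q |: H :\ v :\ f :\ g)) = q |: (H :\ v) by [set_eq]; apply: b.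
  + by have -> : f |: (e |: (q |: H :\ v :\ f :\ g)) = q |: (e |: H :\ v :\ g) by [set_eq].
  + by have -> : g |: (e |: (q |: H :\ v :\ f :\ g)) = q |: (e |: H :\ v :\ f) by [set_eq].
- by rewrite !inE; atoms.
- by rewrite !inE; atoms.
move=> B b sB; apply/negP=> pB.
have [|B' [b' sI sU]] := @extend _ M B H (p |: (q |: (H :\ v :\ f :\ g))) mM b _ bH.
  by rewrite subUset sub1set pB.
have sB' : B' \subset p |: (q |: H).
  apply: (subset_trans sU); apply/subsetP=> z; rewrite !inE.
  by case: (z == p); case: (z == q) => //=; case: (z \in H); rewrite ?andbF.
have [||x [y [[xH xB] [yH yB] xy dd]]] := dx_of_base mM bH b' _ _ pH qH pq sB'.
- by apply: (subsetP sI); rewrite !inE eqxx.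
- by apply: (subsetP sI); rewrite !inE eqxx orbT.
have nu z : z \in H -> z \notin B' -> z != u.
  by move=> zH; apply: contraNneq => ->; apply: (subsetP sI); rewrite !inE; atoms.
exact: (no x y xH yH (nu x xH xB) (nu y yH yB) xy dd).
Qed.

(** By now [H] is [{u, v, f}] and only [p, q, e] lie outside. Pivoting [p] or [q] in for [u] removes
    the zero entry, provided the determinant of rows [u, f] and columns [e] and the entering one is
    nonzero; [rank2_exchange] grants this for [p] or for [q]. *)
Lemma bad_swap_free u p q : u \in H -> u != v -> p \in E -> q \in E ->
  p \notin H -> q \notin H -> p != e -> q != e -> p != q -> dx M H u v p q ->
  freeb (p |: (H :\ u)) \/ freeb (q |: (H :\ u)).
Proof.
move=> uH uv pE qE pH qH pe qe pq d; have c := bad_rank uH uv pE qE pH qH pe qe pq d.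
have [f ef] := cards1P (introT eqP c).
have : f \in H :\ u :\ v by rewrite ef set11.
rewrite !inE => /and3P[fv fu fH].
have vu : v != u by rewrite eq_sym.
have inH z : z \in H -> [|| z == u, z == v | z == f].
  move=> zH; have [//|zu] := eqVneq z u; have [//|zv] := eqVneq z v.
  by rewrite /= -in_set1 -ef !inE zu zv.
have key y z : y \in E -> z \in E -> y \notin H -> z \notin H -> y != e -> z != e -> y != z ->
    dx M H u v y z -> dx M H u f y e -> freeb (y |: (H :\ u)).
  move=> yE zE yH zH ye ze yz d1 d2; split; first exact: fr.
  have inE' w : w \in E -> w \notin H -> [|| w == y, w == z | w == e].
    move=> wE wH; have [ee|we] := eqVneq w e; first by rewrite ee !orbT.
    by rewrite orbF (bad_ground uH uv yE zE yH zH ye ze yz d1).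
  have d3 : dx M H f u y z by apply: dx_spread.
  have d4 := dx_bad uH uv yE yH ye.
  have d4' := dx_bad fH fv yE yH ye.
  move=> x w xH' wE wH'.
  have wS : (w == u) || (w != y) && (w \notin H).
    by move: wH'; rewrite !inE negb_or negb_and negbK => /andP[wy /orP[->//|->]]; rewrite wy orbT.
  move: xH'; rewrite !inE => /orP[/eqP ex|/andP[xu xH]].
    have -> : (y |: H :\ u) :\ x = H :\ u by rewrite ex; set_eq.
    have [->|wu] := eqVneq w u; first by rewrite setD1K.
    rewrite (negbTE wu) /= in wS; case/andP: wS => wy wH; have := inE' w wE wH.
    rewrite (negbTE wy) /= => /orP[]/eqP->; first exact: fr.
    by apply: he.
  have [->|wu] := eqVneq w u.
    have -> : u |: (y |: H :\ u) :\ x = y |: (H :\ x).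
      have yx : y != x by apply: contraNneq yH => ->.
      by set_eq.
    exact: fr.
  rewrite (negbTE wu) /= in wS; case/andP: wS => wy wH.
  have -> : (y |: H :\ u) :\ x = y |: (H :\ u :\ x).
    have yx : y != x by apply: contraNneq yH => ->.
    by set_eq.
  rewrite setUCA -/(dx M H u x y w).
  have := inE' w wE wH; have := inH x xH; rewrite (negbTE wy) (negbTE xu) /=.
  case/orP=> /eqP-> /orP[] /eqP-> //; first by rewrite dxCr.
  by rewrite dxCr.
have b1 : p |: (q |: (H :\ u :\ f)) \in bases M.
  by rewrite -/(dx M H u f p q) dxCr; apply: dx_spread.
have b2 : e |: (f |: (H :\ u :\ f)) \in bases M.
  have -> : e |: (f |: (H :\ u :\ f)) = e |: (H :\ u) by set_eq.
  exact: he.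
have [||h|h] := rank2_exchange mM b1 b2.
- by rewrite !inE eqxx.
- by apply: contraNneq eH => <-.
- by left; apply: (key p q).
right; apply: (key q p) => //; first by rewrite eq_sym.
by rewrite dxCc.
Qed.

End FreeInOctahedron.

(** Corank at least three leaves an [e] outside the octahedron, and a witness for [M \ e] lies in
    the octahedron. If one of its exchanges with [e] fails, [bad_swap_free] repairs this by a pivot
    inside [Q]. *)
Lemma free_in_oct C Q : oct M C Q -> exists2 H, freeb H & inoct H C Q.
Proof.
move=> o; have [c dj b] := o.
have [e eE eCQ] : exists2 e, e \in E & e \notin C :|: Q.
  apply/subsetPn/negP=> s; have [x [y [xQ yQ xy]]] := card4_2 c.
  have bB := b x y xQ yQ xy; have := corank3 bB; rewrite leqNgt => /negP[]; rewrite ltnS.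
  have s2 : E :\: (x |: (y |: C)) \subset Q :\ x :\ y.
    apply/subsetP=> z; rewrite !inE !negb_or => /andP[/and3P[zx zy zC] zE].
    by have := subsetP s z zE; rewrite !inE zx zy (negbTE zC).
  apply: leq_trans (subset_leq_card s2) _.
  by have := cardsD2 xQ yQ xy; rewrite c => -[<-].
move: (eCQ); rewrite inE => /norP[eC eQ].
have ro : roct M set0 [set e] C Q by apply: roct_del.
have [|H [rf val]] := excl_del exM eE; first by exists C, Q.
have io := val _ _ ro; have [bH _ dH fr] := rf.
have eH : e \notin H by rewrite disjoints1 in dH.
have fr' u p : u \in H -> p \in E -> p \notin H -> p != e -> p |: (H :\ u) \in bases M.
  by move=> uH pE pH pe; apply: fr; rewrite ?inE.
have [/forallP al|/forallPn[v]] := boolP [forall u, (u \in H) ==> (e |: (H :\ u) \in bases M)].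
  exists H => //; split=> // u p uH pE pH; have [->|pe] := eqVneq p e; last exact: fr'.
  by have := al u; rewrite uH.
rewrite negb_imply => /andP[vH nv].
have [a [a' [p [q [[aH aH' aa] [pH qH pq] defC defQ d]]]]] := at_oct mM o bH io.
have [pQ qQ] : p \in Q /\ q \in Q by rewrite defQ !inE !eqxx !orbT.
have QE z : z \in Q -> z \in E by move=> zQ; apply: (subsetP (oct_sub mM o)); rewrite inE zQ orbT.
have Qe z : z \in Q -> z != e by move=> zQ; apply: contraNneq eQ => <-.
(* A row inside [Q] that differs from the bad row [v] on [p, q], so that the repaired basis stays in
   the octahedron. *)
have [u [uH uv uC d']] : exists u, [/\ u \in H, u != v, u \in Q & dx M H u v p q].
  have [aQ aQ'] : a \in Q /\ a' \in Q by rewrite defQ !inE !eqxx !orbT.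
  have [ev|va] := eqVneq v a; first by exists a'; rewrite dxCr ev eq_sym.
  have [ev|va'] := eqVneq v a'; first by exists a; rewrite ev.
  have := dx_row mM vH aH aH' va va' aa pH qH pq (fr' _ _ vH (QE _ pQ) pH (Qe _ pQ)) d.
  by rewrite eq_sym in va; case/orP=> d'; [exists a | exists a'; rewrite dxCr eq_sym].
have sub y : y \in Q -> inoct (y |: (H :\ u)) C Q.
  move=> yQ; have /andP[s1 s2] := io; apply/andP; split.
    apply/subsetP=> z zC; rewrite !inE (subsetP s1 z zC) andbT.
    by apply/orP; right; apply: contraTneq zC => ->; apply: oct_notin o _.
  by rewrite subUset sub1set inE yQ orbT (subset_trans (subD1set _ _)).
have [] := bad_swap_free rf eE vH nv uH uv (QE _ pQ) (QE _ qQ) pH qH (Qe _ pQ) (Qe _ qQ) pq d'.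
  by exists (p |: (H :\ u)) => //; apply: sub.
by exists (q |: (H :\ u)) => //; apply: sub.
Qed.

(** * Distinct free bases are complementary *)

Lemma free_oct H u v p q : freeb H -> u \in H -> v \in H -> u != v -> p \in E -> q \in E ->
  p \notin H -> q \notin H -> p != q -> dx M H u v p q -> oct M (H :\ u :\ v) [set u; v; p; q].
Proof.
move=> fH uH vH uv pE qE pH qH pq d.
have rf : rfree M set0 set0 H by apply: freeb_rfree; rewrite ?sub0set // disjoints_subset sub0set.
by have [] := oct_at (u := u) (v := v) (p := p) (q := q) mM rf;
  rewrite // !inE ?uH ?vH ?pE ?qE ?orbF ?pH ?qH.
Qed.

(** Rank at least four allows two rows away from a common element [e] and from some [e'] in
    [H :\: H']; the octahedron there keeps both in its [C]. Because of [e'], [H'] does not lie in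
    it, so [free_avoid] keeps [e] out of [H']. *)
Lemma free_disjoint H H' : 4 <= #|H| -> freeb H -> freeb H' -> H != H' -> [disjoint H & H'].
Proof.
move=> r4 fH fH' ne; have [[bH _] [bH' _]] := (fH, fH'); apply: disjointP => e eH; apply/negP=> eH'.
have [e' e'H e'H'] : exists2 e', e' \in H & e' \notin H'.
  by apply/subsetPn; apply: contra ne => s; rewrite eqEcard s (card_bases mM bH bH') /=.
have [a [b [aH bbH ab /andP[ae be] /andP[ae' be']]]] := pick_two4 e e' r4.
have [p [q [[pE pH] [qE qH] pq d]]] := dx_cosimple bH aH bbH ab.
have o := free_oct fH aH bbH ab pE qE pH qH pq d.
have [|av _] := free_avoid fH' o.
  by apply/negP=> /andP[/subsetP/(_ e')]; rewrite !inE; atoms => /(_ isT).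
by have := av e; rewrite !inE; atoms => /(_ isT).
Qed.

(** The dual of [free_disjoint]: two columns are chosen away from [x] and from some [e'] in
    [H' :\: H], so that both stay outside the octahedron. *)
Lemma free_cover H H' x : 4 <= #|E :\: H| -> freeb H -> freeb H' -> H != H' -> x \in E -> x \notin H -> x \in H'.
Proof.
move=> r4 fH fH' ne xE xH; have [[bH _] [bH' _]] := (fH, fH').
have [e' e'H e'H'] : exists2 e', e' \in H' & e' \notin H.
  by apply/subsetPn; apply: contra ne => s; rewrite eq_sym eqEcard s (card_bases mM bH' bH) /=.
have [p [q [+ + pq /andP[pe qe] /andP[pe' qe']]]] := pick_two4 x e' r4.
rewrite !inE => /andP[pH pE] /andP[qH qE].
have [a [b [aH bbH ab d]]] := dx_simple bH pE qE pH qH pq.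
have o := free_oct fH aH bbH ab pE qE pH qH pq d.
have [|_ av] := free_avoid fH' o.
  by apply/negP=> /andP[_ /subsetP/(_ e')]; rewrite !inE; atoms => /(_ isT).
by apply: av; rewrite // !inE; atoms.
Qed.

Lemma oct_not_inoct H : freeb H -> exists C Q, oct M C Q /\ ~~ inoct H C Q.
Proof.
move=> fH; have [_ nR _] := exM.
have [/existsP[C /existsP[Q /andP[/octP o n]]]|no] :=
  boolP [exists C : {set T}, [exists Q : {set T}, octb M C Q && ~~ inoct H C Q]]; first by exists C, Q.
case: nR => _; exists H; split.
  by apply: freeb_rfree; rewrite ?sub0set // disjoints_subset sub0set.
move=> C Q [o _ _]; apply: contraNT no => n.
by apply/existsP; exists C; apply/existsP; exists Q; rewrite n andbT; apply/octP.
Qed.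

(** Otherwise rank and corank are three. An octahedron in which [H] does not lie then has [C = {p}]
    outside [H] and [Q = {v, w, q, s}], with [v, w] in [H] and [q, s] outside. It separates [p] from
    [q] and [s] on rows [u, v] and on rows [u, w], so [q] and [s] agree on all rows and would be
    parallel. *)
Lemma rank_corank4 H : freeb H -> 4 <= #|H| \/ 4 <= #|E :\: H|.
Proof.
move=> fH; have [bH fr] := fH; have [C [Q [o n]]] := oct_not_inoct fH.
case: (ltnP 3 #|H|) => [|r3]; [by left|]; case: (ltnP 3 #|E :\: H|) => [|c3]; [by right|exfalso].
have [av avE] := free_avoid fH o n; have [c dj b] := o.
have sE := oct_sub mM o.
have cH : #|H| = 3 by apply/eqP; rewrite eqn_leq r3 rank3.
have cHc : #|E :\: H| = 3 by apply/eqP; rewrite eqn_leq c3 corank3.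
have [x [y [xQ yQ xy]]] := card4_2 c.
have cC : #|C| = 1.
  by have := card_oct o xQ yQ xy; rewrite (card_bases mM (b x y xQ yQ xy) bH) cH => -[].
have [p defC] := cards1P (introT eqP cC).
have pC : p \in C by rewrite defC set11.
have pH := av p pC; have pE : p \in E by apply: (subsetP sE); rewrite inE pC.
have pQ : p \notin Q by apply: contraL dj => pQ; apply/pred0Pn; exists p; rewrite /= pC.
have cQH : #|Q :\: H| = 2.
  have e : Q :\: H = (E :\: H) :\ p.
    apply/setP=> z; rewrite !inE; case zH: (z \in H); rewrite ?andbF //=.
    apply/idP/andP=> [zQ|[zp zE]].
      by split; [apply: contraNneq pQ => <-|apply: (subsetP sE); rewrite inE zQ orbT].
    by apply: contraFT zH => zQ; apply: avE; rewrite // defC inE.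
  by have := cardsD1 p (E :\: H); rewrite !inE pH pE cHc e => -[].
have cQI : #|Q :&: H| = 2 by have := cardsID H Q; rewrite c cQH addn2 => -[].
have /cards2P[q [s [qs eqs]]] := introT eqP cQH.
have /cards2P[v [w [vw evw]]] := introT eqP cQI.
have : q \in Q :\: H by rewrite eqs !inE eqxx.
have : s \in Q :\: H by rewrite eqs !inE eqxx orbT.
rewrite !inE => /andP[sH sQ] /andP[qH qQ].
have : v \in Q :&: H by rewrite evw !inE eqxx.
have : w \in Q :&: H by rewrite evw !inE eqxx orbT.
rewrite !inE => /andP[wQ wH] /andP[vQ vH].
have [u defu] : exists u, H :\ v :\ w = [set u].
  by apply/cards1P; have := cardsD2 vH wH vw; rewrite cH => -[<-].
have : u \in H :\ v :\ w by rewrite defu set11.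
rewrite !inE => /and3P[uw uv uH].
have wv : w != v by rewrite eq_sym.
have inH z : z \in H -> [|| z == u, z == v | z == w].
  move=> zH; have [//|zv] := eqVneq z v; first by rewrite orbT.
  have [//|zw] := eqVneq z w; first by rewrite !orbT.
  by rewrite !orbF -in_set1 -defu !inE zv zw.
have eH1 : H :\ u :\ v = [set w].
  apply/setP=> z; rewrite !inE; apply/and3P/eqP=> [[zv zu zH]|->]; last by split; rewrite // eq_sym.
  by have := inH z zH; rewrite (negbTE zv) (negbTE zu) => /eqP.
have eH2 : H :\ u :\ w = [set v].
  apply/setP=> z; rewrite !inE; apply/and3P/eqP=> [[zw zu zH]|->]; last by split; rewrite // eq_sym.
  by have := inH z zH; rewrite (negbTE zw) (negbTE zu) orbF => /eqP.
have dxe a a' z : z \in Q -> a \in Q -> a != z -> H :\ u :\ a' = [set a] -> dx M H u a' p z.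
  move=> zQ aQ az e; rewrite /dx e; have -> : p |: (z |: [set a]) = a |: (z |: C).
    by rewrite defC; apply/setP=> t; rewrite !inE; case: (t == p); case: (t == z); case: (t == a).
  exact: b.
have nqs z z' : z \in H -> z' \notin H -> z != z' by move=> zH; apply: contraNneq => <-.
have fr0 a z : a \in H -> z \in E -> z \notin H -> z \notin (set0 : {set T}) -> z |: (H :\ a) \in bases M.
  by move=> aH zE zH _; apply: fr.
have QE z : z \in Q -> z \in E by move=> zQ; apply: (subsetP sE); rewrite inE zQ orbT.
have [pq ps] : p != q /\ p != s by split; apply: contraNneq pQ => ->.
have uv' : u != v by []. have uw' : u != w by [].
have n1 : ~~ dx M H u v q s.
  by apply: (dx_col3 bH fr0 uH vH uv pE (QE _ qQ) (QE _ sQ) pH qH sH); rewrite ?in_set0 //; apply: (dxe w); rewrite ?nqs.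
have n2 : ~~ dx M H u w q s.
  by apply: (dx_col3 bH fr0 uH wH uw pE (QE _ qQ) (QE _ sQ) pH qH sH); rewrite ?in_set0 //; apply: (dxe v); rewrite ?nqs.
have n3 : ~~ dx M H v w q s.
  apply/negP=> d; have := dx_row mM uH vH wH uv uw vw qH sH qs (fr _ _ uH (QE _ qQ) qH) d.
  by rewrite dxCr (negbTE n1) (negbTE n2).
have [a [a' [/inH aH /inH aH' aa d]]] := dx_simple bH (QE _ qQ) (QE _ sQ) qH sH qs.
case/or3P: aH aH' aa d => /eqP-> /or3P[]/eqP->; rewrite ?eqxx // => _;
  by rewrite ?(negbTE n1) ?(negbTE n2) ?(negbTE n3) // dxCr ?(negbTE n1) ?(negbTE n2) ?(negbTE n3).
Qed.

Lemma free_compl H H' : freeb H -> freeb H' -> H != H' -> H' = E :\: H.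
Proof.
move=> fH fH' ne; have [[bH _] [bH' _]] := (fH, fH').
(* Either bound gives the other: the first puts [H'] inside the complement of [H], the second puts
   that complement inside [H'], and the two bases have equal size. *)
have [r4 c4] : 4 <= #|H| /\ 4 <= #|E :\: H|.
  case: (rank_corank4 fH) => h; split=> //; apply: (leq_trans h).
    rewrite (card_bases mM bH bH'); apply: subset_leq_card; apply/subsetP=> z zH'.
    by rewrite inE (base_in mM bH' zH') (disjointFl (free_disjoint h fH fH' ne) zH').
  rewrite (card_bases mM bH bH'); apply: subset_leq_card; apply/subsetP=> z.
  by rewrite inE => /andP[zH zE]; apply: free_cover h fH fH' ne zE zH.
apply/setP=> z; rewrite inE; apply/idP/andP=> [zH'|[zH zE]]; last exact: free_cover c4 fH fH' ne zE zH.
by rewrite (disjointFl (free_disjoint r4 fH fH' ne) zH') (base_in mM bH' zH').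
Qed.

Lemma relaxed_pair : exists H, [/\ freeb H, freeb (E :\: H) & forall C Q, oct M C Q -> inoct H C Q || inoct (E :\: H) C Q].
Proof.
have [C0 [Q0 o0]] := excl_oct exM; have [H fH iH] := free_in_oct o0.
have [C1 [Q1 [o1 n1]]] := oct_not_inoct fH; have [H' fH' iH'] := free_in_oct o1.
have ne : H != H' by apply: contraNneq n1 => ->.
have e := free_compl fH fH' ne.
exists H; rewrite -e; split=> // C Q o; have [H2 f2 i2] := free_in_oct o.
have [eH|n2] := eqVneq H H2; first by rewrite eH i2.
by rewrite e -(free_compl fH f2 n2) i2 orbT.
Qed.

Lemma excl_in_D : in_D M.
Proof.
have [H [fH fX io]] := relaxed_pair; set X := E :\: H in fX io.
have [[bH frH] [bX frX]] := (fH, fX).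
have sH := base_sub mM bH; have sX := base_sub mM bX.
have dHX : [disjoint H & X] by apply: disjointP => z zH; rewrite inE zH.
have HX : H :|: X = E by rewrite /X setUC setDUK.
have inX z : (z \in X) = (z \notin H) && (z \in E) by rewrite inE.
have r3H := rank3 bH; have r3X := rank3 bX.
have [u uH] : exists u, u \in H by apply/card_gt0P; apply: leq_trans r3H.
have [p pX] : exists p, p \in X by apply/card_gt0P; apply: leq_trans r3X.
have [pH pE] : p \notin H /\ p \in E by apply/andP; rewrite -inX.
have uX : u \notin X by rewrite inX uH.
have uE := base_in mM bH uH.
pose N := Matroid E (bases M :\ H :\ X).
(* A basis meeting both [H] and [X] is neither of them, so it survives the removal of both. *)
have inN B w z : B \in bases M -> w \in B -> w \in H -> z \in B -> z \in X -> B \in bases N.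
  move=> b wB wH zB zX; rewrite !inE b andbT; apply/andP; split.
    by apply: contraTneq wB => ->; rewrite inX wH.
  by apply: contraTneq zB => ->; move: zX; rewrite inX => /andP[].
have oth (S : {set T}) x : 3 <= #|S| -> exists2 w, w \in S & w != x.
  by case/(pick_two x)=> a [b [aS _ _ ax _]]; exists a.
have frNH x q : x \in H -> q \in E -> q \notin H -> q |: (H :\ x) \in bases N.
  move=> xH qE qH; have [w wH wx] := oth H x r3H.
  by apply: (@inN _ w q); rewrite ?frH // ?inX ?qH // !inE ?eqxx // wx wH orbT.
have frNX x q : x \in X -> q \in E -> q \notin X -> q |: (X :\ x) \in bases N.
  move=> xX qE qX; have [w wX wx] := oth X x r3X.
  apply: (@inN _ q w); rewrite ?frX //; first by rewrite in_setU1 eqxx.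
    by move: qX; rewrite inX qE andbT negbK.
  by rewrite in_setU1 in_setD1 wx wX orbT.
have neHX : X != H by apply: contraNneq uX => ->.
have mN : is_matroid N.
  have mN1 := remove_base mM bH uH pE pH frH.
  apply: (@remove_base _ _ X p u mN1) => //=; first by rewrite !inE neHX.
  by move=> x q xX qE qX; have := frNX x q xX qE qX; rewrite !inE => /andP[].
(* It would also be an octahedron of [M], in which [H] or [X] lies and is then one of its six bases;
   but neither is a basis of [N]. *)
have octN C Q : oct N C Q -> False.
  move=> oN; have o : oct M C Q.
    by case: oN => c dj b; split=> // x y xQ yQ xy; have := b x y xQ yQ xy; rewrite !inE => /and3P[].
  have noB B : B \in bases M -> inoct B C Q -> B \in bases N.
    move=> b iB; have [a [c [s [t [[aB cB ac] _ eC eQ _]]]]] := at_oct mM o b iB.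
    have -> : B = a |: (c |: C) by rewrite eC; set_eq.
    by case: oN => _ _; apply; rewrite // eQ !inE eqxx ?orbT.
  case/orP: (io C Q o) => [/(noB _ bH)|/(noB _ bX)]; rewrite !inE eqxx //= ?andbF //.
have cp : p |: (H :\ u) \in bases N by apply: frNH.
have cardN B : B \in bases M -> #|B| = #|p |: (H :\ u)|.
  by move=> b; apply: card_bases mM b (frH _ _ uH pE pH).
have chH : circuit_hyperplane N H.
  apply: (circuit_hyperplaneI mN cp (cardN _ bH) sH) => //.
  - by rewrite !inE eqxx andbF.
  - by apply: contraTneq uH => ->; rewrite inE.
  by apply: contraNneq pH => ->.
have chX : circuit_hyperplane N X.
  apply: (circuit_hyperplaneI mN cp (cardN _ bX) sX) => //.
  - by rewrite !inE eqxx.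
  - by apply: contraTneq pX => ->; rewrite inE.
  by apply: contraNneq uX => ->.
exists N; split=> //; first exact: (binary_noct mN octN); last first.
  exists H, X; split; first by split.
  split=> //; apply/setP=> B; rewrite !inE.
  by case: (eqVneq B H) => [->|_]; rewrite ?bH //; case: (eqVneq B X) => [->|_] //; rewrite bX.
(* The fundamental circuit of [f] in [q |: (H :\ x)], with [x] and [q] chosen so that exchanging
   [x, e] for [f, q] in [H] gives a basis; this puts [e] on the circuit. A third element of [H]
   keeps that basis different from [X]. *)
have conn e f : e \in H -> f \in X -> exists C, circuit N C /\ e \in C /\ f \in C.
  move=> eH fX'; have [fH' fE] : f \notin H /\ f \in E by apply/andP; rewrite -inX.
  have [q qX qf] := oth X f r3X; have [qH qE] : q \notin H /\ q \in E by apply/andP; rewrite -inX.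
  rewrite eq_sym in qf.
  have [x [xH xe d]] : exists x, [/\ x \in H, x != e & dx M H x e f q].
    have [a [b [aH bH' ab d]]] := dx_simple bH fE qE fH' qH qf.
    have [->|ea] := eqVneq e a; first by exists b; rewrite dxCr eq_sym.
    have [->|eb] := eqVneq e b; first by exists a.
    have := dx_row mM eH aH bH' ea eb ab fH' qH qf (frH _ _ eH fE fH') d.
    rewrite eq_sym in ea; rewrite eq_sym in eb.
    by case/orP=> d'; [exists a | exists b; rewrite dxCr].
  have b : q |: (H :\ x) \in bases N by apply: frNH.
  have fB : f \notin q |: (H :\ x) by rewrite !inE negb_or qf negb_and fH' orbT.
  have cC := fundamental_circuit mN b fE fB.
  eexists; split; [exact: cC|split]; rewrite in_setU1 ?eqxx // in_set.
  rewrite in_setU1 in_setD1 (eq_sym e x) xe eH orbT /=; apply/orP; right.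
  have -> : (q |: H :\ x) :\ e = q |: (H :\ x :\ e).
    by have qe : q != e by [apply: contraNneq qH => ->]; set_eq.
  have [w [wH wx we]] : exists w, [/\ w \in H, w != x & w != e].
    have [w [w' [wH w'H ww wx w'x]]] := pick_two x r3H.
    by have [ew|we] := eqVneq w e; [exists w'; split; rewrite // eq_sym -ew | exists w].
  by apply: (@inN _ w f) => //; rewrite !inE ?eqxx // wx we wH !orbT.
move=> e f; rewrite -[ground N]HX !in_setU => /orP[eH|eX] /orP[fH'|fX'] ef.
- by exists H; split=> //; case/andP: chH.
- exact: conn.
- by have [C [cC [fC eC]]] := conn f e fH' eX; exists C.
by exists X; split=> //; case/andP: chX.
Qed.

End FreeBases.

(** * Members of D and the classification *)

Section RelaxedPair.
Variables (T : finType) (M : matroid T) (X Y : {set T}).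
Hypothesis mM : is_matroid M.
Hypothesis bX : X \in bases M.
Hypothesis bY : Y \in bases M.
Hypothesis frX : forall u p, u \in X -> p \in ground M -> p \notin X -> p |: (X :\ u) \in bases M.
Hypothesis frY : forall u p, u \in Y -> p \in ground M -> p \notin Y -> p |: (Y :\ u) \in bases M.
Hypothesis dXY : [disjoint X & Y].
Hypothesis eXY : X :|: Y = ground M.
Hypothesis cX : 2 < #|X|.
Hypothesis octXY : forall C Q, oct M C Q -> inoct X C Q || inoct Y C Q.

Lemma relaxed_pair_rR e : e \in X -> rR M [set e] set0 /\ rR M set0 [set e].
Proof.
move=> eX; have eY := disjointFr dXY eX; split=> _.
  exists X; split.
    by split=> [//|||u p uX _ pE pX _]; rewrite ?sub1set ?disjoints_subset ?sub0set //; apply: frX.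
  move=> C Q [o eC _]; case/orP: (octXY o) => // /andP[/subsetP/(_ e)].
  by rewrite -sub1set eC eY => /(_ isT).
exists Y; split.
  by split=> [//|||u p uY _ pE pY _]; rewrite ?sub0set ?disjoints1 ?eY //; apply: frY.
move=> C Q [o _]; rewrite disjoints1 => eCQ; case/orP: (octXY o) => // /andP[_ /subsetP/(_ e eX)].
by rewrite (negbTE eCQ).
Qed.

Lemma relaxed_pair_rfree : rfree M set0 set0 X.
Proof. by split=> [//|||w z wX _ zE zX _]; rewrite ?sub0set ?disjoints_subset ?sub0set //; apply: frX. Qed.

(** Two elements of the basis [Y], completed from [X], give a basis that has lost two elements of
    [X]. *)
Lemma relaxed_pair_dx : exists u v p q, [/\ u \in X :\: set0 /\ v \in X :\: set0, u != v,
  p \in ground M :\: (X :|: set0) /\ q \in ground M :\: (X :|: set0), p != q & dx M X u v p q].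
Proof.
have /card_gt1P[p [q [pY qY pq]]] : 1 < #|Y| by rewrite (card_bases mM bY bX); apply: leq_trans cX.
have [pX qX] := (disjointFl dXY pY, disjointFl dXY qY).
have [|B [b sI sU]] := @extend _ M Y X [set p; q] mM bY _ bX; first by rewrite subUset !sub1set pY.
move: (sI); rewrite subUset !sub1set => /andP[pB qB]; rewrite -setUA in sU.
have [u [u' [[uX _] [u'X _] uu d]]] := dx_of_base mM bX b pB qB (negbT pX) (negbT qX) pq sU.
by exists u, u', p, q; rewrite setD0 setU0 !inE pX qX uX u'X !(base_in mM bY).
Qed.

Lemma relaxed_pair_oct : exists C Q, oct M C Q.
Proof.
have [u [v [p [q [[uX vX] uv [pX qX] pq d]]]]] := relaxed_pair_dx.
by have [o _ _] := oct_at mM relaxed_pair_rfree uX vX uv pX qX pq d; exists (X :\ u :\ v), [set u; v; p; q].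
Qed.

Lemma relaxed_pair_rvalid H : rvalid M set0 set0 H -> rvalid M set0 set0 X.
Proof.
move=> val; have [u [v [p [q [[uX vX] uv [pX qX] pq d]]]]] := relaxed_pair_dx.
exact: (rfree_rvalid mM val relaxed_pair_rfree uX vX uv pX qX pq d).
Qed.
End RelaxedPair.

Lemma relaxed_pair_excl (T : finType) (M : matroid T) (X Y : {set T}) : is_matroid M ->
  X \in bases M -> Y \in bases M ->
  (forall u p, u \in X -> p \in ground M -> p \notin X -> p |: (X :\ u) \in bases M) ->
  (forall u p, u \in Y -> p \in ground M -> p \notin Y -> p |: (Y :\ u) \in bases M) ->
  [disjoint X & Y] -> X :|: Y = ground M -> 2 < #|X| ->
  (forall C Q, oct M C Q -> inoct X C Q || inoct Y C Q) -> excl M.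
Proof.
move=> mM bX bY frX frY dXY eXY cX octXY.
have dYX : [disjoint Y & X] by rewrite disjoint_sym.
have eYX : Y :|: X = ground M by rewrite setUC.
have cY : 2 < #|Y| by rewrite (card_bases mM bY bX).
have octYX C Q : oct M C Q -> inoct Y C Q || inoct X C Q by rewrite orbC; apply: octXY.
split=> // [r|e]; last first.
  by rewrite -eXY in_setU => /orP[] eS; [exact: (relaxed_pair_rR bX bY frX frY dXY octXY eS) | exact: (relaxed_pair_rR bY bX frY frX dYX octYX eS)].
have [u uX] : exists u, u \in X by apply/card_gt0P; apply: leq_trans cX.
have [C [Q o]] : exists C Q, oct M C Q.
  exact: (relaxed_pair_oct mM bX bY frX dXY cX).
have [|H v] := r; first by exists C, Q; apply: roct0.
have [_ vX] := relaxed_pair_rvalid mM bX bY frX dXY cX v.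
have [_ vY] := relaxed_pair_rvalid mM bY bX frY dYX cY v.
have /andP[sX _] := vX _ _ (roct0 o); have /andP[sY _] := vY _ _ (roct0 o).
have [c _ b] := o; have [x [y [xQ yQ xy]]] := card4_2 c.
have := card_oct o xQ yQ xy; rewrite -(card_bases mM bX (b x y xQ yQ xy)) => cE.
have /card_gt0P[z zC] : 0 < #|C| by rewrite -ltnS -ltnS -cE.
by have := disjointFr dXY (subsetP sX z zC); rewrite (subsetP sY z zC).
Qed.

Lemma in_D_excl (T : finType) (M : matroid T) : is_matroid M -> in_D M -> excl M.
Proof.
move=> mM [M' [mM' bM' cM' [X [Y [[chX chY dXY eXY] [eE eB]]]]]].
have bX : X \in bases M by rewrite eB setU11.
have bY : Y \in bases M by rewrite eB !inE eqxx orbT.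
have sB B : B \in bases M' -> B \in bases M by move=> b; rewrite eB !inE b !orbT.
have cXY : #|X| = #|Y| := card_bases mM bX bY.
apply: (@relaxed_pair_excl _ M X Y) => //.
- by move=> u p uX pE pX; apply: sB; apply: circuit_hyperplane_base; rewrite -?eE.
- by move=> u p uX pE pX; apply: sB; apply: circuit_hyperplane_base; rewrite -?eE.
- by rewrite eE.
(* In rank at most two, a circuit through [x] in [X] and [y] in [Y] contains neither of the circuits
   [X] and [Y], so it meets each in one element and is [{x, y}]. But [y |: (X :\ x')], with [x'] in
   [X] off the circuit, is a basis containing both. *)
- rewrite ltnNge; apply/negP=> c2.
  have [/and3P[sX nX /forall_inP iX] _] := andP chX; have [/and3P[sY nY /forall_inP iY] _] := andP chY.
  have ne (S : {set T}) : ~~ indep M' S -> exists x, x \in S.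
    by move=> nS; apply/set0Pn; apply: contraNneq nS => ->; apply: indep0.
  have [[x xX] [y yY]] := (ne _ nX, ne _ nY).
  have [yX xY] := (disjointFl dXY yY, disjointFr dXY xX).
  have [|||C [/and3P[sC nC /forall_inP iC] [xC yC]]] := cM' x y.
  + exact: (subsetP sX).
  + exact: (subsetP sY).
  + by apply: contraTneq xX => ->; rewrite yX.
  have [x' x'X x'C] : exists2 x', x' \in X & x' \notin C.
    apply/subsetPn; apply: contra nX => s; apply: indep_sub (iC y yC); apply/subsetP=> z zX.
    by rewrite !inE (subsetP s) // andbT; apply: contraTneq zX => ->; rewrite yX.
  have [y' y'Y y'C] : exists2 y', y' \in Y & y' \notin C.
    apply/subsetPn; apply: contra nY => s; apply: indep_sub (iC x xC); apply/subsetP=> z zY.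
    by rewrite !inE (subsetP s) // andbT; apply: contraTneq zY => ->; rewrite xY.
  have two (S : {set T}) a a' z : #|S| <= 2 -> a \in S -> a' \in S -> a \in C -> a' \notin C -> z \in S -> z \in C -> z = a.
    move=> cS aS a'S aC a'C zS zC; apply/eqP; apply: contraLR cS => za; rewrite -ltnNge.
    have a'a : a' != a by apply: contraNneq a'C => ->.
    have a'z : a' != z by apply: contraNneq a'C => ->.
    by apply/card_gt2P; exists a, a', z; split; split; rewrite // eq_sym.
  have cX2 : #|X| <= 2 by []. have cY2 : #|Y| <= 2 by rewrite -cXY.
  case/negP: nC; have b := circuit_hyperplane_base mM' chX x'X (subsetP sY y yY) (negbT yX).
  apply: indep_sub (indep_base b); apply/subsetP=> z zC.
  have := subsetP sC z zC; rewrite -eXY in_setU => /orP[zX|zY].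
    by rewrite (two X x x' z) // !inE xX andbT; apply/orP; right; apply: contraNneq x'C => <-.
  by rewrite (two Y y y' z) // !inE eqxx.
move=> C Q o; apply: contraT; rewrite negb_or => /andP[nX nY].
case: (binary_oct (C := C) (Q := Q) mM' bM'); have [c dj b] := o; split=> // x y xQ yQ xy.
have := b x y xQ yQ xy; rewrite eB !in_setU1.
have io : inoct (x |: (y |: C)) C Q.
  by apply/andP; split; [rewrite !setUA subsetUr | rewrite !subUset !sub1set !inE xQ yQ subsetUl !orbT].
by case/or3P=> // /eqP e; rewrite -e io in nX nY.
Qed.

Lemma loopless_of_not (T : finType) (M : matroid T) : excl M -> ~ iso M (dsum (U 2 4) (U 0 1)) -> loopless M.
Proof.
move=> exM nl e eE; have [/exists_inP[B b eB]|no] := boolP [exists B in bases M, e \in B]; first by exists B.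
case: nl; apply: (excl_loop exM eE) => B b; apply: contraNN no => eB; apply/exists_inP; by exists B.
Qed.

Lemma simple_of_not (T : finType) (M : matroid T) : excl M -> loopless M -> ~ iso M K ->
  forall e e', e \in ground M -> e' \in ground M -> e != e' ->
  exists2 B, B \in bases M & (e \in B) && (e' \in B).
Proof.
move=> exM ll nK e e' eE e'E ne.
have [/exists_inP[B b eB]|no] := boolP [exists B in bases M, (e \in B) && (e' \in B)]; first by exists B.
case: nK; apply: (excl_parallel exM ll eE e'E ne) => B b; apply: contraNN no => eB; apply/exists_inP; by exists B.
Qed.

(** Excluded middle settles the isomorphism types one by one; their failure supplies the hypotheses
    of [excl_in_D], those on cosimplicity and corank through the dual. *)
Lemma excl_classification (T : finType) (M : matroid T) : excl M ->
  [\/ iso M (U 2 5), iso M K, iso M R6 | iso M (dsum (U 2 4) (U 0 1))] \/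
  [\/ iso (dual M) (U 2 5), iso (dual M) K | iso (dual M) (dsum (U 2 4) (U 0 1))] \/ in_D M.
Proof.
move=> exM; have [mM _ _] := exM; have exD := excl_dual exM.
have [n|nU25] := classic (iso M (U 2 5)); first by left; constructor 1.
have [n|nK] := classic (iso M K); first by left; constructor 2.
have [n|nR6] := classic (iso M R6); first by left; constructor 3.
have [n|nloop] := classic (iso M (dsum (U 2 4) (U 0 1))); first by left; constructor 4.
have [n|nU35] := classic (iso (dual M) (U 2 5)); first by right; left; constructor 1.
have [n|nKs] := classic (iso (dual M) K); first by right; left; constructor 2.
have [n|ncoloop] := classic (iso (dual M) (dsum (U 2 4) (U 0 1))); first by right; left; constructor 3.
have ll := loopless_of_not exM nloop; have llD := loopless_of_not exD ncoloop.
have sM := simple_of_not exM ll nK; have sD := simple_of_not exD llD nKs.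
right; right; apply: excl_in_D => //.
- move=> e e' eE e'E ne; have [B b /andP[eB e'B]] := sD e e' eE e'E ne.
  have [b' sB] := dual_base mM b; exists (ground M :\: B) => //.
  by rewrite !inE eB e'B.
- by move=> B b; rewrite ltnNge; apply/negP=> c2; case: nU25; apply: excl_rank2 => //; exists B.
move=> B b; rewrite ltnNge; apply/negP=> c2; case: nU35; apply: excl_rank2 => //.
by exists (ground M :\: B); rewrite ?base_dual ?(base_sub mM).
Qed.

Lemma iso_excl (T T' : finType) (M : matroid T) (N : matroid T') : is_matroid M ->
  (forall B, B \in bases N -> B \subset ground N) -> ground N != set0 -> excl_core N -> iso M N -> excl M.
Proof.
move=> mM sN /set0Pn[y yN] eN i; have [f [_ e _]] := i.
by move: yN; rewrite -e => /imsetP[x xM _]; apply: (excl_core_iso xM mM sN i eN).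
Qed.

Lemma iso_dualE (T T' : finType) (M : matroid T) (N : matroid T') : is_matroid M ->
  (forall B, B \in bases N -> B \subset ground N) -> iso (dual M) N <-> iso M (dual N).
Proof.
move=> mM sN; have sM B := @base_sub _ M B mM.
have sD B := @base_sub _ (dual M) B (dual_matroid mM).
have sND B : B \in bases (dual N) -> B \subset ground (dual N) by case/imsetP=> X _ ->; apply: subsetDl.
split=> [/(iso_dual sD sN)|/(iso_dual sM sND)]; first by rewrite dualK.
by rewrite dualK_sub.
Qed.

Theorem theorem1p2 (T : finType) (M : matroid T) :
  is_matroid M ->
  (excluded_minor_R M <->
   (iso M (U 2 5) \/ iso M (U 3 5) \/ iso M K \/ iso M Kstar \/ iso M R6 \/
    iso M (dsum (U 2 4) (U 1 1)) \/ iso M (dsum (U 2 4) (U 0 1)) \/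
    in_D M)).
Proof.
move=> mM; have mD := dual_matroid mM.
have sU B : B \in bases (U 2 5) -> B \subset ground (U 2 5) by move=> _; apply: subsetT.
have sR B : B \in bases R6 -> B \subset ground R6 by move=> _; apply: subsetT.
have gT n : [set: 'I_n.+1] != set0 by apply/set0Pn; exists ord0.
have gd : ground (dsum (U 2 4) (U 0 1)) != set0.
  by apply/set0Pn; exists (inl ord0); rewrite inE; apply/orP; left; apply: imset_f.
have exU (N : matroid T) mN := iso_excl (M := N) mN sU (gT _) excl_core_U25.
have exK (N : matroid T) mN := iso_excl (M := N) mN K_sub (gT _) excl_core_K.
have exd (N : matroid T) mN := iso_excl (M := N) mN (@dsum_sub 0) gd excl_core_dsum.
have dl : excl (dual M) -> excl M by move/excl_dual; rewrite dualK.
have iU := iso_dualE mM sU; have iK := iso_dualE mM K_sub; have id := iso_dualE mM (@dsum_sub 0).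
rewrite dual_U25 in iU; rewrite dual_dsum in id; rewrite -/Kstar in iK.
apply: iff_trans (excluded_excl mM) _; split.
  case/excl_classification => [[]|[[]|]]; try tauto.
case=> [/(exU _ mM)//|[/iU/(exU _ mD)/dl//|[/(exK _ mM)//|[/iK/(exK _ mD)/dl//|[|]]]]].
  exact: (iso_excl mM sR (gT _) excl_core_R6).
by case=> [/id/(exd _ mD)/dl//|[/(exd _ mM)//|/(in_D_excl mM)]].
Qed.
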